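(* Let $Q$ be a Dynkin quiver of finite type $A_n$. (a) For all $\alpha,\beta\in\Phi_n^+$ with $\gamma=\alpha+\beta\in\Phi_n^+$ and $\alpha\prec_Q\beta$, there is a surjective homomorphism $$S_Q(\beta)\circ S_Q(\alpha)\twoheadrightarrow S_Q(\gamma)\quad\text{in }\mathrm{Rep}(R_{A_n}),$$ and hence a surjective homomorphism $$V_Q(\beta)\otimes V_Q(\alpha)\twoheadrightarrow V_Q(\gamma)\quad\text{in }\mathscr C^{(1)}_Q.$$ (b) For every $\beta\in\Phi_n^+$ there exists a sequence $(i_1,i_2,\dots,i_{|\beta|})\in I_0^{|\beta|}$ and a surjective homomorphism $V_Q(\alpha_{i_1})\otimes V_Q(\alpha_{i_2})\otimes\cdots\otimes V_Q(\alpha_{i_{|\beta|}})\twoheadrightarrow V_Q(\beta)$.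
   Context: ROOTS AND QUIVERS. Let $n\ge 1$, $I_0=\{1,\dots,n\}$, and consider the root system of type $A_n$ with simple roots $\alpha_1,\dots,\alpha_n$ ($i,j$ adjacent in the Dynkin diagram iff $|i-j|=1$), simple reflections $s_i$, bilinear form $(\ ,\ )$ with $(\alpha_i,\alpha_i)=2$, and longest Weyl group element $w_0$. Positive roots: $\Phi_n^+=\{[a,b]\mid 1\le a\le b\le n\}$, $[a,b]=\sum_{k=a}^b\alpha_k$. The height of $\beta=\sum k_i\alpha_i$ is $|\beta|=\sum k_i$. A Dynkin quiver $Q$ of type $A_n$ is an orientation of the Dynkin diagram. A vertex is a source if only exiting arrows are incident with it; $s_iQ$ reverses all arrows incident with $i$. A reduced expression $s_{i_1}\cdots s_{i_l}$ is adapted to $Q$ if $i_k$ is a source of $s_{i_{k-1}}\cdots s_{i_1}Q$ for all $k$. AR QUIVER. There is a unique Coxeter element $\tau$ whose reduced expressions are adapted to $Q$. Fix $\xi:I_0\to\mathbb Z$ with $\xi_j=\xi_i-1$ for each arrow $i\to j$. Put $\gamma_i=\sum_j\alpha_j$ over all $j$ with a (possibly trivial) path in $Q$ from $j$ to $i$, and $m_i=\max\{k\ge0\mid\tau^k(\gamma_i)\in\Phi_n^+\}$. $\Gamma_Q$ has vertices $(i,\xi_i-2k)$ ($i\in I_0$, $0\le k\le m_i$) and arrows $(i,p)\to(j,p+1)$ for $|i-j|=1$. The map $\phi(i,\xi_i-2k)=\tau^k(\gamma_i)$ is a bijection of the vertices onto $\Phi_n^+$ (used as identification). $\alpha\preceq_Q\beta$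 iff there is a path from $\beta$ to $\alpha$ in $\Gamma_Q$. QUIVER HECKE ALGEBRA. $\mathbf k$ is the algebraic closure of $\mathbb C(q)$ in $\bigcup_{m>0}\mathbb C((q^{1/m}))$. Put $\mathcal Q_{i,i}=0$, $\mathcal Q_{i,j}(u,v)=1$ if $|i-j|>1$, $\mathcal Q_{i,j}(u,v)=\varepsilon_{ij}(u-v)$ if $|i-j|=1$, for fixed signs $\varepsilon_{ij}=-\varepsilon_{ji}\in\{\pm1\}$. $R(m)$ is the graded $\mathbf k$-algebra generated by $e(\nu)$ ($\nu\in I_0^m$), $x_1,\dots,x_m$, $\psi_1,\dots,\psi_{m-1}$ with relations: $e(\nu)e(\nu')=\delta_{\nu\nu'}e(\nu)$, $\sum_\nu e(\nu)=1$, $x_ke(\nu)=e(\nu)x_k$, $x_kx_l=x_lx_k$, $\psi_le(\nu)=e(s_l\nu)\psi_l$, $\psi_k\psi_l=\psi_l\psi_k$ if $|k-l|>1$, $\psi_k^2e(\nu)=\mathcal Q_{\nu_k,\nu_{k+1}}(x_k,x_{k+1})e(\nu)$, $(\psi_kx_l-x_{s_k(l)}\psi_k)e(\nu)=-e(\nu)$, $e(\nu)$, $0$ according as ($l=k$, $\nu_k=\nu_{k+1}$), ($l=k+1$, $\nu_k=\nu_{k+1}$), or otherwise, and $(\psi_{k+1}\psi_k\psi_{k+1}-\psi_k\psi_{k+1}\psi_k)e(\nu)=\delta_{\nu_k,\nu_{k+2}}\frac{\mathcal Q_{\nu_k,\nu_{k+1}}(x_k,x_{k+1})-\mathcal Q_{\nu_k,\nu_{k+1}}(x_{k+2},x_{k+1})}{x_k-x_{k+2}}e(\nu)$.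 Degrees: $\deg e(\nu)=0$, $\deg x_k=2$, $\deg\psi_le(\nu)=-(\alpha_{\nu_l},\alpha_{\nu_{l+1}})$. $R(\beta)=R(m)e(\beta)$, $e(\beta)=\sum_{\alpha_{\nu_1}+\cdots+\alpha_{\nu_m}=\beta}e(\nu)$. $\mathrm{Rep}(R_{A_n})$ is the category of finite-dimensional graded modules over the $R(m)$, $m\ge0$, and $M\circ N=R(m+m')\otimes_{R(m)\otimes R(m')}(M\otimes N)$ is the convolution product. Morphisms and isomorphisms are understood up to grading shift. THE MODULES $S_Q(\beta)$. A reduced expression $\widetilde w_0=s_{i_1}\cdots s_{i_N}$ of $w_0$ gives a convex total order on $\Phi_n^+$: $\beta_z=s_{i_1}\cdots s_{i_{z-1}}\alpha_{i_z}$, $\beta_x<\beta_y$ iff $x<y$. A pair $(\alpha,\beta)$ with $\alpha<\beta$ is a minimal pair of $\gamma$ if $\gamma=\alpha+\beta$ and there is no pair with $\gamma=\alpha'+\beta'$, $\alpha<\alpha'<\gamma<\beta'<\beta$. It is known that there are simple $R(\beta)$-modules $S_{\widetilde w_0}(\beta)$ ($\beta\in\Phi_n^+$), determined up to isomorphism by: $S_{\widetilde w_0}(\alpha_i)$ is the one-dimensional $R(\alpha_i)$-module; for any minimal pair $(\alpha,\beta)$ of $\gamma$, $S_{\widetilde w_0}(\gamma)$ is the unique simple quotient of $S_{\widetilde w_0}(\beta)\circ S_{\widetilde w_0}(\alpha)$. For $\widetilde w_0$ adapted to $Q$ these do not depend on the choice of $\widetilde w_0$ and are denoted $S_Q(\beta)$.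 THE MODULES $V_Q(\beta)$. $U'_q(A_n^{(1)})$ is the $\mathbf k$-algebra generated by $e_j,f_j,K_j^{\pm1}$ ($j\in\mathbb Z/(n+1)$) with the standard quantum affine relations for the Cartan matrix $(a_{ij})$ of type $A_n^{(1)}$ (with $K_ie_jK_i^{-1}=q^{a_{ij}}e_j$), and coproduct $\Delta(K_j)=K_j\otimes K_j$, $\Delta(e_j)=e_j\otimes K_j^{-1}+1\otimes e_j$, $\Delta(f_j)=f_j\otimes1+K_j\otimes f_j$. The fundamental module $V(\varpi_i)$ ($1\le i\le n$) has basis $v_A$, $A\subset\mathbb Z/(n+1)$, $|A|=i$; $e_jv_A=v_{(A\setminus\{j+1\})\cup\{j\}}$ if $j+1\in A$, $j\notin A$, and $0$ otherwise; $f_jv_A=v_{(A\setminus\{j\})\cup\{j+1\}}$ if $j\in A$, $j+1\notin A$, and $0$ otherwise; $K_jv_A=q^{[j\in A]-[j+1\in A]}v_A$. For $x\in\mathbf k^\times$, $M_x$ is $M$ with the actions of $e_0$ and $f_0$ multiplied by $x$ and $x^{-1}$. Then $V_Q(\beta)=V(\varpi_i)_{(-q)^p}$ where $\phi^{-1}(\beta)=(i,p)$. $\mathscr C^{(1)}_Q$ is the smallest abelian full subcategory of the finite-dimensional integrable $U_q'(A_n^{(1)})$-modules that contains all $V_Q(\beta)$, $\beta\in\Phi^+_n$, and is stable under subquotients, tensor products and extensions.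
   Formalization: In the definition of Γ_Q, m_i is taken as the largest k such that γ_i, τ(γ_i), …, τ^k(γ_i) are all positive roots, because τ has finite order and the literal maximum max{k ≥ 0 | τ^k(γ_i) ∈ Φ_n^+} does not exist. *)

(* Defs.v *)
From HB Require Import structures.
From mathcomp Require Import all_boot all_order all_algebra.
From mathcomp Require Import generic_quotient ring_quotient.
From mathcomp Require Import boolp classical_sets reals complex mxtens.
From mathcomp.multinomials Require Import monalg.

Set Implicit Arguments.
Unset Strict Implicit.
Unset Printing Implicit Defensive.
Import Order.TTheory GRing.Theory Num.Theory.
Local Open Scope ring_scope.

(* Vertices 1..n of the diagram A_n are the ordinals 0..n-1; the root lattice
   is 'rV[int]_n in the basis of simple roots. *)
Section Roots.
Variable n : nat.
Implicit Types (i j : 'I_n) (b : 'rV[int]_n) (w : seq 'I_n) (Q : rel 'I_n).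

Definition adjacent i j : bool := (i == j.+1 :> nat) || (j == i.+1 :> nat).

Definition cartan i j : int :=
  if i == j then 2 else if adjacent i j then -1 else 0.

Definition alpha i : 'rV[int]_n := delta_mx 0 i.

Definition pairing b b' : int := \sum_i \sum_j b 0 i * cartan i j * b' 0 j.

Definition reflection i b : 'rV[int]_n := b - pairing b (alpha i) *: alpha i.

Definition segment i j : 'rV[int]_n := \sum_(k < n | (i <= k <= j)%N) alpha k.

Definition posroot b : Prop := exists i j, (i <= j)%N /\ b = segment i j.

(* For b = \sum_i k_i alpha_i with k_i >= 0 this is \sum_i k_i. *)
Definition height b : nat := (\sum_i `|b ord0 i|)%N.

Definition weyl w b : 'rV[int]_n := foldr reflection b w.

Definition reduced w : Prop :=
  forall w', weyl w' =1 weyl w -> (size w <= size w')%N.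

Definition reduced_longest w : Prop :=
  reduced w /\ forall w', reduced w' -> (size w' <= size w)%N.

Fixpoint root_seq w : seq 'rV[int]_n :=
  if w is i :: w' then alpha i :: map (reflection i) (root_seq w') else [::].

Definition root_lt w b b' : Prop :=
  [/\ b \in root_seq w, b' \in root_seq w
    & (index b (root_seq w) < index b' (root_seq w))%N].

Definition minimal_pair w (a b g : 'rV[int]_n) : Prop :=
  [/\ g = a + b, root_lt w a b
    & ~ exists a' b', [/\ g = a' + b', root_lt w a a', root_lt w a' g,
                          root_lt w g b' & root_lt w b' b]].

Definition dynkin_quiver Q : Prop :=
  forall i j, (Q i j || Q j i) = adjacent i j /\ ~~ (Q i j && Q j i).

Definition source Q i : bool := [forall j, ~~ Q j i].

Definition flip_at i Q : rel 'I_n :=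
  fun j k => if (j == i) || (k == i) then Q k j else Q j k.

Fixpoint adapted Q w : bool :=
  if w is i :: w' then source Q i && adapted (flip_at i Q) w' else true.

(* c is a reduced expression of the Coxeter element tau adapted to Q. *)
Definition adapted_coxeter Q w : bool :=
  perm_eq w (enum 'I_n) && adapted Q w.

Definition height_function Q (xi : 'I_n -> int) : Prop :=
  forall i j, Q i j -> xi j = xi i - 1.

End Roots.

Section AuslanderReiten.
Variables (n : nat) (Q : rel 'I_n) (c : seq 'I_n) (xi : 'I_n -> int).
Implicit Types (v : 'I_n * int) (b : 'rV[int]_n).

Definition gamma (i : 'I_n) : 'rV[int]_n := \sum_(j | connect Q j i) alpha j.

Definition tau_gamma k (i : 'I_n) : 'rV[int]_n := iter k (weyl c) (gamma i).

(* ar_phi v b: v is a vertex of the AR quiver and phi(v) = b.  As tau has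
   finite order, the maximum defining m_i is that of the k such that
   tau^l(gamma_i) is positive for all l <= k. *)
Definition ar_phi v b : Prop :=
  exists k : nat,
    [/\ forall l, (l <= k)%N -> posroot (tau_gamma l v.1),
        v.2 = xi v.1 - (2 * k)%:Z & b = tau_gamma k v.1].

Definition ar_vertex v : Prop := exists b, ar_phi v b.

Definition ar_arrow v v' : Prop :=
  [/\ ar_vertex v, ar_vertex v', adjacent v.1 v'.1 & v'.2 = v.2 + 1].

Inductive ar_path : 'I_n * int -> 'I_n * int -> Prop :=
| Ar_path_nil v : ar_path v v
| Ar_path_cons v v' v'' : ar_arrow v v' -> ar_path v' v'' -> ar_path v v''.

Definition ar_le b b' : Prop :=
  exists v v', [/\ ar_phi v b, ar_phi v' b' & ar_path v' v].

Definition ar_lt b b' : Prop := ar_le b b' /\ b <> b'.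

(* phi^-1(b), with the diagram vertex numbered from 1. *)
Definition ar_coord b : nat * int :=
  xget (0%N, 0) (fun ip => exists2 v, ar_phi v b & ip = (v.1.+1, v.2)).

End AuslanderReiten.

Section QuotientModule.
Variables (R : nzRingType) (V : lmodType R) (S : V -> Prop).

Inductive submod_span : V -> Prop :=
| Span_gen v : S v -> submod_span v
| Span_0 : submod_span 0
| Span_lin a u v : submod_span u -> submod_span v -> submod_span (a *: u + v).

Definition in_span : {pred V} := fun v => `[< submod_span v >].

Lemma in_spanB : zmod_closed in_span.
Proof.
split=> [|u v /asboolP hu /asboolP hv]; apply/asboolP; first exact: Span_0.
by rewrite addrC -scaleN1r; apply: Span_lin.
Qed.

HB.instance Definition _ := GRing.isZmodClosed.Build V in_span in_spanB.

Definition quot_mod := Quotient.quot in_span.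
HB.instance Definition _ := GRing.Zmodule.on quot_mod.

Definition quot_pi (v : V) : quot_mod := \pi_(Quotient.quot in_span)%qT v.

Lemma quot_pi_eq u v : submod_span (u - v) -> quot_pi u = quot_pi v.
Proof.
move=> h; apply/eqP.
have: u - v \in in_span by apply/asboolP.
by rewrite (Quotient.idealrBE in_span u v).
Qed.

Lemma quot_pi_span u v : quot_pi u = quot_pi v -> submod_span (u - v).
Proof.
move=> h; have /asboolP // : u - v \in in_span.
by rewrite (Quotient.idealrBE in_span u v); apply/eqP.
Qed.

Lemma quot_piD u v : quot_pi (u + v) = quot_pi u + quot_pi v.
Proof. by rewrite /quot_pi raddfD. Qed.

Definition quot_scale (a : R) (x : quot_mod) : quot_mod :=
  quot_pi (a *: repr (x : Quotient.quot in_span)).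

Lemma quot_piK (x : quot_mod) : quot_pi (repr (x : Quotient.quot in_span)) = x.
Proof. exact: reprK. Qed.

Lemma quot_piZ a v : quot_scale a (quot_pi v) = quot_pi (a *: v).
Proof.
apply: quot_pi_eq; rewrite -scalerBr -[_ *: _]addr0.
by apply: Span_lin; [apply/quot_pi_span/quot_piK | exact: Span_0].
Qed.

Lemma quot_scaleA a b x : quot_scale a (quot_scale b x) = quot_scale (a * b) x.
Proof. by rewrite -[x]quot_piK !quot_piZ scalerA. Qed.

Lemma quot_scale1 : left_id 1 quot_scale.
Proof. by move=> x; rewrite -[x]quot_piK quot_piZ scale1r. Qed.

Lemma quot_scaleDr : right_distributive quot_scale +%R.
Proof.
move=> a x y; rewrite -[x]quot_piK -[y]quot_piK -quot_piD !quot_piZ.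
by rewrite scalerDr quot_piD.
Qed.

Lemma quot_scaleDl x : {morph quot_scale^~ x : a b / a + b}.
Proof.
by move=> a b; rewrite /= -[x]quot_piK !quot_piZ scalerDl quot_piD.
Qed.

HB.instance Definition _ := GRing.Zmodule_isLmodule.Build R quot_mod
  quot_scaleA quot_scale1 quot_scaleDr quot_scaleDl.

End QuotientModule.

(* The algebra R(m) is presented by generators and relations, inside the free
   algebra on e(nu), x_k, psi_l for all words nu and all k, l in nat (numbered
   from 0); the generators that do not occur in R(m) are put to zero. *)
Section QuiverHecke.
Variables (K : fieldType) (n : nat) (eps : 'I_n -> 'I_n -> K).

Definition klr_gen : Type := (seq 'I_n + (nat + nat))%type.
HB.instance Definition _ := Choice.on klr_gen.

Definition klr_free : Type := {malg K[{fmonom klr_gen}]}.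
HB.instance Definition _ := GRing.Lalgebra.on klr_free.

Definition free_gen (g : klr_gen) : klr_free := << fmu g >>.
Definition gE (nu : seq 'I_n) : klr_free := free_gen (inl nu).
Definition gX (k : nat) : klr_free := free_gen (inr (inl k)).
Definition gP (l : nat) : klr_free := free_gen (inr (inr l)).

Definition klr_Q (i j : 'I_n) (u v : klr_free) : klr_free :=
  if i == j then 0 else if adjacent i j then eps i j *: (u - v) else 1.

(* (Q_ij(u,v) - Q_ij(w,v)) / (u - w). *)
Definition klr_dQ (i j : 'I_n) : K := if adjacent i j then eps i j else 0.

Definition transp (k l : nat) : nat :=
  if l == k then k.+1 else if l == k.+1 then k else l.

Inductive klr_rel (m : nat) : klr_free -> Prop :=
| Klr_E_out nu : size nu != m -> klr_rel m (gE nu)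
| Klr_X_out k : (m <= k)%N -> klr_rel m (gX k)
| Klr_P_out l : (m <= l.+1)%N -> klr_rel m (gP l)
| Klr_EE nu nu' :
    klr_rel m (gE nu * gE nu' - if nu == nu' then gE nu else 0)
| Klr_E1 : klr_rel m (\sum_(nu : m.-tuple 'I_n) gE nu - 1)
| Klr_XE k nu : klr_rel m (gX k * gE nu - gE nu * gX k)
| Klr_XX k l : klr_rel m (gX k * gX l - gX l * gX k)
| Klr_PE mu i j mu' : let l := size mu in
    klr_rel m (gP l * gE (mu ++ [:: i, j & mu'])
               - gE (mu ++ [:: j, i & mu']) * gP l)
| Klr_PP k l : (k.+1 < l)%N -> klr_rel m (gP k * gP l - gP l * gP k)
| Klr_PPE mu i j mu' : let k := size mu in
    let e := gE (mu ++ [:: i, j & mu']) in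
    klr_rel m (gP k ^+ 2 * e - klr_Q i j (gX k) (gX k.+1) * e)
| Klr_PX mu i j mu' l : let k := size mu in
    let e := gE (mu ++ [:: i, j & mu']) in
    klr_rel m ((gP k * gX l - gX (transp k l) * gP k) * e
               - (if i == j then
                    if l == k then - e else if l == k.+1 then e else 0
                  else 0))
| Klr_PPP mu h i j mu' : let k := size mu in
    let e := gE (mu ++ [:: h, i, j & mu']) in
    klr_rel m ((gP k.+1 * gP k * gP k.+1 - gP k * gP k.+1 * gP k) * e
               - (if h == j then klr_dQ h i *: e else 0)).

(* An R(m)-module is a module over the free algebra killed by the relations.
   The grading is kept apart, as a family of subsets; see klr_graded. *)
Record klr_mod (m : nat) := KlrMod {
  klr_sort :> lmodType klr_free;
  klr_relP : forall r, klr_rel m r -> forall u : klr_sort, r *: u = 0;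
  klr_deg : int -> klr_sort -> Prop }.
Arguments klr_deg [m] k _ _.

Section Modules.
Variables (m : nat) (M : klr_mod m).

Record klr_graded : Prop := KlrGraded {
  klr_deg_lin : forall d (a : K) u v,
    klr_deg M d u -> klr_deg M d v -> klr_deg M d (a%:A *: u + v);
  klr_deg0 : forall d, klr_deg M d 0;
  klr_degE : forall d nu u, klr_deg M d u -> klr_deg M d (gE nu *: u);
  klr_degX : forall d k u, klr_deg M d u -> klr_deg M (d + 2) (gX k *: u);
  klr_degP : forall d mu i j mu' u, klr_deg M d u ->
    klr_deg M (d - cartan i j)
      ((gP (size mu) * gE (mu ++ [:: i, j & mu'])) *: u);
  klr_deg_gen : forall u, exists (s : seq int) (f : int -> M),
    (forall d, klr_deg M d (f d)) /\ u = \sum_(d <- s) f d;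
  klr_deg_direct : forall (s : seq int) (f : int -> M), uniq s ->
    (forall d, klr_deg M d (f d)) -> \sum_(d <- s) f d = 0 ->
    forall d, d \in s -> f d = 0 }.

Definition klr_findim : Prop :=
  exists s : seq M, forall u, exists a : nat -> K,
    u = \sum_(k < size s) (a k)%:A *: s`_k.

Definition klr_onedim : Prop :=
  exists2 u : M, u != 0 & forall v, exists a : K, v = a%:A *: u.

(* e(b) acts as the identity: M is an R(b)-module. *)
Definition klr_weight (b : 'rV[int]_n) : Prop :=
  forall nu, \sum_(i <- nu) alpha i != b -> forall u : M, gE nu *: u = 0.

Definition klr_graded_submod (U : M -> Prop) : Prop :=
  [/\ U 0, forall (a : klr_free) u v, U u -> U v -> U (a *: u + v)
    & forall u, U u -> exists (s : seq int) (f : int -> M),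
        (forall d, klr_deg M d (f d) /\ U (f d)) /\ u = \sum_(d <- s) f d].

Definition klr_simple : Prop :=
  (exists u : M, u != 0) /\
  forall U, klr_graded_submod U -> (forall u, U u -> u = 0) \/ (forall u, U u).

End Modules.

(* Homogeneous homomorphisms of some degree, that is, graded homomorphisms up
   to a grading shift. *)
Definition klr_homogeneous m m' (M : klr_mod m) (N : klr_mod m')
    (f : M -> N) : Prop :=
  exists d0, forall d u, klr_deg M d u -> klr_deg N (d + d0) (f u).

Definition klr_epi m m' (M : klr_mod m) (N : klr_mod m')
    (f : {linear M -> N}) : Prop :=
  klr_homogeneous f /\ forall v, exists u, f u = v.

Definition klr_iso m m' (M : klr_mod m) (N : klr_mod m')
    (f : {linear M -> N}) : Prop :=
  klr_homogeneous f /\ bijective f.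

Definition klr_unique_simple_quotient m m' (M : klr_mod m) (N : klr_mod m') :
    Prop :=
  klr_simple N /\
  exists2 f : {linear M -> N}, klr_epi f &
    forall (N' : klr_mod m) (f' : {linear M -> N'}),
      klr_graded N' -> klr_simple N' -> klr_epi f' ->
      exists2 g : {linear N -> N'}, klr_iso g & f' =1 g \o f.

(* R(m + m') \otimes_{R(m) \otimes R(m')} (M \otimes N), as a quotient of the
   free module with basis the symbols u # v. *)
Section Convolution.
Variables (m m' : nat) (M : klr_mod m) (N : klr_mod m').

Definition conv_free : Type := {malg klr_free[(M * N)%type]}.
HB.instance Definition _ := GRing.Lmodule.on conv_free.

Definition conv_sym (u : M) (v : N) : conv_free := << (u, v) >>.
Local Notation "u # v" := (conv_sym u v) (at level 40).

Inductive conv_rel : conv_free -> Prop :=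
| Conv_klr r a u v : klr_rel (m + m') r -> conv_rel ((r * a) *: (u # v))
| Conv_linl (a : K) u u' v :
    conv_rel ((a%:A *: u + u') # v - (a%:A *: (u # v) + u' # v))
| Conv_linr (a : K) u v v' :
    conv_rel (u # (a%:A *: v + v') - (a%:A *: (u # v) + u # v'))
| Conv_E nu nu' u v : size nu = m -> size nu' = m' ->
    conv_rel (gE (nu ++ nu') *: (u # v) - (gE nu *: u) # (gE nu' *: v))
| Conv_Xl k u v : (k < m)%N ->
    conv_rel (gX k *: (u # v) - (gX k *: u) # v)
| Conv_Xr k u v : (k < m')%N ->
    conv_rel (gX (m + k) *: (u # v) - u # (gX k *: v))
| Conv_Pl l u v : (l.+1 < m)%N ->
    conv_rel (gP l *: (u # v) - (gP l *: u) # v)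
| Conv_Pr l u v : (l.+1 < m')%N ->
    conv_rel (gP (m + l) *: (u # v) - u # (gP l *: v)).

Definition conv_sort : lmodType klr_free := quot_mod conv_rel.

Definition conv_pi (z : conv_free) : conv_sort := quot_pi conv_rel z.

Lemma conv_relP r : klr_rel (m + m') r -> forall z : conv_sort, r *: z = 0.
Proof.
move=> hr z; rewrite -[z]quot_piK [_ *: _]quot_piZ -[RHS]quot_piK.
apply: etrans (_ : quot_pi conv_rel 0 = _); last first.
  by rewrite quot_piK; apply: (raddf0 (\pi_(Quotient.quot (in_span conv_rel))%qT)).
apply: quot_pi_eq; rewrite subr0.
move: (repr _) => {}z; rewrite [z]monalgE scaler_sumr.
elim/big_ind: _ => [|x y hx hy|[u v] _]; first exact: Span_0.
  by rewrite -[x]scale1r; apply: Span_lin.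
suff -> : r *: << z@_(u, v) *g (u, v) >> = (r * z@_(u, v)) *: (u # v).
  exact/Span_gen/Conv_klr.
rewrite -scalerA; congr (_ *: _); apply/malgP => k.
by rewrite mcoeffZ !mcoeffU mulrnAr mulr1.
Qed.

(* The grading is the image of that of R(m + m') \otimes M \otimes N. *)
Inductive conv_deg : int -> conv_sort -> Prop :=
| Conv_deg_sym d d' u v : klr_deg M d u -> klr_deg N d' v ->
    conv_deg (d + d') (conv_pi (u # v))
| Conv_deg_0 d : conv_deg d 0
| Conv_deg_lin d (a : K) z z' : conv_deg d z -> conv_deg d z' ->
    conv_deg d (a%:A *: z + z')
| Conv_deg_E d nu z : conv_deg d z -> conv_deg d (gE nu *: z)
| Conv_deg_X d k z : conv_deg d z -> conv_deg (d + 2) (gX k *: z)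
| Conv_deg_P d mu i j mu' z : conv_deg d z ->
    conv_deg (d - cartan i j)
      ((gP (size mu) * gE (mu ++ [:: i, j & mu'])) *: z).

Definition conv : klr_mod (m + m') := KlrMod conv_relP conv_deg.

End Convolution.
End QuiverHecke.

Section SimpleModules.
Variables (K : fieldType) (n : nat) (eps : 'I_n -> 'I_n -> K).
Implicit Types (w : seq 'I_n) (Q : rel 'I_n).

Definition klr_signs : Prop :=
  forall i j, adjacent i j ->
    (eps i j = 1 \/ eps i j = -1) /\ eps i j = - eps j i.

Definition root_modules : Type :=
  forall b : 'rV[int]_n, klr_mod eps (height b).

(* S is the family S_w, where w is a reduced expression of w_0. *)
Record is_S_word w (S : root_modules) : Prop := IsSWord {
  S_word_simple : forall b, posroot b ->
    [/\ klr_graded (S b), klr_findim (S b), klr_weight (S b) b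
      & klr_simple (S b)];
  S_word_alpha : forall i, klr_onedim (S (alpha i));
  S_word_pair : forall a b g, posroot g -> minimal_pair w a b g ->
    klr_unique_simple_quotient (conv (S b) (S a)) (S g) }.

Definition is_S_quiver Q (S : root_modules) : Prop :=
  exists w, [/\ reduced_longest w, adapted Q w & is_S_word w S].

End SimpleModules.

(* Finite-dimensional modules are given by the matrices, acting on column
   vectors, of the generators e_j, f_j, K_j, K_j^-1 with j in Z/(n+1) = 'I_n.+1.
   The defining relations of the algebra are the predicate Uq_module; the
   tensor product is computed by the coproduct on generators. *)
Section QuantumAffine.
Variables (K : fieldType) (q : K) (n : nat).
Implicit Types (i j : 'I_n.+1) (A B : {set 'I_n.+1}).

Record uq_rep := UqRep {
  uq_dim : nat;
  uq_e : 'I_n.+1 -> 'M[K]_uq_dim;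
  uq_f : 'I_n.+1 -> 'M[K]_uq_dim;
  uq_K : 'I_n.+1 -> 'M[K]_uq_dim;
  uq_Ki : 'I_n.+1 -> 'M[K]_uq_dim }.

(* Both terms contribute when n = 1, which gives -2. *)
Definition aff_cartan i j : int :=
  if i == j then 2 else - ((j == ordS i) + (i == ordS j))%N%:Z.

Definition qint (m : nat) : K := (q ^+ m - q ^- m) / (q - q^-1).
Definition qfact (m : nat) : K := \prod_(k < m) qint k.+1.
Definition qbinom (m k : nat) : K := qfact m / (qfact k * qfact (m - k)).

Definition serre d (x : 'I_n.+1 -> 'M[K]_d) i j : 'M[K]_d :=
  let m := `|1 - aff_cartan i j|%N in
  \sum_(k < m.+1) ((-1) ^+ k * qbinom m k) *:
    (x i ^+ (m - k) *m x j *m x i ^+ k).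

Record Uq_module (M : uq_rep) : Prop := UqModule {
  Uq_KKi : forall i, uq_K M i *m uq_Ki M i = 1%:M;
  Uq_KiK : forall i, uq_Ki M i *m uq_K M i = 1%:M;
  Uq_KK : forall i j, uq_K M i *m uq_K M j = uq_K M j *m uq_K M i;
  Uq_Ke : forall i j, uq_K M i *m uq_e M j *m uq_Ki M i =
    q ^ aff_cartan i j *: uq_e M j;
  Uq_Kf : forall i j, uq_K M i *m uq_f M j *m uq_Ki M i =
    q ^ (- aff_cartan i j) *: uq_f M j;
  Uq_ef : forall i j, uq_e M i *m uq_f M j - uq_f M j *m uq_e M i =
    if i == j then (q - q^-1)^-1 *: (uq_K M i - uq_Ki M i) else 0;
  Uq_serre_e : forall i j, i != j -> serre (uq_e M) i j = 0;
  Uq_serre_f : forall i j, i != j -> serre (uq_f M) i j = 0 }.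

(* Nilpotent e_j and f_j, and a basis (the columns of P) of weight vectors with
   integral weights. *)
Definition uq_integrable (M : uq_rep) : Prop :=
  (exists N : nat, forall j, uq_e M j ^+ N = 0 /\ uq_f M j ^+ N = 0) /\
  exists2 P : 'M[K]_(uq_dim M), P \in unitmx &
    exists wt : 'I_n.+1 -> 'I_(uq_dim M) -> int,
      forall j, uq_K M j *m P = P *m diag_mx (\row_a q ^ wt j a).

Definition uq_hom (M N : uq_rep) (F : 'M[K]_(uq_dim N, uq_dim M)) : Prop :=
  forall j, [/\ F *m uq_e M j = uq_e N j *m F, F *m uq_f M j = uq_f N j *m F,
                F *m uq_K M j = uq_K N j *m F
              & F *m uq_Ki M j = uq_Ki N j *m F].

Definition mx_surj d d' (F : 'M[K]_(d', d)) : Prop :=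
  forall y : 'cV[K]_d', exists x : 'cV[K]_d, F *m x = y.

Definition mx_inj d d' (F : 'M[K]_(d', d)) : Prop :=
  forall x : 'cV[K]_d, F *m x = 0 -> x = 0.

Definition uq_epi (M N : uq_rep) : Prop :=
  exists2 F : 'M[K]_(uq_dim N, uq_dim M), @uq_hom M N F & mx_surj F.

Definition uq_tensor (M N : uq_rep) : uq_rep := {|
  uq_dim := uq_dim M * uq_dim N;
  uq_e := fun j => uq_e M j *t uq_Ki N j + 1%:M *t uq_e N j;
  uq_f := fun j => uq_f M j *t 1%:M + uq_K M j *t uq_f N j;
  uq_K := fun j => uq_K M j *t uq_K N j;
  uq_Ki := fun j => uq_Ki M j *t uq_Ki N j |}.

Definition uq_trivial : uq_rep := {|
  uq_dim := 1;
  uq_e := fun=> 0; uq_f := fun=> 0; uq_K := fun=> 1; uq_Ki := fun=> 1 |}.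

Definition uq_tensor_seq (s : seq uq_rep) : uq_rep :=
  if s is M :: s' then foldl uq_tensor M s' else uq_trivial.

Definition uq_twist (x : K) (M : uq_rep) : uq_rep := {|
  uq_dim := uq_dim M;
  uq_e := fun j => if j == ord0 then x *: uq_e M j else uq_e M j;
  uq_f := fun j => if j == ord0 then x^-1 *: uq_f M j else uq_f M j;
  uq_K := uq_K M;
  uq_Ki := uq_Ki M |}.

Definition subsets (r : nat) : {set {set 'I_n.+1}} :=
  [set A : {set 'I_n.+1} | #|A| == r].

(* The operator with v_A |-> \sum_B (a B A) v_B. *)
Definition subset_mx r (a : {set 'I_n.+1} -> {set 'I_n.+1} -> K) :
    'M[K]_#|subsets r| :=
  \matrix_(k, l) a (enum_val k) (enum_val l).

Definition K_weight j A : int := (j \in A)%:Z - (ordS j \in A)%:Z.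

Definition uq_fund (r : nat) : uq_rep := {|
  uq_dim := #|subsets r|;
  uq_e := fun j => subset_mx r (fun B A =>
    [&& ordS j \in A, j \notin A & B == j |: (A :\ ordS j)]%:R);
  uq_f := fun j => subset_mx r (fun B A =>
    [&& j \in A, ordS j \notin A & B == ordS j |: (A :\ j)]%:R);
  uq_K := fun j => subset_mx r (fun B A => (B == A)%:R * q ^ K_weight j A);
  uq_Ki := fun j => subset_mx r (fun B A =>
    (B == A)%:R * q ^ (- K_weight j A)) |}.

Variables (Q : rel 'I_n) (c : seq 'I_n) (xi : 'I_n -> int).

Definition V_quiver (b : 'rV[int]_n) : uq_rep :=
  let: (r, p) := ar_coord Q c xi b in uq_twist ((- q) ^ p) (uq_fund r).

(* Kernels, cokernels and direct sums are subquotients and extensions, hence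
   need no clause of their own. *)
Inductive in_CQ : uq_rep -> Prop :=
| CQ_V b : posroot b -> in_CQ (V_quiver b)
| CQ_sub M N F : in_CQ M -> @uq_hom N M F -> mx_inj F -> in_CQ N
| CQ_quot M N F : in_CQ M -> @uq_hom M N F -> mx_surj F -> in_CQ N
| CQ_tensor M N : in_CQ M -> in_CQ N -> in_CQ (uq_tensor M N)
| CQ_ext L M N F G : in_CQ L -> in_CQ N -> Uq_module M -> uq_integrable M ->
    @uq_hom L M F -> mx_inj F -> @uq_hom M N G -> mx_surj G ->
    (forall y : 'cV[K]_(uq_dim M), G *m y = 0 <-> exists x, y = F *m x) ->
    in_CQ M.

End QuantumAffine.

(* K is an algebraic closure of C(q) = {fraction {poly R[i]}}. *)
Definition is_alg_closure (R : realType) (K : closedFieldType)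
    (iota : {rmorphism {fraction {poly R[i]}} -> K}) : Prop :=
  forall x : K, algebraicOver iota x.

Definition q_of (R : realType) (K : closedFieldType)
    (iota : {rmorphism {fraction {poly R[i]}} -> K}) : K :=
  iota (tofrac 'X).

(* Main.v *)
(* Label the edges of the path 1 - ... - n extended by one edge at either end
   by 0, ..., n: the positive roots are the pairs of labels x < y, and a sum of
   two positive roots is a root when the pairs share a label y.  Comparing the
   two summands for the order of an adapted word, or for that of the
   Auslander-Reiten quiver, amounts to reading the orientation at y.

   The pair of summands need not be minimal for a given adapted word, so the
   surjection for quiver Hecke modules is not part of the definition of S_Q.
   The letters of a weight of S_Q(b) are distinct, so all generators act with
   non-negative degree and the simple module S_Q(b) lives in a single degree:
   the x_k vanish, and so do the psi_l between adjacent letters.  Since the other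
   psi_l only commute distant letters and satisfy the braid relation, S_Q(b) has
   a basis indexed by a commutation class of words.  By induction over minimal
   pairs it consists of the words in which d precedes c for every arrow c -> d,
   a class that depends on Q only.  Concatenation of words then gives the map
   S_Q(b) o S_Q(a) -> S_Q(a + b), which is onto because its target is simple.

   On the affine side, the coordinates of the three roots in the quiver differ
   as in Dorey's rule, and the surjection is v_A (x) v_B |-> (-q)^l v_(A u B), or
   the same with complements, where l counts inversions.  Part (b) follows by
   splitting off the first simple root. *)

Require Import Defs.
From mathcomp Require Import all_boot all_order all_algebra.
From mathcomp Require Import reals complex.
From HB Require Import structures.
From mathcomp Require Import zify ring mxtens finmap boolp.
From mathcomp Require classical_sets.
From mathcomp.multinomials Require Import monalg.

Set Implicit Arguments.
Unset Strict Implicit.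
Unset Printing Implicit Defensive.
Import Order.TTheory GRing.Theory Num.Theory.
Local Open Scope ring_scope.

(** * Roots as differences of labels *)

(** Reflections permute the labels, so reduced words, tau and the convex orders are handled as
    permutations. The powers of tau on [gamma] are not followed one by one: [Tpos] and [Spos] unroll
    the cycle of tau on labels, and the root [rootn n x y] has the coordinates (T x - S y, T x + S y
    + constant). Statements on coordinates become linear arithmetic, and the alternative T y - S y =
    0 or n + 1 is at once the orientation at y and the choice between unions and complements in
    Dorey's rule.

    For quiver Hecke modules the obstacle is a consistently normalised basis: two chains of
    commutations with the same ends must carry a weight vector to the same vector, without a scalar.
    This is a coherence statement about the psi_l, proved abstractly before modules enter. Minimal
    pairs are used to find one admissible weight of S_Q(b), because a nonzero quotient of a
    convolution product has a weight that is a concatenation of weights of the factors. Simplicity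
    and concentration in one degree then give the whole basis. *)

Section Labels.
Variable n : nat.
Implicit Types (i j : 'I_n) (w : seq 'I_n) (p x y z : nat).

(* The weight [e_0 - e_p] of sl_(n+1) up to sign, so that the roots are the
   differences of two labels in 0..n. *)
Definition hvec p : 'rV[int]_n := \row_k ((k < p)%N : nat)%:Z.

Definition rootn x y : 'rV[int]_n := hvec y - hvec x.

Lemma rootnE x y (k : 'I_n) :
  rootn x y 0 k = ((k < y)%N : nat)%:Z - ((k < x)%N : nat)%:Z.
Proof. by rewrite !mxE. Qed.

Lemma rootnN x y : - rootn x y = rootn y x.
Proof. by rewrite /rootn opprB. Qed.

Lemma root_add x y z : rootn x y + rootn y z = rootn x z.
Proof. by rewrite /rootn addrC subrKA. Qed.

Lemma alpha_root i : alpha i = rootn i i.+1.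
Proof.
apply/rowP => k; rewrite rootnE mxE /= -val_eqE /=; lia.
Qed.

Lemma segment_root i j : (i <= j)%N -> segment i j = rootn i j.+1.
Proof.
move=> ij; apply/rowP => k; rewrite rootnE /segment summxE.
case: (boolP (i <= k <= j)%N) => h.
  rewrite (bigD1 k) //= big1 ?addr0.
    by rewrite mxE !eqxx /=; lia.
  by move=> l /andP[_ lk]; rewrite mxE /= eq_sym (negbTE lk).
rewrite big1; first by lia.
move=> l hl; rewrite mxE /=; case: eqP => // e; subst l; by rewrite hl in h.
Qed.

Lemma posrootP b :
  posroot b <-> exists x y, [/\ (x < y)%N, (y <= n)%N & b = rootn x y].
Proof.
split=> [[i [j [ij ->]]]|[x [y [xy yn ->]]]].
  exists i, j.+1; split=> //; exact: segment_root.
have xn : (x < n)%N by lia.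
have y1n : (y.-1 < n)%N by lia.
exists (Ordinal xn), (Ordinal y1n); rewrite segment_root /=; last by lia.
by rewrite prednK; [split=> //; lia | lia].
Qed.

Lemma root_inj x y x' y' : x != y -> (x <= n)%N -> (y <= n)%N ->
  (x' <= n)%N -> (y' <= n)%N -> rootn x y = rootn x' y' -> x = x' /\ y = y'.
Proof.
move=> xy xn yn xn' yn'.
wlog lxy : x y x' y' xy xn yn xn' yn' / (x < y)%N => [W e|].
  case: (ltngtP x y) xy => // lxy _; first by apply: W e => //; lia.
  suff [-> ->] : y = y' /\ x = x' by [].
  by apply: W => //; [lia | rewrite -rootnN e rootnN].
move=> /rowP e.
have E k : (k < n)%N ->
    ((k < y)%N : nat)%:Z - ((k < x)%N : nat)%:Z
    = ((k < y')%N : nat)%:Z - ((k < x')%N : nat)%:Z.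
  by move=> kn; have := e (Ordinal kn); rewrite !rootnE.
have h1 : (x < y')%N /\ (x' <= x)%N by have := E x; lia.
have ex : x' = x.
  case: (ltngtP x' x) => // h; last by lia.
  by have := E x'; lia.
subst x'; split=> //; case: (ltngtP y y') => // h.
  by have := E y; lia.
by have := E y'; lia.
Qed.

Lemma pairing_alpha b i : pairing b (alpha i) = \sum_k b 0 k * cartan k i.
Proof.
apply: eq_bigr => k _; rewrite (bigD1 i) //= big1 ?addr0 => [|j ji].
  by rewrite mxE !eqxx mulr1.
by rewrite mxE (negbTE ji) andbF mulr0.
Qed.

Lemma pairing_linear i a (u v : 'rV[int]_n) :
  pairing (a *: u + v) (alpha i) = a * pairing u (alpha i) + pairing v (alpha i).
Proof.
rewrite !pairing_alpha mulr_sumr -big_split /=.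
by apply: eq_bigr => k _; rewrite !mxE mulrDl mulrA.
Qed.

Lemma reflection_linear i : linear (@reflection n i).
Proof.
move=> a u v; rewrite /reflection pairing_linear scalerDl scalerBr scalerA.
by rewrite opprD addrACA.
Qed.

Lemma reflectionB i u v :
  reflection i (u - v) = reflection i u - reflection i v.
Proof.
by rewrite -[- v]scaleN1r addrC reflection_linear scaleN1r addrC.
Qed.

Lemma transpK i : involutive (transp i).
Proof. by move=> p; rewrite /transp; do ![case: eqP => //=]; lia. Qed.

Lemma transp_le i p : (p <= n)%N -> (transp i p <= n)%N.
Proof. by rewrite /transp; do ![case: eqP => //=]; lia. Qed.

Lemma pairing_hvec i p : (p <= n)%N ->
  pairing (hvec p) (alpha i) = (p == i.+1)%:Z - (p == i)%:Z + (0 == i)%N%:Z.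
Proof.
move=> pn; rewrite pairing_alpha.
have H (a : nat) : (a <= n)%N -> \sum_(k < n | (k < a)%N) cartan k i
    = (a == i.+1)%:Z - (a == i)%:Z + (0 == i)%N%:Z.
  elim: a => [_|a IH an].
    rewrite big1 => [|k]; last by rewrite ltn0.
    by case: (0 == i)%N.
  have an' : (a < n)%N by lia.
  rewrite (bigD1 (Ordinal an')) /=; last by [].
  rewrite (eq_bigl (fun k : 'I_n => (k < a)%N)); last first.
    by move=> k; rewrite -val_eqE /=; lia.
  rewrite IH; last by lia.
  by rewrite /cartan /adjacent -val_eqE /=; do ![case: eqP => //=]; lia.
rewrite -(H _ pn) [RHS]big_mkcond; apply: eq_bigr => k _.
by rewrite mxE; case: ltnP => _; rewrite ?mul1r ?mul0r.
Qed.

Lemma reflection_root i x y : (x <= n)%N -> (y <= n)%N ->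
  reflection i (rootn x y) = rootn (transp i x) (transp i y).
Proof.
move=> xn yn; rewrite /rootn reflectionB.
(* [hvec p] involves the fixed label 0, which the reflection at the first vertex moves. The
   resulting error term does not depend on [p] and cancels in a difference. *)
have H p : (p <= n)%N ->
      reflection i (hvec p) = hvec (transp i p) - (0 == i)%N%:Z *: alpha i.
  move=> pn; rewrite /reflection pairing_hvec // scalerDl opprD addrA.
  congr (_ - _); apply/rowP => k; rewrite !mxE /= -val_eqE /= /transp.
  by do ![case: eqP => //=]; lia.
by rewrite !H // opprB addrA subrK.
Qed.

Definition act w p : nat := foldr (@transp \o val) p w.

Lemma act_cat w1 w2 p : act (w1 ++ w2) p = act w1 (act w2 p).
Proof. by rewrite /act foldr_cat. Qed.

Lemma act_le w p : (p <= n)%N -> (act w p <= n)%N.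
Proof. by move=> pn; elim: w => //= i w; apply: transp_le. Qed.

Lemma act_inj w : injective (act w).
Proof.
elim: w => [|i w IH] x y //= e.
by apply: IH; apply: (can_inj (transpK i)).
Qed.

Lemma act_revK w p : act w (act (rev w) p) = p.
Proof.
elim: w p => //= i w IH p; rewrite rev_cons -cats1 act_cat IH /=.
exact: transpK.
Qed.

Lemma weyl_cat w1 w2 b : weyl (w1 ++ w2) b = weyl w1 (weyl w2 b).
Proof. by rewrite /weyl foldr_cat. Qed.

Lemma weyl_root w x y : (x <= n)%N -> (y <= n)%N ->
  weyl w (rootn x y) = rootn (act w x) (act w y).
Proof.
move=> xn yn; elim: w => //= i w ->.
by rewrite reflection_root // act_le.
Qed.

Lemma weyl_linear w a u v : weyl w (a *: u + v) = a *: weyl w u + weyl w v.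
Proof. by elim: w => //= i w ->; rewrite reflection_linear. Qed.

Lemma weyl_eq w w' : act w =1 act w' -> weyl w =1 weyl w'.
Proof.
move=> e b; rewrite [b]row_sum_delta.
have S v : weyl v (\sum_(j < n) b 0 j *: delta_mx 0 j)
    = \sum_(j < n) b 0 j *: weyl v (alpha j).
  elim/big_rec2: _ => [|j u u' _ <-]; last by rewrite weyl_linear.
  by have := weyl_linear v (-1) 0 0; rewrite scaler0 addr0 scaleN1r addNr.
rewrite !S; apply: eq_bigr => j _; congr (_ *: _).
have jn := ltn_ord j.
by rewrite alpha_root !weyl_root ?e // ltnW.
Qed.

(* The exchange condition: the hypothesis means that [w s_i] is shorter than
   [w]. *)
Lemma act_delete w i : (act w i.+1 < act w i)%N ->
  exists2 u, (size u).+1 = size w & act u =1 act (w ++ [:: i]).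
Proof.
elim: w => [|j w IH] /=; first by lia.
case: (ltngtP (act w i.+1) (act w i)) => [lt _|lt|e].
- have [u su eu] := IH lt; exists (j :: u); first by rewrite /= su.
  by move=> p /=; rewrite eu.
- move=> h; exists w => // p.
  have [ei ei1] : act w i = j /\ act w i.+1 = j.+1.
    by move: h; rewrite /transp /=; do ![case: eqP => //=]; lia.
  rewrite -[RHS]/(transp j (act (w ++ [:: i]) p)) act_cat.
  rewrite -[act [:: i] p]/(transp i p) /transp.
  have [->|pi] := eqVneq p (val i).
    by rewrite ei1 ei; do ![case: eqP => //=]; lia.
  have [->|pi1] := eqVneq p i.+1; first by rewrite ei eqxx.
  case: eqP => [e|_]; first by move/eqP: pi; case; apply: (@act_inj w); rewrite ei.
  by case: eqP => // e; move/eqP: pi1; case; apply: (@act_inj w); rewrite ei1.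
- by have := act_inj e; lia.
Qed.

Lemma act_last w i : act (w ++ [:: i; i]) =1 act w.
Proof. by move=> p; rewrite act_cat /= transpK. Qed.

(** If a letter did not lengthen the prefix before it, the exchange condition would remove that
    letter together with one letter of the prefix, against minimality. *)
Lemma reducedW w : reduced w ->
  forall w1 i w2, w = w1 ++ i :: w2 -> (act w1 i < act w1 i.+1)%N.
Proof.
move=> rw w1 i w2 e; case: (ltngtP (act w1 i) (act w1 i.+1)) => // h.
  have [u su eu] := act_delete h.
  have := rw (u ++ w2); rewrite e !size_cat /= -su => hr.
  have: ((size u).+1 + (size w2).+1 <= size u + size w2)%N; last by lia.
  apply: hr; apply: weyl_eq => p.
  by rewrite !act_cat eu -[i :: w2]cat1s !act_cat.
by have := act_inj h; lia.
Qed.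

(** At an ascent [i], the longer word [w ++ [:: i]] would again be reduced: every word for the same
    element has a descent at [i], and the exchange condition shortens it to a word for the element
    of [w]. *)
Lemma reduced_longest_decr w : reduced_longest w ->
  forall i, (act w i.+1 < act w i)%N.
Proof.
move=> [rw lw] i; case: (ltngtP (act w i) (act w i.+1)) => // h; last first.
  by have := act_inj h; lia.
have: reduced (w ++ [:: i]); last first.
  by move=> /lw; rewrite size_cat /=; lia.
move=> w' e; rewrite size_cat /= addn1.
have ilt := ltn_ord i.
have [e1 e2] : act w' i = act w i.+1 /\ act w' i.+1 = act w i.
  have := e (alpha i); rewrite alpha_root !weyl_root ?(ltnW ilt) // => E.
  have s1 : act (w ++ [:: i]) i = act w i.+1.
    by rewrite act_cat /= {1}/transp eqxx.
  have s2 : act (w ++ [:: i]) i.+1 = act w i.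
    by rewrite act_cat /= /transp eqxx; case: eqP => //; lia.
  rewrite s1 s2 in E; apply: root_inj E; rewrite ?act_le // ?(ltnW ilt) //.
  by apply/eqP => /act_inj; lia.
have [u <- eu] : exists2 u, (size u).+1 = size w' & act u =1 act (w' ++ [:: i]).
  by apply: act_delete; rewrite e1 e2.
rewrite ltnS; apply: rw => b; rewrite (weyl_eq eu) weyl_cat e -weyl_cat -catA.
exact/weyl_eq/act_last.
Qed.

Lemma homo_decr_le (f : nat -> nat) :
  (forall p, (p < n)%N -> (f p.+1 < f p)%N) ->
  forall x y, (y <= n)%N -> (x < y)%N -> (f y < f x)%N.
Proof.
move=> h x y; elim: y => // y IH yn; rewrite ltnS leq_eqVlt => /orP[/eqP ->|lt].
  exact: h.
by have h1 := h y; have h2 := IH _ lt; lia.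
Qed.

(** The roots of [root_seq] with their two ends kept apart, so that reflections act
    componentwise. *)
Fixpoint rseq w : seq (nat * nat) :=
  if w is i :: w' then
    (val i, i.+1) :: [seq (transp i u.1, transp i u.2) | u <- rseq w']
  else [::].

Lemma rseq_le w (p : nat * nat) : p \in rseq w -> (p.1 <= n)%N /\ (p.2 <= n)%N.
Proof.
elim: w p => //= i w IH p; rewrite inE => /orP[/eqP -> /=|/mapP[p' hp' -> /=]].
  by have := ltn_ord i; lia.
by have [h1 h2] := IH _ hp'; rewrite !transp_le.
Qed.

Lemma root_seqE w : root_seq w = [seq rootn u.1 u.2 | u <- rseq w].
Proof.
elim: w => //= i w ->; rewrite alpha_root /= -!map_comp; congr (_ :: _).
apply/eq_in_map => u /rseq_le[h1 h2] /=.
exact: reflection_root.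
Qed.

Lemma rseqP w (p : nat * nat) : p \in rseq w ->
  exists w1 i w2, [/\ w = w1 ++ i :: w2 & p = (act w1 i, act w1 i.+1)].
Proof.
elim: w p => //= i w IH p; rewrite inE => /orP[/eqP -> /=|/mapP[p' hp' -> /=]].
  by exists [::], i, w.
have [w1 [j [w2 [-> -> /=]]]] := IH _ hp'.
by exists (i :: w1), j, w2.
Qed.

Lemma rseq_pos w (p : nat * nat) : reduced w -> p \in rseq w -> (p.1 < p.2)%N.
Proof.
by move=> rw /rseqP[w1 [i [w2 [e -> /=]]]]; apply: reducedW rw _ _ _ e.
Qed.

(** The inversions occur in the root sequence: either the tail already inverts the two labels, or
    the first letter is the transposition that does. *)
Lemma rseq_flip w x y : (y < x)%N -> (act w x < act w y)%N ->
  (act w x, act w y) \in rseq w.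
Proof.
elim: w => /= [|i w IH]; first by lia.
move=> yx h; rewrite inE; case: (ltngtP (act w x) (act w y)) => h'.
- apply/orP; right; apply/mapP.
  by exists (act w x, act w y); first exact: IH.
- apply/orP; left; move: h; rewrite /transp /= xpair_eqE.
  by do ![case: eqP => //=]; lia.
- by have := act_inj h'; lia.
Qed.

(** A longest reduced word reverses the order of the labels, so every pair of labels is an
    inversion. *)
Lemma rseq_mem w x y : reduced_longest w -> (x < y)%N -> (y <= n)%N ->
  (x, y) \in rseq w.
Proof.
move=> rw xy yn.
have D := @homo_decr_le (act w) (fun (p : nat) h =>
  reduced_longest_decr rw (Ordinal h)).
rewrite -[x](act_revK w) -[y](act_revK w); apply: rseq_flip; last first.
  by rewrite !act_revK.
have xn : (x <= n)%N by lia.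
case: (ltngtP (act (rev w) y) (act (rev w) x)) => // h.
  have := D _ _ (act_le _ yn) h; rewrite !act_revK; lia.
by have := act_inj h; lia.
Qed.

Lemma root_lt_rindex w x y x' y' : reduced w -> (x < y <= n)%N ->
  (x' < y' <= n)%N ->
  root_lt w (rootn x y) (rootn x' y') <->
  [/\ (x, y) \in rseq w, (x', y') \in rseq w
     & (index (x, y) (rseq w) < index (x', y') (rseq w))%N].
Proof.
move=> rw xy xy'.
have I (p q : nat * nat) : p \in rseq w -> (q.1 < q.2 <= n)%N ->
    rootn p.1 p.2 = rootn q.1 q.2 -> p = q.
  move=> hp hq; have := rseq_pos rw hp; have [] := rseq_le hp.
  case: p hp => p1 p2; case: q hq => q1 q2 /= hq _ l1 l2 l e.
  have [] := root_inj _ l1 l2 _ _ e; try lia.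
  by move=> -> ->.
have M (q : nat * nat) : (q.1 < q.2 <= n)%N ->
    (rootn q.1 q.2 \in root_seq w) = (q \in rseq w).
  move=> hq; rewrite root_seqE; apply/mapP/idP => [[p hp /esym e]|hp].
    by rewrite -(I _ _ hp hq e).
  by exists q.
have X (q : nat * nat) : (q.1 < q.2 <= n)%N ->
    index (rootn q.1 q.2) (root_seq w) = index q (rseq w).
  move=> hq; rewrite root_seqE /index find_map; apply: eq_in_find => p hp /=.
  by apply/eqP/eqP => [|->//]; apply: I.
rewrite /root_lt (M (x, y)) // (M (x', y')) // (X (x, y)) // (X (x', y')) //.
Qed.

Lemma reduced_tail i w : reduced (i :: w) -> reduced w.
Proof.
move=> rw w' e; suff: (size (i :: w) <= size (i :: w'))%N by [].
by apply: rw => b /=; rewrite e.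
Qed.

(** * Orientation of the quiver at a label, and adapted words *)

Definition arrow_right (Q : rel 'I_n) y : bool :=
  [exists i, [exists j, [&& Q i j, i.+1 == y & j == y :> nat]]].

Lemma arrow_rightP Q y (i j : 'I_n) : i.+1 = y -> j = y :> nat -> arrow_right Q y = Q i j.
Proof.
move=> iy jy; apply/existsP/idP => [[i' /existsP[j' /and3P[h /eqP e /eqP e']]]|h].
  have -> : i = i' by apply: ord_inj; lia.
  by have -> : j = j' by apply: ord_inj; lia.
by exists i; apply/existsP; exists j; rewrite h iy jy !eqxx.
Qed.

(** The labels 0 and n carry no edge and count as not pointing right; [dn], [Spos] and [Tpos] rely
    on this default. *)
Lemma arrow_right_bounds Q y : arrow_right Q y -> (0 < y < n)%N.
Proof.
case/existsP => i /existsP[j /and3P[_ /eqP <- /eqP e]] /=; rewrite -e.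
exact: ltn_ord.
Qed.

Lemma arrow_rightN Q y (i j : 'I_n) : dynkin_quiver Q -> i.+1 = y -> j = y :> nat ->
  arrow_right Q y = ~~ Q j i.
Proof.
move=> qQ iy jy; rewrite (arrow_rightP Q iy jy); have [] := qQ i j.
have -> : adjacent i j by rewrite /adjacent iy jy eqxx orbT.
by case: (Q i j); case: (Q j i).
Qed.

Lemma dynkin_flip Q i : dynkin_quiver Q -> dynkin_quiver (flip_at i Q).
Proof.
move=> qQ j k; have [h1 h2] := qQ j k; rewrite /flip_at.
have -> : (k == i) || (j == i) = (j == i) || (k == i) by rewrite orbC.
by case: ifP => _; rewrite // orbC andbC.
Qed.

Lemma arrow_right_flip Q i y : dynkin_quiver Q -> source Q i -> (0 < y < n)%N ->
  arrow_right (flip_at i Q) y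
  = if (y == i) || (y == i.+1) then ~~ arrow_right Q y else arrow_right Q y.
Proof.
move=> qQ /forallP sQ yn.
have y1n : (y.-1 < n)%N by lia.
have yn' : (y < n)%N by lia.
have e : (Ordinal y1n).+1 = y by rewrite /=; lia.
have e' : Ordinal yn' = y :> nat by [].
rewrite (arrow_rightP _ e e') (arrow_rightP _ e e') /flip_at -!val_eqE /=.
have -> : (y.-1 == i)%N = (y == i.+1)%N by lia.
rewrite orbC; case: ifP => // _.
by rewrite -(arrow_rightP Q e e') (arrow_rightN qQ e e') negbK.
Qed.

Lemma arrow_right_source Q i : dynkin_quiver Q -> source Q i ->
  ~~ arrow_right Q i /\ ((i.+1 < n)%N -> arrow_right Q i.+1).
Proof.
move=> qQ /forallP sQ; split.
  apply/negP => h; have := arrow_right_bounds h => hi; move: h.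
  have i1n : (i.-1 < n)%N by have := ltn_ord i; lia.
  rewrite (@arrow_rightP Q i (Ordinal i1n) i) //=; last by lia.
  by apply/negP/sQ.
by move=> i1; rewrite (@arrow_rightN Q i.+1 i (Ordinal i1)).
Qed.

Lemma transpI i : injective (transp i).
Proof. exact: can_inj (transpK i). Qed.

(* Induction on [w]: flipping the arrows at [i] exchanges the orientations
   attached to the labels [i] and [i.+1], as does the reflection at [i]. *)
Lemma adapted_order Q w x y z : dynkin_quiver Q -> reduced w -> adapted Q w ->
  (x < y)%N -> (y < z <= n)%N ->
  (x, y) \in rseq w -> (y, z) \in rseq w ->
  if arrow_right Q y then (index (x, y) (rseq w) < index (y, z) (rseq w))%N
  else (index (y, z) (rseq w) < index (x, y) (rseq w))%N.
Proof.
elim: w Q x y z => //= i w IH Q x y z qQ rw /andP[sQ aw] xy yz.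
have [s1 s2] := arrow_right_source qQ sQ.
have im := ltn_ord i.
have inj_s : injective (fun p : nat * nat => (transp i p.1, transp i p.2)).
  by move=> [a b] [a' b'] [/transpI -> /transpI ->].
have f a b : ((nat_of_ord i, i.+1) == (a, b)) = ((a == i) && (b == i.+1)).
  by rewrite xpair_eqE ![_ == a]eq_sym ![_ == b]eq_sym.
rewrite !inE /= !f !xpair_eqE.
case: (boolP ((x == i) && (y == i.+1))) => [/andP[/eqP ex /eqP ey] _ _|nxy].
  have -> : (y == i) = false by lia.
  by rewrite ey s2 //; lia.
case: (boolP ((y == i) && (z == i.+1))) => [/andP[/eqP ey /eqP ez] _ _|nyz].
  by rewrite ey (negbTE s1).
rewrite /= => h1 h2.
have E a b : (a, b) = ((fun p : nat * nat => (transp i p.1, transp i p.2))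
    (transp i a, transp i b)) by rewrite /= !transpK.
rewrite E (mem_map inj_s) in h1; rewrite E (mem_map inj_s) in h2.
rewrite (E x y) (E y z) !(index_map inj_s) !ltnS.
have rw' := reduced_tail rw.
have := rseq_pos rw' h1; have := rseq_pos rw' h2 => /= l2 l1.
have [_ le2] := rseq_le h2.
have := IH _ (transp i x) (transp i y) (transp i z) (dynkin_flip i qQ) rw' aw l1.
rewrite l2 => /(_ le2 h1 h2).
suff -> : arrow_right (flip_at i Q) (transp i y) = arrow_right Q y by [].
have := l1; have := l2; have := le2; rewrite /= => l2' l1' le2'.
rewrite arrow_right_flip //; last by lia.
rewrite {1 2}/transp; case: (y =P val i) => [e|yi].
  by rewrite eqxx orbT /transp e eqxx s2 ?(negbTE s1) //;
     move: l1' l2' le2'; rewrite e /transp eqxx; lia.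
case: (y =P i.+1) => [e|yi1].
  rewrite eqxx /= /transp; have -> : (y == i) = false by lia.
  by rewrite e eqxx s2 ?s1 //; lia.
by rewrite /transp; case: (y =P val i) => //; case: (y =P i.+1) => //;
   case: eqP => //; case: eqP.
Qed.

End Labels.

(** * Coordinates in the Auslander-Reiten quiver *)

Section ARCoordinates.
Variables (n : nat) (Q : rel 'I_n).
Hypothesis qQ : dynkin_quiver Q.
Implicit Types (i j : 'I_n) (x y z : nat).

(** Both counts run over the labels y, ..., n - 1: the label 0 counts as a left one, and n is never
    counted. *)
Definition count_right y : nat := count (arrow_right Q) (iota y (n - y)).
Definition count_left y : nat := count (predC (arrow_right Q)) (iota y (n - y)).

Lemma count_rightS y : (y < n)%N ->
  count_right y = (arrow_right Q y + count_right y.+1)%N.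
Proof. by move=> h; rewrite /count_right -(subnSK h). Qed.

Lemma count_leftS y : (y < n)%N ->
  count_left y = (~~ arrow_right Q y + count_left y.+1)%N.
Proof. by move=> h; rewrite /count_left -(subnSK h). Qed.

Lemma count_rightn : count_right n = 0%N. Proof. by rewrite /count_right subnn. Qed.
Lemma count_leftn : count_left n = 0%N. Proof. by rewrite /count_left subnn. Qed.

Lemma count_right_left y : (count_right y + count_left y = n - y)%N.
Proof. by rewrite /count_right /count_left count_predC size_iota. Qed.

Lemma arrow_right0 : arrow_right Q 0 = false.
Proof. by case h: arrow_right => //; have := arrow_right_bounds h. Qed.
(* Cut the (n+1)-gon at each label to place the labels on the integers, so that
   tau becomes the translation by -1; the two cuts used for the lower and for
   the upper end of a positive root differ by one turn at the labels that do
   not satisfy [arrow_right]. *)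
Definition Spos y : int :=
  if arrow_right Q y then (count_right y)%:Z else - (count_left y)%:Z.
Definition Tpos x : int :=
  if arrow_right Q x then (count_right x)%:Z else n.+1%:Z - (count_left x)%:Z.

Lemma TposE y : Tpos y = Spos y + (if arrow_right Q y then 0 else n.+1%:Z).
Proof. by rewrite /Tpos /Spos; case: ifP => _; lia. Qed.

(** The walk down stops at the first label that does not point right, which is how far the paths
    into a vertex reach on its left. [up] is the mirror walk, with fuel [n - y]. *)
Fixpoint dn y : nat := if y is y'.+1 then if arrow_right Q y then dn y' else y else 0%N.

Fixpoint up_rec d y : nat :=
  if d is d'.+1 then if arrow_right Q y then y else up_rec d' y.+1 else y.
Definition up y : nat := up_rec (n - y) y.

Lemma upE y : up y = if (y < n)%N && ~~ arrow_right Q y then up y.+1 else y.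
Proof.
rewrite /up; case: ltnP => h /=; last by have -> : (n - y = 0)%N by lia.
by rewrite -(subnSK h) /=; case: arrow_right.
Qed.

Lemma dnP y : [/\ (dn y <= y)%N, ~~ arrow_right Q (dn y)
  & forall z, (dn y < z <= y)%N -> arrow_right Q z].
Proof.
elim: y => [|y [h1 h2 h3]] /=; first by rewrite arrow_right0; split=> // z; lia.
case: ifP => hR; split=> //; [lia | | by rewrite hR | by move=> z; lia].
by move=> z; case: (eqVneq z y.+1) => [-> //|zy] hz; apply: h3; lia.
Qed.

Lemma upP y : (y <= n)%N -> [/\ (y <= up y <= n)%N, (up y == n) || arrow_right Q (up y)
  & forall z, (y <= z < up y)%N -> ~~ arrow_right Q z].
Proof.
move: {2}(n - y)%N (leqnn (n - y)) => d; elim: d y => [|d IH] y hd yn.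
  have -> : y = n by lia.
  by rewrite upE ltnn /= eqxx leqnn; split=> // z; lia.
rewrite upE; case: ifP => [/andP[yn' hR]|/negbT].
  have [|//|h1 h2 h3] := IH y.+1; first by lia.
  split=> //; first by lia.
  move=> z; case: (eqVneq z y) => [-> //|zy] hz; apply: h3; lia.
rewrite negb_and negbK => h; split=> //; last by move=> z; lia.
  by lia.
by case/orP: h => [h|->]; [apply/orP; left; lia | rewrite orbT].
Qed.

Lemma count_left_dn y : (y < n)%N -> count_left (dn y) = (count_left y.+1).+1.
Proof.
elim: y => [|y IH] yn /=; first by rewrite count_leftS ?arrow_right0.
case: ifP => hR; last by rewrite count_leftS ?hR.
by rewrite IH ?(count_leftS yn) ?hR //; lia.
Qed.

Lemma count_right_up y : (y <= n)%N -> count_right (up y) = count_right y.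
Proof.
move: {2}(n - y)%N (leqnn (n - y)) => d; elim: d y => [|d IH] y hd yn.
  have -> : y = n by lia.
  by rewrite upE ltnn.
rewrite upE; case: ifP => // /andP[yn' hR].
by rewrite IH ?(count_rightS yn') ?(negbTE hR) //; lia.
Qed.

Lemma Tpos_dn y : (y < n)%N -> Tpos (dn y) = n%:Z - (count_left y.+1)%:Z.
Proof.
move=> yn; have [_ h _] := dnP y.
by rewrite /Tpos (negbTE h) count_left_dn //; lia.
Qed.

Lemma Spos_up y : (y <= n)%N -> Spos (up y) = (count_right y)%:Z.
Proof.
move=> yn; have [_ h _] := upP yn; rewrite /Spos.
rewrite -(count_right_up yn); case: ifP => hR //; move: h; rewrite hR orbF => /eqP ->.
by rewrite count_rightn count_leftn.
Qed.

(** On a line, a path into [i] from the left uses only edges that point right, and one from the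
    right only edges that point left. The vertices that reach [i] thus fill an interval bounded by
    the first wrong edge on either side. *)
Lemma connect_interval (i k : 'I_n) :
  connect Q k i = (dn i <= k < up i.+1)%N.
Proof.
have im := ltn_ord i.
have [d1 d2 d3] := dnP i; have [u1 u2 u3] := upP im.
apply/idP/idP => [/connectP[p]|].
  elim: p k => [k _ /= <- |b p IH k /= /andP[kb hp] e]; first by lia.
  have hb := IH _ hp e.
  have [] := qQ k b; rewrite kb /= => /esym adj nbk.
  case/orP: adj => /eqP ab.
    have nR : arrow_right Q k = false.
      by rewrite (@arrow_rightN _ Q k b k) // kb.
    suff : (k : nat) != up i.+1 by lia.
    apply/eqP => ke; move: u2; rewrite -ke nR orbF => /eqP ke'.
    by have := ltn_ord k; lia.
  have hR : arrow_right Q b by rewrite (@arrow_rightP _ Q b k b).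
  suff : (b : nat) != dn i by lia.
  by apply/eqP => be; move: d2; rewrite -be hR.
have A : forall d (k : 'I_n), (dn i <= k <= i)%N -> (i - k <= d)%N -> connect Q k i.
  elim=> [|d IH] {}k hk hd.
    by have -> : k = i by apply: ord_inj; lia.
  have [ki|ki] := eqVneq k i; first by rewrite ki.
  have ki' : (k : nat) != i by apply: contra_neq ki => /ord_inj.
  have k1 : (k.+1 < n)%N by lia.
  apply: (@connect_trans _ _ (Ordinal k1)); last by apply: IH => /=; lia.
  apply: connect1; rewrite -(@arrow_rightP _ Q k.+1 k (Ordinal k1)) //.
  apply: d3; lia.
have B : forall d (k : 'I_n), (i <= k < up i.+1)%N -> (k - i <= d)%N -> connect Q k i.
  elim=> [|d IH] {}k hk hd.
    by have -> : k = i by apply: ord_inj; lia.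
  have [ki|ki] := eqVneq k i; first by rewrite ki.
  have ki' : (k : nat) != i by apply: contra_neq ki => /ord_inj.
  have k1 : (k.-1 < n)%N by have := ltn_ord k; lia.
  have k1k : (Ordinal k1).+1 = k by rewrite /=; lia.
  apply: (@connect_trans _ _ (Ordinal k1)); last by apply: IH => /=; lia.
  apply: connect1; have := u3 k.
  by rewrite (@arrow_rightN _ Q k _ k qQ k1k) // negbK; apply; lia.
move=> hk; case: (leqP k i) => ki; [apply: (A (i - k)%N) | apply: (B (k - i)%N)];
  lia.
Qed.

Lemma gamma_root (i : 'I_n) : gamma Q i = rootn n (dn i) (up i.+1).
Proof.
apply/rowP => k; rewrite rootnE /gamma summxE.
rewrite big_mkcond (bigD1 k) //= big1 ?addr0 => [|j jk]; last first.
  by case: ifP; rewrite // mxE eq_sym (negbTE jk) andbF.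
have [[d1 _ _] [u1 _ _]] := (dnP i, upP (ltn_ord i)).
by rewrite connect_interval mxE !eqxx; case: ifP; lia.
Qed.

(** * The Coxeter element as a cycle on labels, and the coordinates of the roots *)

Section Coxeter.
Variable c : seq 'I_n.
Hypothesis cQ : adapted_coxeter Q c.

Lemma coxeter_uniq : uniq c.
Proof. by case/andP: cQ => /perm_uniq ->; rewrite enum_uniq. Qed.

Lemma coxeter_mem i : i \in c.
Proof. by case/andP: cQ => /perm_mem -> _; rewrite mem_enum. Qed.

(** [i] is a source when its letter is read, so an arrow from [j] into [i] has been reversed before.
    As the letters of [c] are distinct, only the letter [j] can have done it. *)
Lemma coxeter_before u i v j : c = u ++ i :: v -> Q j i -> j \in u.
Proof.
case/andP: cQ => _; have := coxeter_uniq; move: c => w uw aw e.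
elim: u w Q uw aw e => [|k u IH] w q uw aw e; rewrite {}e /= in uw aw.
  by move=> ji; case/andP: aw => /forallP/(_ j); rewrite ji.
case/andP: uw => kn uw; case/andP: aw => _ aw ji; rewrite inE.
have [->//|jk] := eqVneq j k; apply: (IH _ _ uw aw) => //.
rewrite /flip_at (negbTE jk) /=; case: eqP => // ik.
by rewrite ik mem_cat inE eqxx orbT in kn.
Qed.

Lemma act_rcons (u : seq 'I_n) k x : act (rcons u k) x = act u (transp k x).
Proof. by rewrite -cats1 act_cat. Qed.

(** Read from its last letter, the prefix moves the label [i] only at the letter [i - 1]. The edge
    between them then points right, the label becomes [i - 1], and [coxeter_before] supplies the
    hypothesis for the shorter prefix. The label stops where [dn] stops. *)
Lemma act_prefix_dn u v i : c = u ++ v -> i \notin u ->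
  (forall j, Q j i -> j.+1 = i -> j \in u) -> act u i = dn i.
Proof.
elim/last_ind: u v i => [|u k IH] v i e iu hi.
  have : arrow_right Q i = false.
    case hR: (arrow_right Q i) => //; have /andP[i0 _] := arrow_right_bounds hR.
    have i1 : (i.-1 < n)%N by have := ltn_ord i; lia.
    have i1i : (Ordinal i1).+1 = i by rewrite /=; lia.
    by move: hR; rewrite (@arrow_rightP _ Q i _ i i1i) // => /hi /(_ i1i).
  rewrite /=; case: (nat_of_ord i) => //= i' ->; by [].
rewrite act_rcons; rewrite cat_rcons in e.
move: iu; rewrite mem_rcons inE negb_or => /andP[ik iu].
have ik' : (i : nat) != k by apply: contra_neq ik => /ord_inj.
have [ki|ki] := eqVneq (k.+1) i.
  have -> : transp k i = k by rewrite /transp -ki eqxx; case: eqP => //; lia.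
  have hR : arrow_right Q i.
    rewrite (@arrow_rightN _ Q i k i qQ ki) //; apply/negP => /(coxeter_before e).
    by rewrite (negbTE iu).
  rewrite (IH _ _ e); first by rewrite -ki /= ki hR.
    by have := coxeter_uniq; rewrite e cat_uniq /= => /and3P[_ /norP[]].
  by move=> j jk _; apply: coxeter_before e jk.
have -> : transp k i = i by rewrite /transp (negbTE ik') eq_sym (negbTE ki).
apply: (IH _ _ e iu) => j ji j1.
have := hi j ji j1; rewrite mem_rcons inE => /orP[/eqP ejk|//].
by rewrite -ejk j1 eqxx in ki.
Qed.

Lemma act_prefix_up u v i : c = u ++ v -> i \notin u ->
  (forall j, Q j i -> j = i.+1 :> nat -> j \in u) -> act u i.+1 = up i.+1.
Proof.
elim/last_ind: u v i => [|u k IH] v i e iu hi.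
  rewrite upE; case: ifP => // /andP[i1].
  rewrite (@arrow_rightN _ Q i.+1 i (Ordinal i1)) // negbK => /hi /(_ erefl).
  by [].
rewrite act_rcons; rewrite cat_rcons in e.
move: iu; rewrite mem_rcons inE negb_or => /andP[ik iu].
have ik' : (i : nat) != k by apply: contra_neq ik => /ord_inj.
have [ki|ki] := eqVneq (k : nat) i.+1.
  have -> : transp k i.+1 = k.+1 by rewrite /transp ki eqxx.
  have hR : ~~ arrow_right Q i.+1.
    rewrite (@arrow_rightP _ Q i.+1 i k) //; apply/negP => /(coxeter_before e).
    by rewrite (negbTE iu).
  rewrite (IH _ _ e); first by rewrite [RHS]upE hR -ki ltn_ord.
    by have := coxeter_uniq; rewrite e cat_uniq /= => /and3P[_ /norP[]].
  by move=> j jk _; apply: coxeter_before e jk.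
have -> : transp k i.+1 = i.+1.
  by rewrite /transp eqSS (negbTE ik') eq_sym (negbTE ki).
apply: (IH _ _ e iu) => j ji j1.
have := hi j ji j1; rewrite mem_rcons inE => /orP[/eqP ejk|//].
by rewrite -ejk j1 eqxx in ki.
Qed.

(** The root of [c] at the letter [i] is therefore [gamma i]: the positive roots made negative by
    the inverse of tau are the [gamma i]. *)
Lemma act_prefix u i v : c = u ++ i :: v ->
  act u i = dn i /\ act u i.+1 = up i.+1.
Proof.
move=> e; have iu : i \notin u.
  by have := coxeter_uniq; rewrite e cat_uniq /= => /and3P[_ /norP[]].
split; [apply: (act_prefix_dn e iu) | apply: (act_prefix_up e iu)];
  by move=> j ji _; apply: (coxeter_before e ji).
Qed.

Lemma act_fix (v : seq 'I_n) x :
  (forall k, k \in v -> (k : nat) != x /\ k.+1 != x) -> act v x = x.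
Proof.
elim: v => //= k v IH h; rewrite IH.
  have [h1 h2] := h k (mem_head _ _).
  by rewrite /transp ![x == _]eq_sym (negbTE h1) (negbTE h2).
by move=> j jv; apply: h; rewrite inE jv orbT.
Qed.

(** On labels tau is a single cycle: from 0 up through the labels that point right to n, then down
    through the other labels back to 0. *)
Lemma act_coxeter x : (0 < n)%N -> (x <= n)%N ->
  act c x = if arrow_right Q x || (x == 0)%N then up x.+1 else dn x.-1.
Proof.
move=> n0 xn; have uc := coxeter_uniq; case: ifP => [hx|/negbT].
  have xn' : (x < n)%N by case/orP: hx => [/arrow_right_bounds|/eqP]; lia.
  have [u [v e]] : exists u v, c = u ++ Ordinal xn' :: v.
    by case/splitPr: (coxeter_mem (Ordinal xn')) => u v; exists u, v.
  have [_ <-] := act_prefix e; rewrite {1}e act_cat /=.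
  rewrite e cat_uniq /= in uc; case/and3P: uc => _ /norP[_ /hasPn uv] /andP[xv _].
  rewrite (@act_fix v x); first by rewrite /transp /= eqxx.
  move=> k kv; split.
    by apply: contraNneq xv => kx; have -> : Ordinal xn' = k by apply: ord_inj.
  apply/eqP => kx; case/orP: hx => [hR|]; last by lia.
  rewrite (@arrow_rightP _ Q x k (Ordinal xn')) // in hR.
  by have := uv _ kv; rewrite (coxeter_before e hR).
rewrite negb_or => /andP[hR x0].
have xn' : (x.-1 < n)%N by lia.
have [u [v e]] : exists u v, c = u ++ Ordinal xn' :: v.
  by case/splitPr: (coxeter_mem (Ordinal xn')) => u v; exists u, v.
have [<- _] := act_prefix e; rewrite {1}e act_cat /=.
rewrite e cat_uniq /= in uc; case/and3P: uc => _ /norP[_ /hasPn uv] /andP[xv _].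
rewrite (@act_fix v x).
  by rewrite /transp /= prednK ?lt0n // eqxx; case: eqP => //; lia.
move=> k kv; split; last first.
  by apply: contraNneq xv => kx;
    have -> : Ordinal xn' = k by apply: ord_inj; rewrite /=; lia.
apply/eqP => kx; have x1 : (Ordinal xn').+1 = x by rewrite /=; lia.
rewrite (@arrow_rightN _ Q x _ k qQ x1 kx) negbK in hR.
by have := uv _ kv; rewrite (coxeter_before e hR).
Qed.

(** [Tpos] cuts the cycle just before n, and [Spos] just before 0. As long as a root stays positive,
    its lower end does not reach n and its upper end does not reach 0, so the cuts are never
    crossed. *)
Lemma Tpos_coxeter x : (x < n)%N -> act c x != n ->
  Tpos (act c x) = Tpos x - 1.
Proof.
move=> xn; rewrite act_coxeter //; [|lia|lia].
have [[u1 u2 _] [_ d2 _]] := (upP xn, dnP x.-1).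
case: ifP => [hx|/negbT].
  move=> un; rewrite (negbTE un) /= in u2.
  rewrite {1}/Tpos u2 count_right_up //; move: hx; rewrite /Tpos; case: ifP => hR /=.
    by rewrite (count_rightS xn) hR; lia.
  move=> /eqP x0; subst x; have := count_right_left 1.
  rewrite (count_leftS xn) arrow_right0 /=; lia.
rewrite negb_or => /andP[hR x0] _; rewrite Tpos_dn; last by lia.
by rewrite /Tpos (negbTE hR) prednK ?lt0n //; lia.
Qed.

Lemma Spos_coxeter y : (0 < y <= n)%N -> act c y != 0%N ->
  Spos (act c y) = Spos y - 1.
Proof.
move=> yn; rewrite act_coxeter; [|lia|lia].
have -> : (y == 0)%N = false by lia.
rewrite orbF; case: ifP => hR.
  have yn' : (y < n)%N by case/andP: (arrow_right_bounds hR).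
  by move=> _; rewrite Spos_up // /Spos hR (count_rightS yn') hR; lia.
move=> _; have [_ d2 _] := dnP y.-1.
rewrite /Spos (negbTE d2) hR count_left_dn prednK; lia.
Qed.

Variable xi : 'I_n -> int.
Hypothesis xiQ : height_function Q xi.

(** The diagram is connected, so a height function is known up to a constant. *)
Lemma height_functionP :
  exists k : int, forall i, xi i = (count_right i.+1)%:Z - (count_left i.+1)%:Z + k.
Proof.
case: (posnP n) => [n0|n0]; first by exists 0 => i; have := ltn_ord i; lia.
have l1 : (n.-1 < n)%N by lia.
exists (xi (Ordinal l1)) => i.
move: {2}(n - i)%N (leqnn (n - i)) => d.
elim: d i => [|d IH] i hd; first by have := ltn_ord i; lia.
have [e|ne] := eqVneq (i : nat) n.-1.
  have -> : i = Ordinal l1 by apply: ord_inj.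
  by rewrite /= prednK // count_rightn count_leftn; lia.
have i1 : (i.+1 < n)%N by have := ltn_ord i; lia.
have := IH (Ordinal i1); rewrite /= => /(_ ltac:(lia)).
rewrite (count_rightS i1) (count_leftS i1).
case hR: (arrow_right Q i.+1).
  rewrite (@arrow_rightP _ Q i.+1 i (Ordinal i1)) // in hR.
  by rewrite (xiQ hR); lia.
have := @arrow_rightN _ Q i.+1 i (Ordinal i1) qQ erefl erefl; rewrite hR.
by move/esym/negbFE/xiQ => ->; lia.
Qed.

Definition xi0 : int := classical_sets.xget 0 (fun k : int =>
  forall i, xi i = (count_right i.+1)%:Z - (count_left i.+1)%:Z + k).

Lemma xiE i : xi i = (count_right i.+1)%:Z - (count_left i.+1)%:Z + xi0.
Proof.
have [k hk] := height_functionP.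
by rewrite /xi0; case: classical_sets.xgetP => //= /(_ k).
Qed.

Lemma posroot_rootn x y : x != y -> (x <= n)%N -> (y <= n)%N ->
  posroot (rootn n x y) -> (x < y)%N.
Proof.
move=> xy xn yn /posrootP[x' [y' [h1 h2 e]]].
by have [] := root_inj xy xn yn _ h2 e; lia.
Qed.

(** Each application of tau lowers both [Tpos x] and [Spos y] by 1: their difference stays at the
    vertex number, counted from 1, and their sum falls by 2 like the second coordinate. *)
Lemma tau_gamma_coord k i :
  (forall l, (l <= k)%N -> posroot (tau_gamma Q c l i)) ->
  exists x y, [/\ (x < y <= n)%N, tau_gamma Q c k i = rootn n x y,
    Tpos x - Spos y = i.+1%:Z &
    Tpos x + Spos y = xi i - (2 * k)%:Z + n%:Z - xi0].
Proof.
have im := ltn_ord i; elim: k => [|k IH] hp.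
  exists (dn i), (up i.+1); rewrite -gamma_root.
  have [[d1 _ _] [u1 _ _]] := (dnP i, upP im).
  rewrite Tpos_dn // Spos_up // xiE; have := count_right_left i.+1.
  by split=> //; lia.
have [|x [y [xy e h1 h2]]] := IH; first by move=> l hl; apply: hp; lia.
have e' : tau_gamma Q c k.+1 i = rootn n (act c x) (act c y).
  by rewrite /tau_gamma /= -/(tau_gamma Q c k i) e weyl_root //; lia.
have xy' : (act c x < act c y)%N.
  apply: posroot_rootn; rewrite ?act_le //; try lia.
    by apply/eqP => /act_inj; lia.
  by rewrite -e'; apply: hp.
have yn := act_le c (n := n) (p := y) ltac:(lia).
exists (act c x), (act c y); split => //; first by lia.
  by rewrite Tpos_coxeter ?Spos_coxeter; lia.
by rewrite Tpos_coxeter ?Spos_coxeter; lia.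
Qed.

(* A positive root made negative by the inverse of the Coxeter element is one
   of the [gamma i]; otherwise one steps back, and [Tpos] grows. *)
Lemma tau_gamma_surj x y : (x < y <= n)%N -> exists k i,
  [/\ forall l, (l <= k)%N -> posroot (tau_gamma Q c l i)
    & tau_gamma Q c k i = rootn n x y].
Proof.
have Tn z : (z < n)%N -> Tpos z <= n%:Z.
  move=> zn; rewrite /Tpos; case: ifP => hR; first by have := count_right_left z; lia.
  by rewrite (count_leftS zn) hR; lia.
move=> xy; have: (`|n%:Z - Tpos x| < n.*2.+1)%N.
  have := Tn x; have := count_right_left x; rewrite /Tpos; case: ifP => _; lia.
move: {1}n.*2.+1 => d; elim: d x y xy => // d IH x y xy hd.
pose x' := act (rev c) x; pose y' := act (rev c) y.
have [ex ey] : act c x' = x /\ act c y' = y by rewrite !act_revK.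
have [xn' yn'] : (x' <= n)%N /\ (y' <= n)%N by rewrite !act_le //; lia.
case: (ltngtP x' y') => xy'; last by move: ex; rewrite xy' ey; lia.
  have Tx : Tpos x = Tpos x' - 1 by rewrite -ex Tpos_coxeter // ?ex; lia.
  have Tx' := Tn x'.
  have [||k [i [h e]]] := IH x' y'; [lia|lia|].
  have e' : tau_gamma Q c k.+1 i = rootn n x y.
    by rewrite /tau_gamma /= -/(tau_gamma Q c k i) e weyl_root // ex ey.
  exists k.+1, i; split=> // l; rewrite leq_eqVlt => /orP[/eqP ->|]; last exact: h.
  by rewrite e'; apply/posrootP; exists x, y; split=> //; lia.
have : (x, y) \in rseq c.
  by rewrite -ex -ey; apply: rseq_flip => //; rewrite ex ey; lia.
case/rseqP => u [i [v [/act_prefix[e1 e2] [e3 e4]]]].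
have e : tau_gamma Q c 0 i = rootn n x y.
  by rewrite /tau_gamma /= gamma_root -e1 -e2 e3 e4.
exists 0%N, i; split=> // l; rewrite leqn0 => /eqP ->; rewrite e.
by apply/posrootP; exists x, y; split=> //; lia.
Qed.

Lemma ar_phi_root v x y : (x < y <= n)%N ->
  ar_phi Q c xi v (rootn n x y) <->
  v.1.+1%:Z = Tpos x - Spos y /\ v.2 = Tpos x + Spos y - n%:Z + xi0.
Proof.
move=> xy; split=> [[k [hp e1 e2]]|[e1 e2]].
  have [x' [y' [xy' e h1 h2]]] := tau_gamma_coord hp.
  rewrite e in e2; have [] := root_inj _ _ _ _ _ e2; try lia.
  by move=> ex ey; subst x' y'; rewrite e1; lia.
have [k [i [hp e]]] := tau_gamma_surj xy.
have [x' [y' [xy' e' h1 h2]]] := tau_gamma_coord hp.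
rewrite e in e'; have [] := root_inj _ _ _ _ _ e'; try lia.
move=> ex ey; subst x' y'.
have ei : v.1 = i by apply: ord_inj; lia.
exists k; rewrite ei; split=> //; lia.
Qed.

(** The difference is the number of a vertex, since every positive root is reached from some
    [gamma i]. *)
Lemma Tpos_Spos_bounds x y : (x < y <= n)%N -> 0 < Tpos x - Spos y <= n%:Z.
Proof.
move=> xy; have [k [i [hp e]]] := tau_gamma_surj xy.
have [x' [y' [xy' e' h1 h2]]] := tau_gamma_coord hp.
rewrite e in e'; have [] := root_inj _ _ _ _ _ e'; try lia.
by move=> ex ey; subst x' y'; have := ltn_ord i; lia.
Qed.

Lemma ar_coord_root x y : (x < y <= n)%N ->
  ar_coord Q c xi (rootn n x y)
  = (`|Tpos x - Spos y|%N, Tpos x + Spos y - n%:Z + xi0).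
Proof.
move=> xy; have b := Tpos_Spos_bounds xy.
rewrite /ar_coord; apply: classical_sets.xget_unique.
  have i0 : (`|(Tpos x - Spos y)%R|.-1 < n)%N by lia.
  exists (Ordinal i0, Tpos x + Spos y - n%:Z + xi0).
    by rewrite ar_phi_root //=; split=> //; lia.
  by rewrite /=; congr pair; lia.
move=> _ [v hv ->]; move: hv; rewrite ar_phi_root // => -[e1 ->].
by congr pair; lia.
Qed.

Lemma ar_path_le v v' : ar_path Q c xi v v' -> v.2 <= v'.2.
Proof. by elim=> // {}v w {}v' [_ _ _ ->] _; lia. Qed.

(** Paths raise the second coordinate, and they run from the larger root to the smaller one. *)
Lemma ar_lt_root x y x' y' : (x < y <= n)%N -> (x' < y' <= n)%N ->
  ar_lt Q c xi (rootn n x y) (rootn n x' y') ->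
  Tpos x' + Spos y' <= Tpos x + Spos y.
Proof.
move=> xy xy' [[v [v' [hv hv' /ar_path_le hle]]] _].
move: hv hv'; rewrite !ar_phi_root // => -[_ e] [_ e']; lia.
Qed.

(* The second coordinates of the two roots differ by (T x - S z) - (T y - S y),
   where 0 < T x - S z <= n while T y - S y is 0 or n + 1. *)
Lemma ar_lt_arrow_right x y z : (x < y)%N -> (y < z <= n)%N ->
  (ar_lt Q c xi (rootn n x y) (rootn n y z) -> arrow_right Q y) /\
  (ar_lt Q c xi (rootn n y z) (rootn n x y) -> ~~ arrow_right Q y).
Proof.
move=> xy yz.
have b1 := @Tpos_Spos_bounds x y ltac:(lia).
have b2 := Tpos_Spos_bounds yz.
have b3 := @Tpos_Spos_bounds x z ltac:(lia).
have := TposE y.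
split=> /ar_lt_root; case: (arrow_right Q y) H => // H /(_ ltac:(lia) ltac:(lia)); lia.
Qed.

End Coxeter.
End ARCoordinates.

(** * Tensor products of matrices and of representations *)

Section MatrixLemmas.
Variable K : fieldType.

Lemma mx_surjP d d' (F : 'M[K]_(d', d)) :
  mx_surj F <-> exists G : 'M[K]_(d, d'), F *m G = 1%:M.
Proof.
split=> [hF|[G hG] y]; last by exists (G *m y); rewrite mulmxA hG mul1mx.
have [g hg] := choice (fun i : 'I_d' => hF (delta_mx i 0)).
exists (\matrix_(l, i) g i l 0); apply/matrixP => k i.
have := congr1 (fun M : 'cV_d' => M k 0) (hg i); rewrite !mxE /=.
by rewrite andbT => <-; apply: eq_bigr => l _; rewrite !mxE.
Qed.

(** The column chosen for the row [k] is a nonzero multiple of the k-th basis vector; rescaled,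
    these columns give a right inverse. *)
Lemma mx_surj_pivots d d' (F : 'M[K]_(d', d)) :
  (forall k, exists l, F k l != 0 /\ forall k', k' != k -> F k' l = 0) ->
  mx_surj F.
Proof.
move=> h; have [L hL] := choice h; apply/mx_surjP.
exists (\matrix_(l, k) ((l == L k)%:R / F k (L k))).
apply/matrixP => k' k; rewrite !mxE (bigD1 (L k)) //= big1 => [|l nl]; last first.
  by rewrite mxE (negbTE nl) mul0r mulr0.
have [h1 h2] := hL k; rewrite mxE eqxx mul1r addr0.
by have [->|/h2 ->] := eqVneq k' k; rewrite ?mulfV ?mul0r.
Qed.

Lemma tensmxDl m n p r (A B : 'M[K]_(m, n)) (C : 'M[K]_(p, r)) :
  (A + B) *t C = A *t C + B *t C.
Proof.
apply/matrixP => i j.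
by case: (mxtens_indexP i) => i1 i2; case: (mxtens_indexP j) => j1 j2;
   rewrite [RHS]mxE !tensmxE mxE mulrDl.
Qed.

Lemma tensmxDr m n p r (A : 'M[K]_(m, n)) (B C : 'M[K]_(p, r)) :
  A *t (B + C) = A *t B + A *t C.
Proof.
apply/matrixP => i j.
by case: (mxtens_indexP i) => i1 i2; case: (mxtens_indexP j) => j1 j2;
   rewrite [RHS]mxE !tensmxE mxE mulrDr.
Qed.

Lemma tensmx11 m p : (1%:M : 'M[K]_m) *t (1%:M : 'M[K]_p) = 1%:M.
Proof.
apply/matrixP => i j.
case: (mxtens_indexP i) => i1 i2; case: (mxtens_indexP j) => j1 j2.
rewrite tensmxE !mxE (can_eq (@mxtens_indexK _ _)) xpair_eqE.
by do 2!case: eqP => _; rewrite ?mulr1 ?mulr0.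
Qed.

(** The two bracketings of a triple tensor product index their bases differently, so associativity
    is a permutation matrix and not an equality. *)
Definition assoc_index a b c (v : 'I_(a * b * c)) : 'I_(a * (b * c)) :=
  let: (ij, k) := mxtens_unindex v in let: (i, j) := mxtens_unindex ij in
  mxtens_index (i, mxtens_index (j, k)).

Definition assoc_mx a b c : 'M[K]_(a * (b * c), a * b * c) :=
  \matrix_(u, v) (u == assoc_index v)%:R.

Lemma assoc_indexE a b c i j k : @assoc_index a b c
  (mxtens_index (mxtens_index (i, j), k)) = mxtens_index (i, mxtens_index (j, k)).
Proof. by rewrite /assoc_index !mxtens_indexK. Qed.

Lemma assoc_index_inj a b c : injective (@assoc_index a b c).
Proof.
move=> u v; case: (mxtens_indexP u) => ij k; case: (mxtens_indexP ij) => i j.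
case: (mxtens_indexP v) => ij' k'; case: (mxtens_indexP ij') => i' j'.
rewrite !assoc_indexE => /(can_inj (@mxtens_indexK _ _)) e.
have /= -> := congr1 fst e; move/(congr1 snd): e => /=.
by move=> /(can_inj (@mxtens_indexK _ _)) [-> ->].
Qed.

Lemma assoc_mx_intertwine a b c (A : 'M_a) (B : 'M_b) (C : 'M_c) :
  assoc_mx a b c *m (A *t B *t C) = A *t (B *t C) *m assoc_mx a b c.
Proof.
apply/matrixP => u v.
case: (mxtens_indexP u) => i jk; case: (mxtens_indexP jk) => j k.
case: (mxtens_indexP v) => ij' k'; case: (mxtens_indexP ij') => i' j'.
rewrite -!assoc_indexE [LHS]mxE [RHS]mxE.
rewrite (bigD1 (mxtens_index (mxtens_index (i, j), k))) //= big1 => [|l nl].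
  rewrite (bigD1 (mxtens_index (i', mxtens_index (j', k')))) //=.
  rewrite big1 => [|l nl]; last first.
    by rewrite [assoc_mx _ _ _ _ _]mxE !assoc_indexE (negbTE nl) mulr0.
  rewrite !addr0 [assoc_mx _ _ _ _ _]mxE [assoc_mx _ _ _ _ _]mxE.
  by rewrite !assoc_indexE !eqxx mul1r mulr1 !tensmxE mulrA.
by rewrite mxE (inj_eq (@assoc_index_inj _ _ _)) eq_sym (negbTE nl) mul0r.
Qed.

Lemma assoc_mx_surj a b c : mx_surj (assoc_mx a b c).
Proof.
apply: mx_surj_pivots => u.
case: (mxtens_indexP u) => i jk; case: (mxtens_indexP jk) => j k.
exists (mxtens_index (mxtens_index (i, j), k)); rewrite mxE assoc_indexE eqxx.
by split=> [|u' h]; rewrite ?oner_eq0 // mxE assoc_indexE (negbTE h).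
Qed.

End MatrixLemmas.

Section TensorEpi.
Variables (K : fieldType) (n : nat).
Implicit Types M N : uq_rep K n.

Lemma uq_epi_refl M : uq_epi M M.
Proof.
exists 1%:M; first by move=> j; rewrite !mul1mx !mulmx1.
by move=> y; exists y; rewrite mul1mx.
Qed.

Lemma uq_epi_trans M N P : uq_epi M N -> uq_epi N P -> uq_epi M P.
Proof.
move=> [F hF sF] [G hG sG]; exists (G *m F).
  move=> j; have [e1 f1 k1 l1] := hF j; have [e2 f2 k2 l2] := hG j.
  by rewrite -!mulmxA e1 f1 k1 l1 !mulmxA e2 f2 k2 l2.
move=> y; have [x <-] := sG y; have [x' <-] := sF x.
by exists x'; rewrite mulmxA.
Qed.

Lemma uq_epi_tensor M M' N N' : uq_epi M M' -> uq_epi N N' ->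
  uq_epi (uq_tensor M N) (uq_tensor M' N').
Proof.
move=> [F hF /mx_surjP[F' FF']] [G hG /mx_surjP[G' GG']].
exists (F *t G); last first.
  by apply/mx_surjP; exists (F' *t G'); rewrite tensmx_mul FF' GG' tensmx11.
move=> j; have [e1 f1 k1 l1] := hF j; have [e2 f2 k2 l2] := hG j.
rewrite /= !mulmxDr !mulmxDl !tensmx_mul.
by rewrite e1 f1 k1 l1 e2 f2 k2 l2 !mul1mx !mulmx1.
Qed.

Lemma uq_epi_assoc M N P :
  uq_epi (uq_tensor (uq_tensor M N) P) (uq_tensor M (uq_tensor N P)).
Proof.
exists (assoc_mx K (uq_dim M) (uq_dim N) (uq_dim P)); last exact: assoc_mx_surj.
move=> j; split=> /=; rewrite -?(tensmx11 K) ?tensmxDl ?tensmxDr;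
  by rewrite ?mulmxDr ?mulmxDl !assoc_mx_intertwine ?addrA.
Qed.

Lemma uq_tensor_seq_rcons (s : seq (uq_rep K n)) M : (0 < size s)%N ->
  uq_tensor_seq (rcons s M) = uq_tensor (uq_tensor_seq s) M.
Proof. by case: s => //= N s _; rewrite foldl_rcons. Qed.

(** [uq_tensor_seq] brackets to the left, so the second block has to be rebracketed one factor at a
    time. *)
Lemma uq_epi_tensor_cat (s s' : seq (uq_rep K n)) :
  (0 < size s)%N -> (0 < size s')%N ->
  uq_epi (uq_tensor_seq (s ++ s'))
         (uq_tensor (uq_tensor_seq s) (uq_tensor_seq s')).
Proof.
move=> s0; elim/last_ind: s' => // s' M IH _.
have [s'0|s'0] := posnP (size s').
  rewrite (size0nil s'0) /= cats1 uq_tensor_seq_rcons //; exact: uq_epi_refl.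
rewrite -rcons_cat !uq_tensor_seq_rcons ?size_cat //; last by lia.
apply: uq_epi_trans (uq_epi_assoc _ _ _).
by apply: uq_epi_tensor (uq_epi_refl _); apply: IH.
Qed.

End TensorEpi.

(** * Dorey's rule for the fundamental modules *)

Section Inversions.
Variable n : nat.
Hypothesis n_gt0 : (0 < n)%N.
Implicit Types (j a b : 'I_n.+1) (A B : {set 'I_n.+1}).

Lemma ordSE j : ordS j = (if j == n :> nat then 0 else j.+1)%N :> nat.
Proof.
rewrite /=; case: eqP => [->|ne]; first by rewrite modnn.
by rewrite modn_small //; have := ltn_ord j; lia.
Qed.

Lemma ordS_neq j : (ordS j == j) = false.
Proof.
by apply/eqP => /(congr1 (@nat_of_ord _)); rewrite ordSE; case: eqP; lia.
Qed.

(* The rank of an index in the order 1 < 2 < ... < n < 0, in which e_0 moves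
   the smallest index to the largest one. *)
Definition rk a : nat := if a == 0 :> nat then n else a.-1.

Lemma rk_ordS j : j != ord0 -> rk (ordS j) = (rk j).+1.
Proof.
rewrite -val_eqE /rk ordSE /= => j0; rewrite (negbTE j0).
by case: (_ =P n) => [->|_] /=; lia.
Qed.

Lemma rk_le a : (rk a <= n)%N.
Proof. by rewrite /rk; have := ltn_ord a; case: eqP; lia. Qed.

Lemma rk0 : rk ord0 = n. Proof. by []. Qed.
Lemma rk1 : rk (ordS ord0) = 0%N.
Proof. by rewrite /rk ordSE /=; case: (0 =P n)%N => //; lia. Qed.

Lemma rk_inj : injective rk.
Proof.
move=> a b; rewrite /rk; have := ltn_ord a; have := ltn_ord b.
by case: eqP; case: eqP => ? ? ? ? ?; apply: ord_inj; lia.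
Qed.

Definition invr a B : nat := #|[set b in B | (rk b < rk a)%N]|.
Definition invl A b : nat := #|[set a in A | (rk b < rk a)%N]|.
Definition inv A B : nat := \sum_(a in A) invr a B.

Lemma inv_invl A B : inv A B = (\sum_(b in B) invl A b)%N.
Proof.
rewrite /inv /invr /invl.
under eq_bigr do rewrite -sum1dep_card big_mkcondr.
under [RHS]eq_bigr do rewrite -sum1dep_card big_mkcondr.
exact: exchange_big.
Qed.

Definition e_set j A : {set 'I_n.+1} := j |: (A :\ ordS j).
Definition f_set j A : {set 'I_n.+1} := ordS j |: (A :\ j).

(** Moving one element of [A] changes only its own contribution. The identity is additive on both
    sides to avoid truncated subtraction. *)
Lemma inv_esetl j A B : ordS j \in A -> j \notin A ->
  (inv (e_set j A) B + invr (ordS j) B = inv A B + invr j B)%N.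
Proof.
move=> h1 h0; rewrite /inv [in RHS](big_setD1 _ h1) /=.
by rewrite big_setU1 ?inE ?(negbTE h0) ?andbF //=; ring.
Qed.

Lemma inv_esetr j A B : ordS j \in B -> j \notin B ->
  (inv A (e_set j B) + invl A (ordS j) = inv A B + invl A j)%N.
Proof.
move=> h1 h0; rewrite !inv_invl [in RHS](big_setD1 _ h1) /=.
by rewrite big_setU1 ?inE ?(negbTE h0) ?andbF //=; ring.
Qed.

Lemma invr_ordS j B : j != ord0 -> invr (ordS j) B = (invr j B + (j \in B))%N.
Proof.
move=> j0; rewrite /invr rk_ordS //.
have [jB|jB] := boolP (j \in B).
  rewrite (cardsD1 j) inE jB ltnSn addnC; congr (#|pred_of_set _| + _)%N.
  apply/setP => b; rewrite !inE ltnS leq_eqVlt.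
  have [->|bj] := eqVneq b j; first by rewrite ltnn andbF.
  by rewrite (inj_eq rk_inj) (negbTE bj).
rewrite addn0; congr #|pred_of_set _|; apply/setP => b; rewrite !inE ltnS leq_eqVlt.
rewrite (inj_eq rk_inj); have [->|//] := eqVneq b j.
by rewrite (negbTE jB).
Qed.

Lemma invl_ordS A j : j != ord0 -> invl A j = (invl A (ordS j) + (ordS j \in A))%N.
Proof.
move=> j0; rewrite /invl rk_ordS //.
have [jB|jB] := boolP (ordS j \in A).
  rewrite (cardsD1 (ordS j)) inE jB rk_ordS // ltnSn addnC; congr (#|pred_of_set _| + _)%N.
  apply/setP => b; rewrite !inE [in RHS]ltn_neqAle -rk_ordS //.
  rewrite (inj_eq rk_inj) [ordS j == b]eq_sym rk_ordS //.
  by rewrite andbCA.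
rewrite addn0; congr #|pred_of_set _|; apply/setP => b; rewrite !inE.
rewrite [in RHS]ltn_neqAle -rk_ordS // (inj_eq rk_inj) rk_ordS //.
by have [<-|//] := eqVneq (ordS j) b; rewrite (negbTE jB).
Qed.

Lemma invr_0 B : ord0 \notin B -> invr ord0 B = #|B|.
Proof.
move=> h; congr #|pred_of_set _|; apply/setP => b; rewrite !inE rk0.
have [bB|//] := boolP (b \in B); rewrite /= ltn_neqAle rk_le andbT -rk0.
by rewrite (inj_eq rk_inj); apply: contraNneq h => <-.
Qed.

Lemma invr_1 B : invr (ordS ord0) B = 0%N.
Proof. by apply/eqP; rewrite cards_eq0; apply/eqP/setP => b; rewrite !inE rk1 andbF. Qed.

Lemma invl_0 A : invl A ord0 = 0%N.
Proof.
apply/eqP; rewrite cards_eq0; apply/eqP/setP => b; rewrite !inE rk0.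
by rewrite ltnNge rk_le andbF.
Qed.

Lemma invl_1 A : (invl A (ordS ord0) + (ordS ord0 \in A) = #|A|)%N.
Proof.
rewrite [RHS](cardsD1 (ordS ord0)) addnC; congr (_ + _)%N.
congr #|pred_of_set _|; apply/setP => b; rewrite !inE rk1 lt0n -rk1.
by rewrite (inj_eq rk_inj) andbC.
Qed.

Lemma mem_eset j A : (j \in e_set j A) * (ordS j \in e_set j A = false) *
  (forall x, x != j -> x != ordS j -> (x \in e_set j A) = (x \in A)).
Proof.
rewrite !inE !eqxx ordS_neq /=; split=> // x h1 h2.
by rewrite !inE (negbTE h1) h2.
Qed.

Lemma mem_fset j A : (ordS j \in f_set j A) * (j \in f_set j A = false) *
  (forall x, x != j -> x != ordS j -> (x \in f_set j A) = (x \in A)).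
Proof.
rewrite !inE !eqxx [_ == ordS j]eq_sym ordS_neq /=; split=> // x h1 h2.
by rewrite !inE (negbTE h2) h1.
Qed.

Lemma card_eset j A : ordS j \in A -> j \notin A -> #|e_set j A| = #|A|.
Proof.
by move=> h1 h0; rewrite cardsU1 inE (negbTE h0) andbF [RHS](cardsD1 (ordS j)) h1.
Qed.

Lemma card_fset j A : ordS j \notin A -> j \in A -> #|f_set j A| = #|A|.
Proof.
by move=> h1 h0; rewrite cardsU1 inE (negbTE h1) andbF [RHS](cardsD1 j) h0.
Qed.

Lemma esetK j A : ordS j \in A -> j \notin A -> f_set j (e_set j A) = A.
Proof.
move=> h1 h0; apply/setP => x; rewrite !inE.
have [->|xS] := eqVneq x (ordS j); first by rewrite h1.
by have [->|xj] := eqVneq x j; rewrite /= ?(negbTE h0).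
Qed.

Lemma fsetK j A : ordS j \notin A -> j \in A -> e_set j (f_set j A) = A.
Proof.
move=> h1 h0; apply/setP => x; rewrite !inE.
have [->|xj] := eqVneq x j; first by rewrite h0.
by have [->|xS] := eqVneq x (ordS j); rewrite /= ?(negbTE h1).
Qed.

Lemma setC_eset j A : ~: e_set j A = f_set j (~: A).
Proof.
apply/setP => x; rewrite !inE negb_or negb_and negbK.
have [->|xS] := eqVneq x (ordS j); first by rewrite ordS_neq.
by [].
Qed.

End Inversions.

Section SubsetMatrices.
Variables (K : fieldType) (n : nat).
Implicit Types (A B C : {set 'I_n.+1}).

Lemma scale_subset_mx r (x : K) a :
  x *: subset_mx r a = subset_mx (n := n) r (fun B A => x * a B A).
Proof. by apply/matrixP => k l; rewrite !mxE. Qed.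

Lemma subset_mx1 r :
  1%:M = subset_mx (n := n) r (fun B A => (B == A)%:R : K).
Proof.
by apply/matrixP => k l; rewrite !mxE (inj_eq enum_val_inj).
Qed.

Definition triple_mx r1 r2 r3 (G : {set 'I_n.+1} -> {set 'I_n.+1} -> {set 'I_n.+1} -> K) :
    'M[K]_(#|subsets n r3|, #|subsets n r1| * #|subsets n r2|) :=
  \matrix_(k, l) G (enum_val k) (enum_val (mxtens_unindex l).1)
                   (enum_val (mxtens_unindex l).2).

Lemma triple_mxE r1 r2 r3 G k l1 l2 : triple_mx r1 r2 r3 G k (mxtens_index (l1, l2))
  = G (enum_val k) (enum_val l1) (enum_val l2).
Proof. by rewrite mxE mxtens_indexK. Qed.

Lemma triple_mx_tens r1 r2 r3 G (a b : {set 'I_n.+1} -> {set 'I_n.+1} -> K) k l1 l2 :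
  (triple_mx r1 r2 r3 G *m (subset_mx r1 a *t subset_mx r2 b)) k (mxtens_index (l1, l2))
  = \sum_(A in subsets n r1) \sum_(B in subsets n r2)
      G (enum_val k) A B * (a A (enum_val l1) * b B (enum_val l2)).
Proof.
rewrite mxE [RHS]big_enum_val /=.
under [RHS]eq_bigr do rewrite big_enum_val /=.
rewrite pair_big [LHS](reindex (@mxtens_index #|subsets n r1| #|subsets n r2|)) /=; last first.
  by exists (@mxtens_unindex _ _) => ? _; rewrite ?mxtens_indexK ?mxtens_unindexK.
by apply: eq_bigr => -[l l'] _; rewrite triple_mxE tensmxE !mxE.
Qed.

Lemma subset_mx_triple r1 r2 r3 G (a : {set 'I_n.+1} -> {set 'I_n.+1} -> K) k l1 l2 :
  (subset_mx r3 a *m triple_mx r1 r2 r3 G) k (mxtens_index (l1, l2))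
  = \sum_(C in subsets n r3)
      a (enum_val k) C * G C (enum_val l1) (enum_val l2).
Proof.
rewrite mxE [RHS]big_enum_val /=.
by apply: eq_bigr => l _; rewrite triple_mxE !mxE.
Qed.

(** When [x] vanishes, [D] may have the wrong cardinality: [e_set j A] is sure to be a basis index
    only where [e_j] does not kill v_A. Hence the conditional membership. *)
Lemma sum_pick (T : finType) (S : {set T}) (D : T) (f : T -> K) (x : K) :
  (x != 0 -> D \in S) ->
  \sum_(A in S) f A * (x * (A == D)%:R) = x * f D.
Proof.
have [-> _|x0 /(_ isT) DS] := eqVneq x 0.
  by rewrite mul0r big1 // => A _; rewrite mul0r mulr0.
rewrite (bigD1 D) //= big1 ?addr0 ?eqxx ?mulr1 1?mulrC // => A /andP[_ /negbTE ->].
by rewrite !mulr0.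
Qed.

Lemma triple_mx_pick r1 r2 r3 G (a b : {set 'I_n.+1} -> {set 'I_n.+1} -> K)
    k l1 l2 (x y : K) D E :
  (forall A, a A (enum_val l1) = x * (A == D)%:R) ->
  (forall B, b B (enum_val l2) = y * (B == E)%:R) ->
  (x != 0 -> D \in subsets n r1) -> (y != 0 -> E \in subsets n r2) ->
  (triple_mx r1 r2 r3 G *m (subset_mx r1 a *t subset_mx r2 b)) k (mxtens_index (l1, l2))
  = x * y * G (enum_val k) D E.
Proof.
move=> ha hb hD hE; rewrite triple_mx_tens.
transitivity (\sum_(A in subsets n r1)
    y * G (enum_val k) A E * (x * (A == D)%:R)); last first.
  by rewrite sum_pick // mulrA.
apply: eq_bigr => A _.
rewrite -(sum_pick (G (enum_val k) A) hE) mulr_suml.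
by apply: eq_bigr => B _; rewrite ha hb mulrCA mulrC.
Qed.

Lemma subset_triple_pick r1 r2 r3 G (a : {set 'I_n.+1} -> {set 'I_n.+1} -> K)
    k l1 l2 (x : K) D :
  (forall C, a (enum_val k) C = x * (C == D)%:R) -> (x != 0 -> D \in subsets n r3) ->
  (subset_mx r3 a *m triple_mx r1 r2 r3 G) k (mxtens_index (l1, l2))
  = x * G D (enum_val l1) (enum_val l2).
Proof.
move=> ha hD; rewrite subset_mx_triple -(sum_pick (fun C => G C _ _) hD).
by apply: eq_bigr => C _; rewrite ha mulrC.
Qed.

Lemma card_enum_val r (k : 'I_#|subsets n r|) : #|enum_val k| = r.
Proof. by have := enum_valP k; rewrite inE => /eqP. Qed.

End SubsetMatrices.

Section FundamentalHom.
Variables (K : fieldType) (q : K) (n : nat).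
Hypotheses (q_neq0 : q != 0) (n_gt0 : (0 < n)%N).
Implicit Types (A B C : {set 'I_n.+1}) (j : 'I_n.+1).

(* For [t = false]: [C] is the disjoint union of [A] and [B]; for [t = true]
   the same for the complements. *)
Definition bit_ok (t a b c : bool) : bool :=
  let a' := a (+) t in let b' := b (+) t in
  (c (+) t == a' || b') && ~~ (a' && b').

Variables (t : bool) (r1 r2 r3 : nat).
Variables (phi : {set 'I_n.+1} -> {set 'I_n.+1} -> K) (X Y Z : K).
Hypotheses (X0 : X != 0) (Y0 : Y != 0) (Z0 : Z != 0).

Definition tw j (x : K) : K := if j == ord0 then x else 1.

(** Compatibility with [e_j] when it acts on the first factor only, on the second only ([phi_r]), or
    on both ([phi_lr]). In the last case v_A (x) v_B is sent to 0, so the two terms must cancel; the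
    factor [q] there is the eigenvalue of K_j^-1 on v_B. *)
Hypothesis phi_l : forall j A B, #|A| = r1 -> #|B| = r2 ->
  ordS j \in A -> j \in A = false -> j \in B = t -> ordS j \in B = t ->
  tw j X * phi (e_set j A) B = tw j Z * phi A B.
Hypothesis phi_r : forall j A B, #|A| = r1 -> #|B| = r2 ->
  ordS j \in B -> j \in B = false -> j \in A = t -> ordS j \in A = t ->
  tw j Y * phi A (e_set j B) = tw j Z * phi A B.
Hypothesis phi_lr : forall j A B, #|A| = r1 -> #|B| = r2 ->
  ordS j \in A -> j \in A = false -> ordS j \in B -> j \in B = false ->
  tw j X * q * phi (e_set j A) B + tw j Y * phi A (e_set j B) = 0.

Definition triple_coef C A B : K :=
  [forall x, bit_ok t (x \in A) (x \in B) (x \in C)]%:R * phi A B.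

Definition ok_off j A B C :=
  [forall x, (x != j) ==> (x != ordS j) ==> bit_ok t (x \in A) (x \in B) (x \in C)].

Lemma ok_split j A B C :
  [forall x, bit_ok t (x \in A) (x \in B) (x \in C)]
  = [&& ok_off j A B C, bit_ok t (j \in A) (j \in B) (j \in C)
      & bit_ok t (ordS j \in A) (ordS j \in B) (ordS j \in C)].
Proof.
apply/forallP/and3P => [h|[/forallP h h0 h1] x].
  by split=> //; apply/forallP => x; rewrite h !implybT.
have [->//|xj] := eqVneq x j; have [->//|xS] := eqVneq x (ordS j).
by have := h x; rewrite xj xS.
Qed.

Lemma ok_off_eq j A A' B B' C C' :
  (forall x, x != j -> x != ordS j -> (x \in A) = (x \in A')) ->
  (forall x, x != j -> x != ordS j -> (x \in B) = (x \in B')) ->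
  (forall x, x != j -> x != ordS j -> (x \in C) = (x \in C')) ->
  ok_off j A B C = ok_off j A' B' C'.
Proof.
move=> hA hB hC; apply: eq_forallb => x.
case xj: (x != j) => //=; case xS: (x != ordS j) => //=.
by rewrite hA ?hB ?hC.
Qed.

Lemma tw_neq0 j (x : K) : x != 0 -> tw j x != 0.
Proof. by rewrite /tw; case: ifP; rewrite ?oner_eq0. Qed.

(** A matrix entry of the commutation with [e_j]. Membership away from [j] and [ordS j] is the same
    in all terms, so there remains a check over the six bits at these two places. *)
Lemma coef_e j A B C : #|A| = r1 -> #|B| = r2 ->
  tw j X * ((ordS j \in A) && (j \notin A))%:R * q ^ (- K_weight j B)
    * triple_coef C (e_set j A) B
  + tw j Y * ((ordS j \in B) && (j \notin B))%:R * triple_coef C A (e_set j B)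
  = tw j Z * ((j \in C) && (ordS j \notin C))%:R * triple_coef (f_set j C) A B.
Proof.
move=> cA cB; rewrite /triple_coef !(ok_split j).
have eA := mem_eset n_gt0 j A; have eB := mem_eset n_gt0 j B.
have eC := mem_fset n_gt0 j C.
rewrite (@ok_off_eq j (e_set j A) A B B C C) //; last exact: eA.2.
rewrite (@ok_off_eq j A A (e_set j B) B C C) //; last exact: eB.2.
rewrite (@ok_off_eq j A A B B (f_set j C) C) //; last exact: eC.2.
rewrite !eA.1 !eB.1 !eC.1.
case: ok_off; last by rewrite /= !mul0r !mulr0 addr0.
have h1 := @phi_l j A B cA cB; have h2 := @phi_r j A B cA cB.
have h3 := @phi_lr j A B cA cB.
rewrite /K_weight; move: h1 h2 h3.
case: (ordS j \in A); case: (j \in A); case: (ordS j \in B); case: (j \in B);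
case: (ordS j \in C); case: (j \in C); rewrite /bit_ok; case: t => /= h1 h2 h3;
rewrite ?(mul0r, mulr0, addr0, add0r) // ?mul1r ?mulr1 ?subrr ?oppr0 ?expr0z ?mulr1;
try (by rewrite h1); try (by rewrite h2).
all: by rewrite ?sub0r ?opprK ?expr1z h3.
Qed.

Lemma coef_f j A B C : #|A| = r1 -> #|B| = r2 ->
  (tw j X)^-1 * ((j \in A) && (ordS j \notin A))%:R
    * triple_coef C (f_set j A) B
  + (tw j Y)^-1 * ((j \in B) && (ordS j \notin B))%:R * q ^ K_weight j A
    * triple_coef C A (f_set j B)
  = (tw j Z)^-1 * ((ordS j \in C) && (j \notin C))%:R * triple_coef (e_set j C) A B.
Proof.
move=> cA cB; rewrite /triple_coef !(ok_split j).
have fA := mem_fset n_gt0 j A; have fB := mem_fset n_gt0 j B.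
have fC := mem_eset n_gt0 j C.
rewrite (@ok_off_eq j (f_set j A) A B B C C) //; last exact: fA.2.
rewrite (@ok_off_eq j A A (f_set j B) B C C) //; last exact: fB.2.
rewrite (@ok_off_eq j A A B B (e_set j C) C) //; last exact: fC.2.
rewrite !fA.1 !fB.1 !fC.1.
case: ok_off; last by rewrite /= !mul0r !mulr0 addr0.
have [x0 y0 z0] : [/\ tw j X != 0, tw j Y != 0 & tw j Z != 0] by rewrite !tw_neq0.
(* The relations needed for [f_j] are those for [e_j], taken at [f_set j A] and [f_set j B] and
   divided by the twists. *)
have h1 : j \in A -> ordS j \in A = false -> j \in B = t -> ordS j \in B = t ->
    (tw j X)^-1 * phi (f_set j A) B = (tw j Z)^-1 * phi A B.
  move=> jA SA b0 b1; have := @phi_l j (f_set j A) B.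
  rewrite card_fset ?SA // fsetK ?SA // !fA.1 => /(_ cA cB isT erefl b0 b1) e.
  by rewrite -[phi (f_set j A) B](mulKf z0) -e mulrCA mulKf.
have h2 : j \in B -> ordS j \in B = false -> j \in A = t -> ordS j \in A = t ->
    (tw j Y)^-1 * phi A (f_set j B) = (tw j Z)^-1 * phi A B.
  move=> jA SA b0 b1; have := @phi_r j A (f_set j B).
  rewrite card_fset ?SA // fsetK ?SA // !fB.1 => /(_ cA cB isT erefl b0 b1) e.
  by rewrite -[phi A (f_set j B)](mulKf z0) -e mulrCA mulKf.
have h3 : j \in A -> ordS j \in A = false -> j \in B -> ordS j \in B = false ->
    (tw j X)^-1 * phi (f_set j A) B + (tw j Y)^-1 * q * phi A (f_set j B) = 0.
  move=> jA SA jB SB; have := @phi_lr j (f_set j A) (f_set j B).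
  rewrite !card_fset ?SA ?SB // !fsetK ?SA ?SB // !fA.1 !fB.1.
  move=> /(_ cA cB isT erefl isT erefl) e.
  apply: (mulfI x0); apply: (mulfI y0); rewrite !mulr0 -[RHS]e.
  by field; rewrite x0 y0.
rewrite /K_weight; move: h1 h2 h3.
case: (ordS j \in A); case: (j \in A); case: (ordS j \in B); case: (j \in B);
case: (ordS j \in C); case: (j \in C); rewrite /bit_ok; case: t => /= h1 h2 h3;
rewrite ?(mul0r, mulr0, addr0, add0r) // ?mul1r ?mulr1 ?subrr ?oppr0 ?expr0z ?mulr1;
try (by rewrite h1); try (by rewrite h2).
all: by rewrite ?subr0 ?expr1z h3.
Qed.

(** Where the coefficient is not forced to 0 by [bit_ok], the weight of [C] is the sum of those of
    [A] and [B]. The exponent [s] is 1 for [K_j] and -1 for its inverse. *)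
Lemma coef_K j A B C (s : int) :
  triple_coef C A B * (q ^ (s * K_weight j A) * q ^ (s * K_weight j B))
  = q ^ (s * K_weight j C) * triple_coef C A B.
Proof.
rewrite /triple_coef (ok_split j) -expfzDr // -mulrDr.
have [/and3P[_ h0 h1]|_] := boolP [&& _, _ & _]; last by rewrite !mul0r mulr0.
rewrite mulrC; congr (q ^ (s * _) * _); move: h0 h1; rewrite /K_weight /bit_ok.
case: (ordS j \in A); case: (j \in A); case: (ordS j \in B); case: (j \in B);
case: (ordS j \in C); case: (j \in C); by case: t.
Qed.

Lemma triple_hom : uq_hom (M := uq_tensor (uq_twist X (uq_fund q n r1))
    (uq_twist Y (uq_fund q n r2))) (N := uq_twist Z (uq_fund q n r3))
  (triple_mx r1 r2 r3 triple_coef).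
Proof.
have twE (d : nat) (j : 'I_n.+1) (x : K) (M : 'M[K]_d) :
    (if j == ord0 then x *: M else M) = tw j x *: M.
  by rewrite /tw; case: ifP; rewrite ?scale1r.
have twV j x : tw j x^-1 = (tw j x)^-1 by rewrite /tw; case: ifP; rewrite ?invr1.
have addE d d' (M N : 'M[K]_(d, d')) k l : (M + N) k l = M k l + N k l.
  by rewrite mxE.
have bR (x : K) (b : bool) : x * b%:R != 0 -> b by case: b; rewrite ?mulr0 ?eqxx.
have inS (r : nat) A : #|A| = r -> A \in subsets n r by move=> h; rewrite inE h.
have pK r (D : {set 'I_n.+1}) (x : K) : #|D| = r -> x != 0 -> D \in subsets n r.
  by move=> h _; apply: inS.
have hK (D : {set 'I_n.+1}) (x : int) A :
    (A == D)%:R * q ^ x = q ^ x * (A == D)%:R by rewrite mulrC.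
have h1 (D : {set 'I_n.+1}) A : (A == D)%:R = 1 * (A == D)%:R :> K by rewrite mul1r.
have he j (x : K) (D A : {set 'I_n.+1}) :
    x * [&& ordS j \in D, j \notin D & A == e_set j D]%:R
    = x * ((ordS j \in D) && (j \notin D))%:R * (A == e_set j D)%:R.
  by rewrite -mulrA -natrM mulnb andbA.
have hf j (x : K) (D A : {set 'I_n.+1}) :
    x * [&& j \in D, ordS j \notin D & A == f_set j D]%:R
    = x * ((j \in D) && (ordS j \notin D))%:R * (A == f_set j D)%:R.
  by rewrite -mulrA -natrM mulnb andbA.
have he' j (x : K) (D A : {set 'I_n.+1}) :
    x * [&& ordS j \in A, j \notin A & D == e_set j A]%:R
    = x * ((j \in D) && (ordS j \notin D))%:R * (A == f_set j D)%:R.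
  rewrite -mulrA -natrM mulnb; congr (_ * (_ : bool)%:R).
  apply/and3P/andP => [[a1 a0 /eqP ->]|[/andP[d0 d1] /eqP ->]].
    by rewrite !(mem_eset n_gt0 j A).1 esetK.
  by rewrite !(mem_fset n_gt0 j D).1 fsetK.
have hf' j (x : K) (D A : {set 'I_n.+1}) :
    x * [&& j \in A, ordS j \notin A & D == f_set j A]%:R
    = x * ((ordS j \in D) && (j \notin D))%:R * (A == e_set j D)%:R.
  rewrite -mulrA -natrM mulnb; congr (_ * (_ : bool)%:R).
  apply/and3P/andP => [[a1 a0 /eqP ->]|[/andP[d0 d1] /eqP ->]].
    by rewrite !(mem_fset n_gt0 j A).1 fsetK.
  by rewrite !(mem_eset n_gt0 j D).1 esetK.
have ce j r (D : {set 'I_n.+1}) (x : K) : #|D| = r ->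
    x * ((ordS j \in D) && (j \notin D))%:R != 0 -> e_set j D \in subsets n r.
  by move=> h /bR/andP[d1 d0]; apply: inS; rewrite card_eset.
have cf j r (D : {set 'I_n.+1}) (x : K) : #|D| = r ->
    x * ((j \in D) && (ordS j \notin D))%:R != 0 -> f_set j D \in subsets n r.
  by move=> h /bR/andP[d1 d0]; apply: inS; rewrite card_fset.
have cE := @card_enum_val n.
move=> j; split; apply/matrixP => k l; case: (mxtens_indexP l) => l1 l2;
  rewrite /= ?twE ?twV ?scale_subset_mx ?(subset_mx1 K n) ?mulmxDr ?addE.
- rewrite (triple_mx_pick _ _ (fun A => he j _ (enum_val l1) A)
    (fun B => hK (enum_val l2) _ B)); [|exact: ce|exact: pK].
  rewrite (triple_mx_pick _ _ (fun A => h1 (enum_val l1) A)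
    (fun B => he j _ (enum_val l2) B)); [|exact: pK|exact: ce].
  rewrite (subset_triple_pick _ _ _ (fun C => he' j _ (enum_val k) C)); last exact: cf.
  by rewrite mul1r coef_e.
- rewrite (triple_mx_pick _ _ (fun A => hf j _ (enum_val l1) A)
    (fun B => h1 (enum_val l2) B)); [|exact: cf|exact: pK].
  rewrite (triple_mx_pick _ _ (fun A => hK (enum_val l1) _ A)
    (fun B => hf j _ (enum_val l2) B)); [|exact: pK|exact: cf].
  rewrite (subset_triple_pick _ _ _ (fun C => hf' j _ (enum_val k) C)); last exact: ce.
  by rewrite mulr1 -coef_f // [q ^ _ * _]mulrC.
- rewrite (triple_mx_pick _ _ (fun A => hK (enum_val l1) _ A)
    (fun B => hK (enum_val l2) _ B)); [|exact: pK|exact: pK].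
  rewrite (@subset_triple_pick _ _ _ _ _ _ _ _ _ _ (q ^ K_weight j (enum_val k)) (enum_val k));
    [|by move=> C; rewrite eq_sym; have [->|_] := eqVneq C (enum_val k);
       rewrite ?mulr0 ?mul0r // mulrC|exact: pK].
  by have := coef_K j (enum_val l1) (enum_val l2) (enum_val k) 1; rewrite !mul1r mulrC.
- rewrite (triple_mx_pick _ _ (fun A => hK (enum_val l1) _ A)
    (fun B => hK (enum_val l2) _ B)); [|exact: pK|exact: pK].
  rewrite (@subset_triple_pick _ _ _ _ _ _ _ _ _ _ (q ^ (- K_weight j (enum_val k))) (enum_val k));
    [|by move=> C; rewrite eq_sym; have [->|_] := eqVneq C (enum_val k);
       rewrite ?mulr0 ?mul0r // mulrC|exact: pK].
  by have := coef_K j (enum_val l1) (enum_val l2) (enum_val k) (-1); rewrite !mulN1r mulrC.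
Qed.

(** [bit_ok] determines [C] from [A] and [B], so the column of such a pair meets a single row and is
    a pivot. *)
Lemma triple_surj : (forall C, #|C| = r3 -> exists A B,
    [/\ #|A| = r1, #|B| = r2, phi A B != 0
      & [forall x, bit_ok t (x \in A) (x \in B) (x \in C)]]) ->
  mx_surj (triple_mx r1 r2 r3 triple_coef).
Proof.
move=> h; apply: mx_surj_pivots => k.
have [A [B [cA cB phi0 okC]]] := h _ (card_enum_val k).
have hA : A \in subsets n r1 by rewrite inE cA.
have hB : B \in subsets n r2 by rewrite inE cB.
exists (mxtens_index (enum_rank_in hA A, enum_rank_in hB B)).
rewrite triple_mxE !enum_rankK_in // /triple_coef okC mul1r; split=> // k' k'k.
rewrite triple_mxE !enum_rankK_in // /triple_coef.
case: forallP => [okC'|_]; last by rewrite mul0r.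
case/eqP: k'k; apply: enum_val_inj; apply/setP => x.
move/forallP/(_ x): okC; have := okC' x; rewrite /bit_ok.
by do 4!case: (_ \in _); case: t.
Qed.

End FundamentalHom.

Section DoreyInversions.
Variable n : nat.
Hypothesis n_gt0 : (0 < n)%N.
Implicit Types (j : 'I_n.+1) (A B : {set 'I_n.+1}).

(** For [j] other than 0 the moved element passes no element of [B]. For [j] equal to 0 it goes from
    the lowest rank to the highest and passes all of them. *)
Lemma inv_rel_l j A B : ordS j \in A -> j \notin A ->
  j \notin B -> ordS j \notin B ->
  inv (e_set j A) B = (inv A B + (j == ord0) * #|B|)%N.
Proof.
move=> a1 a0 b0 b1; have := inv_esetl B a1 a0.
have [j0|j0] := eqVneq j ord0; last by rewrite invr_ordS // (negbTE b0); lia.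
by subst j; rewrite invr_1 // invr_0 //; lia.
Qed.

Lemma inv_rel_r j A B : ordS j \in B -> j \notin B ->
  j \notin A -> ordS j \notin A ->
  (inv A (e_set j B) + (j == ord0) * #|A| = inv A B)%N.
Proof.
move=> b1 b0 a0 a1; have := inv_esetr A b1 b0.
have [j0|j0] := eqVneq j ord0; last by rewrite (@invl_ordS _ n_gt0 A j) // (negbTE a1); lia.
by subst j; have := invl_1 n_gt0 A; rewrite (negbTE a1) invl_0 //; lia.
Qed.

Lemma inv_rel_lr j A B : ordS j \in A -> j \notin A ->
  ordS j \in B -> j \notin B ->
  inv (e_set j A) B = (inv A B + (j == ord0) * #|B|)%N /\
  (inv A (e_set j B) + (j == ord0) * #|A| = (inv A B).+1)%N.
Proof.
move=> a1 a0 b1 b0; have := inv_esetr A b1 b0; have := inv_esetl B a1 a0.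
have [j0|j0] := eqVneq j ord0.
  subst j; have := invl_1 n_gt0 A; rewrite a1 invl_0 // invr_1 // invr_0 //; lia.
by rewrite (@invl_ordS _ n_gt0 A j) // invr_ordS // (negbTE b0) a1; lia.
Qed.

Lemma exists_subset_card (T : finType) (D : {set T}) r : (r <= #|D|)%N ->
  exists2 A : {set T}, A \subset D & #|A| = r.
Proof.
move=> rD; exists [set x in take r (enum D)].
  by apply/subsetP => x; rewrite inE => /mem_take; rewrite mem_enum.
rewrite cardsE; have /card_uniqP -> := take_uniq r (enum_uniq D).
by rewrite size_take -cardE; case: ltngtP rD => // ->.
Qed.

End DoreyInversions.

Section Dorey.
Variables (K : fieldType) (q : K) (n : nat).
Hypotheses (q_neq0 : q != 0) (n_gt0 : (0 < n)%N).
Implicit Types (j : 'I_n.+1) (A B : {set 'I_n.+1}).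

Let m : K := - q.
Let m0 : m != 0. Proof. by rewrite oppr_eq0. Qed.

(* v_A (x) v_B goes to v_(A u B). *)
Lemma Dorey_union r1 r2 (X Y Z : K) : (r1 + r2 <= n.+1)%N -> Z != 0 ->
  X * m ^+ r2 = Z -> Y = Z * m ^+ r1 ->
  uq_epi (uq_tensor (uq_twist X (uq_fund q n r1)) (uq_twist Y (uq_fund q n r2)))
         (uq_twist Z (uq_fund q n (r1 + r2))).
Proof.
move=> r12 Z0 eX eY.
have X0 : X != 0 by apply: contraNneq Z0 => x0; rewrite -eX x0 mul0r.
have Y0 : Y != 0 by rewrite eY mulf_neq0 // expf_neq0.
(* With the coefficient (-q)^inv, the instances [j = ord0] of [phi_l] and [phi_r] amount to the two
   relations between [X], [Y] and [Z]. In [phi_lr] at the other [j] the inversion numbers differ by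
   one, and q + (-q) = 0. *)
exists (triple_mx r1 r2 (r1 + r2)
  (triple_coef false (fun A B => m ^+ inv A B))); last first.
  apply: triple_surj => C cC.
  have [A AC cA] := @exists_subset_card _ C r1 ltac:(lia).
  exists A, (C :\: A); split; rewrite ?expf_neq0 //.
    by rewrite cardsD (setIidPr AC) cC cA addKn.
  apply/forallP => x; rewrite /bit_ok !inE !addbF.
  by have := subsetP AC x; case: (x \in A) => [->|_] //=; case: (x \in C).
apply: triple_hom => // j A B cA cB h1 /negbT h2 h3 h4.
- rewrite (inv_rel_l n_gt0) ?h3 ?h4 // /tw; case: eqP => _; last by rewrite mul0n addn0.
  by rewrite mul1n exprD mulrCA mulrC -eX cB mulrC mulrA.
- rewrite -(@inv_rel_r _ n_gt0 j A B) ?h3 ?h4 // /tw.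
  case: eqP => _; last by rewrite mul0n addn0.
  by rewrite mul1n exprD eY cA mulrAC mulrA.
- move/negbT: h4 => h4; have [-> e] := inv_rel_lr n_gt0 h1 h2 h3 h4.
  move: e; rewrite /tw; case: eqP => _.
    rewrite !mul1n cA cB => e; rewrite eY -eX.
    transitivity (X * m ^+ r2
      * (q * m ^+ inv A B + m ^+ (inv A (e_set j B) + r1))).
      by rewrite !exprD; ring.
    by rewrite e exprS /m; ring.
  by rewrite !mul0n !addn0 !mul1r => ->; rewrite exprS /m; ring.
Qed.

(* v_A (x) v_B goes to v_(A n B) when A u B is everything. *)
Lemma Dorey_inter r1 r2 r3 (X Y Z : K) : (r1 <= n.+1)%N -> (r2 <= n.+1)%N ->
  (r1 + r2 = r3 + n.+1)%N -> Z != 0 ->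
  X * m ^+ (n.+1 - r2) = Z -> Y = Z * m ^+ (n.+1 - r1) ->
  uq_epi (uq_tensor (uq_twist X (uq_fund q n r1)) (uq_twist Y (uq_fund q n r2)))
         (uq_twist Z (uq_fund q n r3)).
Proof.
move=> r1n r2n r123 Z0 eX eY.
have X0 : X != 0 by apply: contraNneq Z0 => x0; rewrite -eX x0 mul0r.
have Y0 : Y != 0 by rewrite eY mulf_neq0 // expf_neq0.
have cC A : #|~: A| = (n.+1 - #|A|)%N by rewrite cardsCs setCK card_ord.
(* Complements turn [e_set] into its inverse, and exchanging the two arguments of [inv] makes up for
   it. The computation for unions then applies with n + 1 - r in place of r. *)
exists (triple_mx r1 r2 r3
  (triple_coef true (fun A B => m ^+ inv (~: B) (~: A)))); last first.
  apply: triple_surj => C cC3.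
  have [A AC cA] := @exists_subset_card _ (~: C) (n.+1 - r1) ltac:(rewrite cC; lia).
  exists (~: A), (A :|: C); split; rewrite ?expf_neq0 //.
  - by rewrite cC cA; lia.
  - rewrite cardsU cA cC3; have -> : A :&: C = set0.
      by apply/setP => x; rewrite !inE; have := subsetP AC x; rewrite inE;
         case: (x \in A) => // /(_ isT) /negbTE.
    by rewrite cards0; lia.
  apply/forallP => x; rewrite /bit_ok !inE !addbT.
  have := subsetP AC x; rewrite inE.
  by case: (x \in A) => [/(_ isT)|_] //=; case: (x \in C).
have dual j A : ordS j \in A -> j \notin A ->
    [/\ ordS j \in ~: e_set j A, j \notin ~: e_set j A
      & ~: A = e_set j (~: e_set j A)].
  move=> h1 h2; rewrite !in_setC !(mem_eset n_gt0 j A).1; split=> //.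
  by rewrite setC_eset // fsetK // in_setC ?h1 ?h2.
apply: triple_hom => // j A B cA cB h1 /negbT h2 h3 h4.
- have [a1 a0 eA] := dual j A h1 h2.
  have := @inv_rel_r _ n_gt0 j (~: B) _ a1 a0; rewrite !in_setC h3 h4 -eA.
  move=> /(_ isT isT) <-; rewrite cC cB /tw.
  case: eqP => _; last by rewrite mul0n addn0.
  by rewrite mul1n exprD mulrCA mulrC -eX mulrC mulrA.
- have [b1 b0 eB] := dual j B h1 h2.
  have := @inv_rel_l _ n_gt0 j _ (~: A) b1 b0; rewrite !in_setC h3 h4 -eB.
  move=> /(_ isT isT) ->; rewrite cC cA /tw.
  case: eqP => _; last by rewrite mul0n addn0.
  by rewrite mul1n exprD eY mulrAC mulrA.
- move/negbT: h4 => h4; have [a1 a0 eA] := dual j A h1 h2.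
  have [b1 b0 eB] := dual j B h3 h4.
  have [] := inv_rel_lr n_gt0 b1 b0 a1 a0; rewrite -eA -eB => -> e.
  have : ((j == ord0) * #|~: e_set j B| = (j == ord0) * (n.+1 - r2))%N.
    by rewrite cC card_eset // cB.
  have : ((j == ord0) * #|~: e_set j A| = (j == ord0) * (n.+1 - r1))%N.
    by rewrite cC card_eset // cA.
  move=> e1 e2; move: e; rewrite e1 e2 /tw; case: eqP => _.
    rewrite !mul1n => e; rewrite eY -eX.
    transitivity (X * m ^+ (n.+1 - r1)
      * (q * m ^+ inv (~: e_set j B) (~: e_set j A)
         + m ^+ (inv (~: e_set j B) (~: A) + (n.+1 - r2)))).
      by rewrite !exprD; ring.
    by rewrite e exprS /m; ring.
  by rewrite !mul0n !addn0 !mul1r => ->; rewrite exprS /m; ring.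
Qed.

End Dorey.

(** * Sums of positive roots, and the surjections between the modules V_Q *)

Section RootSums.
Variable n : nat.

Lemma height_root x y : (x <= y <= n)%N -> height (rootn n x y) = (y - x)%N.
Proof.
elim: y => [|y IH] /andP[xy yn]; rewrite /height.
  by rewrite big1 // => k _; rewrite rootnE; lia.
have [->|xy'] := eqVneq x y.+1.
  by rewrite big1 ?subnn // => k _; rewrite rootnE subrr.
have yn' : (y < n)%N by [].
rewrite subSn; last by lia.
rewrite -IH; last by lia.
rewrite /height (bigD1 (Ordinal yn')) //= [in RHS](bigD1 (Ordinal yn')) //=.
rewrite !rootnE /=; have -> : (y < x)%N = false by lia.
rewrite ltnSn ltnn /= add1n add0n; congr _.+1; apply: eq_bigr => k ky.
rewrite !rootnE; congr `|_ - _|%N; congr (nat_of_bool _)%:Z.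
by have : (k : nat) != y by []; lia.
Qed.

Lemma posroot_add (a b : 'rV[int]_n) : posroot a -> posroot b -> posroot (a + b) ->
  exists x y z, [/\ (x < y)%N, (y < z <= n)%N &
    (a = rootn n x y /\ b = rootn n y z) \/ (a = rootn n y z /\ b = rootn n x y)].
Proof.
move=> /posrootP[x [y [xy yn ->]]] /posrootP[x' [y' [xy' yn' ->]]].
move=> /posrootP[p [r [pr rn /rowP e]]].
have E k : (k < n)%N ->
    ((k < y)%N : nat)%:Z - ((k < x)%N : nat)%:Z
    + (((k < y')%N : nat)%:Z - ((k < x')%N : nat)%:Z)
    = ((k < r)%N : nat)%:Z - ((k < p)%N : nat)%:Z.
  by move=> kn; have := e (Ordinal kn); rewrite mxE !rootnE.
have h : (y = x' \/ y' = x).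
  (* Overlapping supports would produce a coefficient 2, and separated ones a gap in the support of
     the sum; the coordinates next to the ends exclude both. *)
  have h1 := E x ltac:(lia); have h2 := E x' ltac:(lia).
  have [hx|hx] : (y <= x')%N \/ (y' <= x)%N by lia.
    have [|ne] := eqVneq y x'; first by left.
    have k1 : (p <= y.-1)%N by have := E y.-1; lia.
    have k2 : (r <= y)%N by have := E y; lia.
    by exfalso; lia.
  have [|ne] := eqVneq y' x; first by right.
  have k1 : (p <= y'.-1)%N by have := E y'.-1; lia.
  have k2 : (r <= y')%N by have := E y'; lia.
  by exfalso; lia.
case: h => h; subst; [exists x, x', y' | exists x', x, y]; split; try lia;
  by [left | right].
Qed.

End RootSums.

Section QuiverEpi.
Variables (K : fieldType) (q : K) (n : nat).
Hypotheses (q_neq0 : q != 0) (n_gt0 : (0 < n)%N).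
Variables (Q : rel 'I_n) (c : seq 'I_n) (xi : 'I_n -> int).
Hypotheses (qQ : dynkin_quiver Q) (cQ : adapted_coxeter Q c)
  (xiQ : height_function Q xi).

Let V := V_quiver q Q c xi.

Lemma V_quiver_root x y : (x < y <= n)%N ->
  V (rootn n x y) = uq_twist ((- q) ^ (Tpos Q x + Spos Q y - n%:Z + xi0 Q xi))
    (uq_fund q n `|Tpos Q x - Spos Q y|%N).
Proof. by move=> xy; rewrite /V /V_quiver ar_coord_root. Qed.

(** If the edge at [y] points right, the vertex numbers of the summands add up to that of the sum;
    otherwise they exceed it by n + 1. The spectral parameters then match because their exponents
    are linear in [Tpos] and [Spos]. *)
Lemma V_quiver_epi x y z : (x < y)%N -> (y < z <= n)%N ->
  uq_epi (if arrow_right Q y then uq_tensor (V (rootn n y z)) (V (rootn n x y))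
          else uq_tensor (V (rootn n x y)) (V (rootn n y z)))
    (V (rootn n x z)).
Proof.
move=> xy yz.
have b1 := @Tpos_Spos_bounds n Q qQ c cQ xi xiQ x y ltac:(lia).
have b2 := @Tpos_Spos_bounds n Q qQ c cQ xi xiQ y z yz.
have b3 := @Tpos_Spos_bounds n Q qQ c cQ xi xiQ x z ltac:(lia).
have := TposE Q y; rewrite !V_quiver_root //; try lia.
have m0 : - q != 0 by rewrite oppr_eq0.
have E (u v : int) (d : nat) : v = u + d%:Z -> (- q) ^ v = (- q) ^ u * (- q) ^+ d.
  by move=> ->; rewrite expfzDr.
case: ifP => _ e.
  have -> : `|Tpos Q x - Spos Q z|%N
      = (`|Tpos Q y - Spos Q z| + `|Tpos Q x - Spos Q y|)%N by lia.
  apply: Dorey_union; rewrite ?expfz_neq0 //; first by lia.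
    by apply/esym/E; lia.
  by apply: E; lia.
apply: Dorey_inter; rewrite ?expfz_neq0 //; try lia.
  by apply/esym/E; lia.
by apply: E; lia.
Qed.

Lemma V_quiver_simple_epi x y : (x < y <= n)%N -> exists s : seq 'I_n,
  size s = (y - x)%N /\
  uq_epi (uq_tensor_seq [seq V (alpha i) | i <- s]) (V (rootn n x y)).
Proof.
move: {2}(y - x)%N (leqnn (y - x)) => d.
elim: d x y => [|d IH] x y hd xy; first by lia.
have xn : (x < n)%N by lia.
have [->|y1] := eqVneq y x.+1.
  exists [:: Ordinal xn]; split; first by rewrite subSnn.
  by rewrite /= alpha_root; apply: uq_epi_refl.
have [s1 [z1 e1]] := IH x x.+1 ltac:(lia) ltac:(lia).
have [s2 [z2 e2]] := IH x.+1 y ltac:(lia) ltac:(lia).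
have := @V_quiver_epi x x.+1 y (ltnSn x) ltac:(lia).
have C (s s' : seq 'I_n) W W' : (0 < size s)%N -> (0 < size s')%N ->
    uq_epi (uq_tensor_seq [seq V (alpha i) | i <- s]) W ->
    uq_epi (uq_tensor_seq [seq V (alpha i) | i <- s']) W' ->
    uq_epi (uq_tensor_seq [seq V (alpha i) | i <- s ++ s']) (uq_tensor W W').
  move=> h h' e e'; rewrite map_cat.
  apply: uq_epi_trans (uq_epi_tensor e e').
  by apply: uq_epi_tensor_cat; rewrite size_map.
case: ifP => _ e; [exists (s2 ++ s1) | exists (s1 ++ s2)];
  rewrite size_cat; split; try lia; apply: uq_epi_trans e; apply: C => //; lia.
Qed.

End QuiverEpi.

(** * Modules over the free algebra *)

Section FreeAlgebra.
Variables (K : fieldType) (n : nat).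
Local Notation F := (klr_free K n).

(* Folding the scalars prevents the keyed matching of [*:] from comparing the
   ring structures of [K] and of the free algebra, which is very slow. *)
Definition ksc (a : K) : F := a%:A.

Lemma kscE a : ksc a = << a *g fmone (klr_gen n) >>.
Proof. by apply/malgP => k; rewrite mcoeffZ !mcoeffU mulr_natr. Qed.

Lemma ksc1 : ksc 1 = 1. Proof. exact: scale1r. Qed.

Lemma ksc0 : ksc 0 = 0. Proof. exact: scale0r. Qed.

Lemma kscN1 : ksc (-1) = -1. Proof. exact: scaleN1r. Qed.

Lemma kscD a b : ksc (a + b) = ksc a + ksc b. Proof. exact: scalerDl. Qed.

Lemma kscM a b : ksc a * ksc b = ksc (a * b).
Proof. by rewrite !kscE malgM_def fgmulUU; congr << _ *g _ >>; apply: mulm1. Qed.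

(** Centrality of the scalars is computed on coefficients, from the left algebra structure of
    [klr_free]. *)
Lemma kscC (a : K) (x : F) : ksc a * x = x * ksc a.
Proof.
rewrite kscE !malgM_def fgmulgU fgmulUg; apply: eq_bigr => k _.
by rewrite mulm1 mul1m mulrC.
Qed.

Section Module.
Variable V : lmodType F.
Implicit Types (v : V).

Lemma kscA (a : K) (x : F) v : x *: (ksc a *: v) = ksc a *: (x *: v).
Proof. by rewrite !scalerA kscC. Qed.

Lemma ksc_scale (a b : K) v : ksc a *: (ksc b *: v) = ksc (a * b) *: v.
Proof. by rewrite [LHS]scalerA kscM. Qed.

Lemma kscDl (a b : K) v : ksc (a + b) *: v = ksc a *: v + ksc b *: v.
Proof. by rewrite kscD scalerDl. Qed.

Lemma ksc_combl (a b c d : K) v :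
  ksc ((a * b + c) * d) *: v = ksc a *: (ksc (b * d) *: v) + ksc (c * d) *: v.
Proof.
have -> : (a * b + c) * d = a * (b * d) + c * d by rewrite mulrDl mulrA.
by apply: etrans (kscDl _ _ _) _; congr (_ + _); apply/esym/ksc_scale.
Qed.

Lemma ksc_combr (a b c d : K) v :
  ksc (d * (a * b + c)) *: v = ksc a *: (ksc (d * b) *: v) + ksc (d * c) *: v.
Proof.
have -> : d * (a * b + c) = a * (d * b) + d * c by rewrite mulrDr mulrCA.
by apply: etrans (kscDl _ _ _) _; congr (_ + _); apply/esym/ksc_scale.
Qed.

Lemma ksc_eq0 (a : K) v : ksc a *: v = 0 -> v != 0 -> a = 0.
Proof.
move=> av v0; apply/eqP; apply: contraNT v0 => a0.
apply/eqP; have e : ksc (a^-1 * a) *: v = 0.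
  apply: etrans (esym (ksc_scale _ _ _)) _.
  exact: (etrans (congr1 (fun z => ksc a^-1 *: z) av) (scaler0 _ _)).
by rewrite mulVf // ksc1 in e; rewrite -e; apply/esym/scale1r.
Qed.

Lemma ksc_inj (a b : K) v : ksc a *: v = ksc b *: v -> v != 0 -> a = b.
Proof.
move=> e v0; apply/eqP; rewrite -subr_eq0; apply/eqP; apply: ksc_eq0 v0.
apply: etrans (kscDl _ _ _) (etrans (congr1 (+%R^~ _) e) _).
apply: etrans (esym (kscDl _ _ _)) _; rewrite subrr ksc0; exact: scale0r.
Qed.

End Module.

Lemma free_monom (s : seq (klr_gen n)) :
  (<< FMonom s >> : F) = \prod_(g <- s) free_gen K g.
Proof.
elim: s => [|g s IH]; first by rewrite big_nil -fmoneE.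
rewrite big_cons -IH [RHS]malgM_def fgmulUU mulr1; congr << _ >>.
by rewrite /mmul /= fmmulE fmuE.
Qed.

Lemma free_gen_ind (V : lmodType F) (U : V -> Prop) :
  U 0 -> (forall u v, U u -> U v -> U (u + v)) ->
  (forall (a : K) u, U u -> U (ksc a *: u)) ->
  (forall g u, U u -> U (free_gen K g *: u)) ->
  forall r u, U u -> U (r *: u).
Proof.
move=> U0 UD UZ Ug r u Uu; rewrite [r]monalgE scaler_suml.
elim/big_ind: _ => // -[s] _; set k := FMonom s.
have -> : (<< r@_k *g k >> : F) = ksc (r@_k) * (<< k >> : F).
  by rewrite kscE malgM_def fgmulUU mulr1 mul1m.
rewrite -scalerA; apply: (UZ); rewrite /k free_monom.
elim: s {k} => [|g s IH]; first by rewrite big_nil scale1r.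
by rewrite big_cons -scalerA; apply: (Ug).
Qed.

End FreeAlgebra.

Section LinearExtension.
Variables (R : nzRingType) (T : choiceType) (V : lmodType R) (h : T -> V).

Definition lin_ext (w : {malg R[T]}) : V := \sum_(k <- msupp w) w@_k *: h k.

Lemma lin_extEw (d : {fset T}) w : (msupp w `<=` d)%fset ->
  lin_ext w = \sum_(k <- d) w@_k *: h k.
Proof.
move=> le; rewrite [LHS](big_fset_incl _ le) => //= x xd /mcoeff_outdom ->.
by rewrite scale0r.
Qed.

Lemma lin_ext_linear a u v : lin_ext (a *: u + v) = a *: lin_ext u + lin_ext v.
Proof.
pose d := (msupp (a *: u + v) `|` (msupp u `|` msupp v))%fset.
rewrite !(@lin_extEw d) /d.
- rewrite scaler_sumr -big_split /=; apply: eq_bigr => k _.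
  by rewrite mcoeffD mcoeffZ scalerDl scalerA.
- by apply: fsubsetU; rewrite fsubsetUr orbT.
- by apply: fsubsetU; rewrite fsubsetUl orbT.
- by apply: fsubsetU; rewrite fsubset_refl.
Qed.

Lemma lin_extU k : lin_ext << k >> = h k.
Proof. by rewrite (lin_extEw msuppU_le) big_seq_fset1 mcoeffUU scale1r. Qed.

End LinearExtension.

Section QuotientMap.
Variables (R : nzRingType) (V W : lmodType R) (S : V -> Prop) (f : V -> W).
Hypothesis f_linear : forall a u v, f (a *: u + v) = a *: f u + f v.
Hypothesis f_rel : forall v, S v -> f v = 0.

Definition quot_map (z : quot_mod S) : W := f (repr (z : Quotient.quot (in_span S))).

Let f0 : f 0 = 0.
Proof. by have := f_linear (-1) 0 0; rewrite scaler0 addr0 scaleN1r addNr. Qed.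

Lemma quot_map_pi v : quot_map (quot_pi S v) = f v.
Proof.
have H u : submod_span S u -> f u = 0.
  by elim=> // a x y _ hx _ hy; rewrite f_linear hx hy scaler0 addr0.
rewrite /quot_map; set r := repr _.
have : quot_pi S r = quot_pi S v by rewrite /r quot_piK.
move/quot_pi_span/H; rewrite addrC -scaleN1r f_linear scaleN1r => /eqP.
by rewrite addrC subr_eq0 => /eqP.
Qed.

Lemma quot_map_linear a u v : quot_map (a *: u + v) = a *: quot_map u + quot_map v.
Proof.
rewrite -[u]quot_piK -[v]quot_piK [a *: _]quot_piZ -quot_piD !quot_map_pi.
by rewrite f_linear.
Qed.

End QuotientMap.

Lemma linear_pack (R : nzRingType) (V W : lmodType R) (f : V -> W) :
  (forall a u v, f (a *: u + v) = a *: f u + f v) ->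
  exists g : {linear V -> W}, g =1 f.
Proof.
move=> flin; pose H := GRing.isLinear.Build R V W *:%R f flin.
by exists (HB.pack_for {linear V -> W} f H).
Qed.

(** * Words up to commutation of distant letters *)

Section Words.
Variable n : nat.
Implicit Types (i j a c d : 'I_n) (mu nu : seq 'I_n).

Lemma adjacentC i j : adjacent i j = adjacent j i.
Proof. by rewrite /adjacent orbC. Qed.

(* Equality up to commutation of non-adjacent letters. *)
Definition word_eqv nu nu0 : bool :=
  perm_eq nu nu0 &&
  [forall c, [forall d, adjacent c d ==>
    (filter (pred2 c d) nu == filter (pred2 c d) nu0)]].

Lemma word_eqvP nu nu0 : reflect
  (perm_eq nu nu0 /\ forall c d, adjacent c d ->
     filter (pred2 c d) nu = filter (pred2 c d) nu0) (word_eqv nu nu0).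
Proof.
apply: (iffP andP) => -[p h]; split=> //.
  by move=> c d cd; move/forallP/(_ c)/forallP/(_ d)/implyP/(_ cd)/eqP: h.
by apply/forallP => c; apply/forallP => d; apply/implyP => cd; rewrite h.
Qed.

Lemma word_eqv_refl nu : word_eqv nu nu.
Proof. by apply/word_eqvP. Qed.

Lemma word_eqv_swap mu i j mu' nu0 : ~~ adjacent i j -> i != j ->
  word_eqv (mu ++ [:: i, j & mu']) nu0 = word_eqv (mu ++ [:: j, i & mu']) nu0.
Proof.
move=> ij ne; have E c d : adjacent c d -> filter (pred2 c d) (mu ++ [:: i, j & mu'])
    = filter (pred2 c d) (mu ++ [:: j, i & mu']).
  move=> cd; rewrite !filter_cat /=; congr (_ ++ _).
  case: ifP => // hi; case: ifP => // hj; exfalso.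
  move: hi hj cd ij ne => /= /orP[]/eqP-> /orP[]/eqP->; rewrite ?eqxx //.
    by move=> ->.
  by rewrite adjacentC => ->.
have P : perm_eq (mu ++ [:: i, j & mu']) (mu ++ [:: j, i & mu']).
  by rewrite perm_cat2l (perm_catCA [:: i] [:: j] mu').
apply/word_eqvP/word_eqvP => -[p h]; split.
- by rewrite -(permPl P).
- by move=> c d cd; rewrite -E ?h.
- by rewrite (permPl P).
- by move=> c d cd; rewrite E ?h.
Qed.

(** As [a] comes first in one word, its neighbours in the diagram come after it in every equivalent
    word. So [a] commutes with all letters before it and can be erased from both words. *)
Lemma word_eqv_cons al be a nu1 :
  uniq (a :: nu1) -> word_eqv (al ++ a :: be) (a :: nu1) ->
  [/\ a \notin al, forall i, i \in al -> ~~ adjacent a i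
    & word_eqv (al ++ be) nu1].
Proof.
move=> u1 /word_eqvP[p h].
have un : uniq (al ++ a :: be) by rewrite (perm_uniq p).
have aal : a \notin al.
  by move: un; rewrite cat_uniq /= => /and3P[_ /norP[]].
have na i : i \in al -> ~~ adjacent a i.
  move=> ial; apply/negP => /h; rewrite filter_cat /= eqxx /=.
  case E: (filter _ al) => [|x s] /=.
    have : i \in filter (pred2 a i) al by rewrite mem_filter /= eqxx orbT ial.
    by rewrite E.
  move=> [xa _]; have : x \in filter (pred2 a i) al by rewrite E mem_head.
  by rewrite mem_filter xa (negbTE aal) andbF.
split=> //; apply/word_eqvP; split.
  rewrite -(perm_cons a); apply: perm_trans p.
  by rewrite -cat1s -[a :: be]cat1s; apply/permPl/perm_catCA.
move=> c d cd; have := h c d cd; rewrite !filter_cat /=.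
case: ifP => // acd.
suff -> : filter (pred2 c d) al = [::] by move=> [].
apply/eqP; rewrite -size_eq0 size_filter -leqn0 leqNgt -has_count.
apply/hasPn => i ial; apply/negP => icd; have := na i ial.
move: acd icd aal; rewrite /= => /orP[]/eqP-> /orP[]/eqP e; rewrite -?e ?ial ?e ?cd //.
by rewrite adjacentC cd.
Qed.

End Words.

Section Coherence.
Variables (n : nat) (M : zmodType) (psi : nat -> M -> M).
Variable In : seq 'I_n -> M -> Prop.
Implicit Types (i j h a : 'I_n) (mu nu al be : seq 'I_n) (u : M).
Hypothesis psi0 : forall l, psi l 0 = 0.
Hypothesis psiC : forall k l u, (k.+1 < l)%N -> psi k (psi l u) = psi l (psi k u).
Hypothesis psi_in : forall mu i j mu' u, i != j -> ~~ adjacent i j ->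
  In (mu ++ [:: i, j & mu']) u -> In (mu ++ [:: j, i & mu']) (psi (size mu) u).
Hypothesis psiK : forall mu i j mu' u, i != j -> ~~ adjacent i j ->
  In (mu ++ [:: i, j & mu']) u -> psi (size mu) (psi (size mu) u) = u.
Hypothesis psi_braid : forall mu h i j mu' u, h != j ->
  In (mu ++ [:: h, i, j & mu']) u ->
  psi (size mu).+1 (psi (size mu) (psi (size mu).+1 u))
  = psi (size mu) (psi (size mu).+1 (psi (size mu) u)).

(** The product psi_(p+k-1) ... psi_p, which moves the letter at place [p] to the right across the
    next [k] letters. *)
Fixpoint shift_letter p k u : M :=
  if k is k'.+1 then psi (p + k') (shift_letter p k' u) else u.

Lemma shift_letterD p k l u :
  shift_letter p (k + l) u = shift_letter (p + k) l (shift_letter p k u).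
Proof. by elim: l => [|l IH]; rewrite ?addn0 // addnS /= IH addnA. Qed.

Lemma shift_letter_right p k l u : (p + k < l)%N ->
  psi l (shift_letter p k u) = shift_letter p k (psi l u).
Proof.
elim: k => //= k IH h; rewrite -psiC; last by lia.
by rewrite IH //; lia.
Qed.

Lemma shift_letter_left p k l u : (l.+1 < p)%N ->
  psi l (shift_letter p k u) = shift_letter p k (psi l u).
Proof.
move=> h; elim: k => //= k IH; rewrite psiC ?IH //; lia.
Qed.

Lemma shift_letter_in mu a al be u : a \notin al ->
  (forall i, i \in al -> ~~ adjacent a i) ->
  In (mu ++ a :: al ++ be) u ->
  In (mu ++ al ++ a :: be) (shift_letter (size mu) (size al) u) /\
  (u != 0 -> shift_letter (size mu) (size al) u != 0).
Proof.
elim/last_ind: al be u => [|al x IH] be u //=.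
rewrite mem_rcons inE negb_or => /andP[ax aal] na; rewrite cat_rcons => hu.
have na' i : i \in al -> ~~ adjacent a i.
  by move=> ial; apply: na; rewrite mem_rcons inE ial orbT.
have [h1 h2] := IH _ _ aal na' hu.
have nax : ~~ adjacent a x by apply: na; rewrite mem_rcons mem_head.
rewrite size_rcons /= -size_cat cat_rcons catA.
rewrite catA in h1; split; first exact: psi_in.
move=> /h2 u0; apply: contraNneq u0 => e; apply/eqP.
by rewrite -(psiK ax nax h1) size_cat -size_cat e psi0.
Qed.

(* [v nu] is obtained from [v] of the word without the first letter [a] of [nu0]
   by moving [a] to its place from the left; the braid relation is used when a
   swap happens to the left of that place. *)
Theorem word_coherence nu0 mu u0 : uniq nu0 -> In (mu ++ nu0) u0 -> u0 != 0 ->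
  exists v : seq 'I_n -> M, v nu0 = u0 /\
    forall nu, word_eqv nu nu0 -> [/\ In (mu ++ nu) (v nu), v nu != 0 &
      forall al i j be, nu = al ++ [:: i, j & be] -> i != j -> ~~ adjacent i j ->
        psi (size mu + size al) (v nu) = v (al ++ [:: j, i & be])].
Proof.
elim: nu0 mu u0 => [|a nu1 IH] mu u0 un0 hu0 u00.
  exists (fun=> u0); split=> // nu /word_eqvP[/perm_nilP -> _].
  by split=> // -[].
have /andP[a1 un1] := un0.
rewrite -cat_rcons in hu0.
have [v1 [v1u0 hv1]] := IH _ _ un1 hu0 u00.
pose v nu := shift_letter (size mu) (index a nu) (v1 (rem a nu)).
have vE al be : a \notin al ->
    v (al ++ a :: be) = shift_letter (size mu) (size al) (v1 (al ++ be)).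
  move=> aal; rewrite /v index_cat (negbTE aal) /= eqxx addn0; congr (shift_letter _ _ (v1 _)).
  elim: al aal => [|x al IHal]; first by rewrite /= eqxx.
  by rewrite inE negb_or /= => /andP[ax /IHal ->]; rewrite eq_sym (negbTE ax).
exists v; split; first by rewrite (vE [::]).
move=> nu e0.
have un : uniq nu by have /word_eqvP[/perm_uniq -> _] := e0.
have step al be : nu = al ++ a :: be -> [/\ a \notin al,
    forall i, i \in al -> ~~ adjacent a i, word_eqv (al ++ be) nu1
    & In (mu ++ a :: al ++ be) (v1 (al ++ be))].
  move=> e; rewrite e in e0; have [aal na e1] := word_eqv_cons un0 e0.
  by split=> //; have [+ _ _] := hv1 _ e1; rewrite cat_rcons.
have [al0 [be0 enu]] : exists al be, nu = al ++ a :: be.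
  have : a \in nu by have /word_eqvP[/perm_mem -> _] := e0; rewrite mem_head.
  by case/splitPr => al be; exists al, be.
have [aal na e1 i1] := step _ _ enu.
have [i2 n2] := shift_letter_in aal na i1; have [_ n1 _] := hv1 _ e1.
split; [by rewrite enu vE | by rewrite enu vE //; apply: n2 |].
move=> {al0 be0 enu aal na e1 i1 i2 n2 n1} al i j be e ij nij.
(* A swap that starts with [a] lengthens the shift by one step, and a swap that ends with [a] undoes
   its last step. The remaining cases are swaps to the right and to the left of [a]. *)
have [ai|ai] := eqVneq a i.
  subst i; have [aal _ _ _] := step _ _ e.
  rewrite e vE // -[al ++ [:: j, a & be]]cat_rcons vE; last by rewrite mem_rcons inE negb_or ij.
  by rewrite size_rcons /= cat_rcons.
have [aj|aj] := eqVneq a j.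
  subst j; rewrite -cat_rcons in e; have [aal na _ i1] := step _ _ e.
  have nai : ~~ adjacent a i by apply: na; rewrite mem_rcons mem_head.
  have aal' : a \notin al by move: aal; rewrite mem_rcons inE => /norP[].
  have na' k : k \in al -> ~~ adjacent a k.
    by move=> kal; apply: na; rewrite mem_rcons inE kal orbT.
  rewrite e vE // vE // size_rcons /= cat_rcons; rewrite cat_rcons in i1.
  have [i2 _] := shift_letter_in aal' na' i1.
  by rewrite catA in i2; have := psiK ai nai i2; rewrite size_cat.
have : a \in al ++ [:: i, j & be].
  by rewrite -e; have /word_eqvP[/perm_mem -> _] := e0; rewrite mem_head.
rewrite mem_cat !inE (negbTE ai) (negbTE aj) /=.
have sp (t : seq 'I_n) : a \in t -> exists A B, t = A ++ a :: B.
  by case/splitPr => A B; exists A, B.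
case/orP => /sp[A [B et]]; rewrite {}et in e *.
  rewrite -catA /= in e; have [aal na e1 _] := step _ _ e.
  have [_ _ s1] := hv1 _ e1; rewrite e -catA /= vE // vE //.
  rewrite shift_letter_right; last by rewrite size_cat /= ltn_add2l addnS ltnS leq_addr.
  congr shift_letter; have := s1 (A ++ B) i j be; rewrite -!catA /= => <- //.
  by rewrite !size_cat size_rcons /=; congr psi; rewrite !addnS !addSn.
have e' : nu = (al ++ [:: i, j & A]) ++ a :: B by rewrite e -catA.
have [aal na e1 i1] := step _ _ e'.
have [_ _ s1] := hv1 _ e1.
have aal' : a \notin al by move: aal; rewrite mem_cat => /norP[].
have na' k : k \in al -> ~~ adjacent a k.
  by move=> kal; apply: na; rewrite mem_cat kal.
have aal2 : a \notin al ++ [:: j, i & A].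
  by move: aal; rewrite !mem_cat !inE => /norP[/negbTE -> /norP[/negbTE -> /norP[/negbTE -> ->]]].
rewrite e; have -> : al ++ [:: i, j & A ++ a :: B] = (al ++ [:: i, j & A]) ++ a :: B.
  by rewrite -catA.
have -> : al ++ [:: j, i & A ++ a :: B] = (al ++ [:: j, i & A]) ++ a :: B.
  by rewrite -catA.
rewrite vE // vE // -!catA /=; rewrite -!catA /= in i1 s1.
have := s1 al i j (A ++ B) erefl ij nij => <-.
set w := v1 _ in i1 *.
have [i2 _] := shift_letter_in aal' na' i1.
rewrite !size_cat /= !shift_letterD.
have S2 p k z : shift_letter p k.+2 z = shift_letter p.+2 k (psi p.+1 (psi p z)).
  by rewrite -(add2n k) shift_letterD addn2 /= addn0 addn1.
rewrite !S2 shift_letter_left //; congr shift_letter.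
set z := shift_letter (size mu) (size al) w in i2 *.
rewrite catA in i2; have := psi_braid aj i2; rewrite size_cat => <-.
do 2!congr psi; rewrite size_rcons addSn shift_letter_right //; lia.
Qed.

End Coherence.

(** * Simple quiver Hecke modules of weight a positive root *)

Section WordWeights.
Variable n : nat.
Implicit Types (nu : seq 'I_n).

Definition word_wt nu : 'rV[int]_n := \sum_(i <- nu) alpha i.

Lemma word_wtE nu k : word_wt nu 0 k = (count_mem k nu)%:Z.
Proof.
rewrite /word_wt summxE; elim: nu => [|i nu IH]; first by rewrite big_nil.
by rewrite big_cons IH mxE /= [k == i]eq_sym PoszD; case: eqP.
Qed.

Lemma word_wt_root nu x y : (x <= y)%N -> word_wt nu = rootn n x y ->
  uniq nu /\ forall i : 'I_n, (i \in nu) = (x <= i < y)%N.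
Proof.
move=> xy e; have C i : count_mem i nu = (x <= i < y)%N.
  by apply/eqP; rewrite -eqz_nat -word_wtE e rootnE; apply/eqP; lia.
have I i : (i \in nu) = (x <= i < y)%N.
  by rewrite -has_pred1 has_count C; case: (_ <= _ < _)%N.
by split=> //; apply: count_mem_uniq => i; rewrite C I.
Qed.

Lemma split_two nu l : (l.+1 < size nu)%N ->
  exists mu i j mu', nu = mu ++ [:: i, j & mu'] /\ size mu = l.
Proof.
move=> h; have := cat_take_drop l nu; have := size_drop l nu.
have := size_takel (ltnW (ltnW h)).
case: (drop l nu) => [|i [|j mu']] s1 /=; [lia|lia|].
by move=> _ <-; exists (take l nu), i, j, mu'.
Qed.

End WordWeights.

Section Scaling.
Variables (R : nzRingType) (V : lmodType R).

Lemma scaler3 (a b c : R) (v : V) : a *: (b *: (c *: v)) = (a * b * c) *: v.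
Proof. by rewrite !scalerA. Qed.

Lemma scale_sub_eq (a b : R) (v : V) : (a - b) *: v = 0 -> a *: v = b *: v.
Proof. by rewrite scalerBl => /eqP; rewrite subr_eq0 => /eqP. Qed.

End Scaling.

Section ModuleRelations.
Variables (K : fieldType) (n : nat) (eps : 'I_n -> 'I_n -> K).
Variables (m : nat) (M : klr_mod eps m).
Implicit Types (nu mu : seq 'I_n) (u : M).
Local Notation gE := (@gE K n).
Local Notation gP := (@gP K n).

Lemma klr_relB r r' u : klr_rel eps m (r - r') -> r *: u = r' *: u.
Proof. by move=> /klr_relP/(_ u)/eqP; rewrite scalerBl subr_eq0 => /eqP. Qed.

Lemma klr_EE nu nu' u :
  gE nu *: (gE nu' *: u) = if nu == nu' then gE nu *: u else 0.
Proof.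
rewrite scalerA (klr_relB _ (Klr_EE eps m nu nu')).
by case: ifP => // _; rewrite scale0r.
Qed.

Lemma klr_E1 u : u = \sum_(nu : m.-tuple 'I_n) gE nu *: u.
Proof. by rewrite -scaler_suml (klr_relB _ (Klr_E1 eps m)) scale1r. Qed.

Lemma klr_E_size nu u : gE nu *: u != 0 -> size nu = m.
Proof.
by move=> h; apply/eqP; apply: contraNT h => /(Klr_E_out eps)/klr_relP ->.
Qed.

Lemma klr_P_out l u : (m <= l.+1)%N -> gP l *: u = 0.
Proof. by move=> /(Klr_P_out eps)/klr_relP ->. Qed.

Lemma klr_PE mu i j mu' u : gP (size mu) *: (gE (mu ++ [:: i, j & mu']) *: u)
  = gE (mu ++ [:: j, i & mu']) *: (gP (size mu) *: u).
Proof. by rewrite !scalerA; exact: klr_relB (Klr_PE eps m mu i j mu'). Qed.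

Lemma klr_PC k l u : (k.+1 < l)%N -> gP k *: (gP l *: u) = gP l *: (gP k *: u).
Proof. by move=> h; rewrite !scalerA; exact: klr_relB (Klr_PP eps m h). Qed.

Lemma klr_PK mu i j mu' u : i != j -> ~~ adjacent i j ->
  gE (mu ++ [:: i, j & mu']) *: u = u -> gP (size mu) *: (gP (size mu) *: u) = u.
Proof.
move=> ij nij hu; rewrite -{1}hu !scalerA -expr2.
rewrite (klr_relB _ (Klr_PPE eps m mu i j mu')) /klr_Q (negbTE ij) (negbTE nij).
by rewrite mul1r.
Qed.

Lemma klr_braid mu h i j mu' u : h != j ->
  gE (mu ++ [:: h, i, j & mu']) *: u = u ->
  gP (size mu).+1 *: (gP (size mu) *: (gP (size mu).+1 *: u))
  = gP (size mu) *: (gP (size mu).+1 *: (gP (size mu) *: u)).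
Proof.
move=> hj hu; have := klr_relP (Klr_PPP eps m mu h i j mu') u.
rewrite (negbTE hj) subr0 -scalerA hu => /scale_sub_eq e.
exact: (etrans (scaler3 _ _ _ _) (etrans e (esym (scaler3 _ _ _ _)))).
Qed.

End ModuleRelations.

Section Decompositions.
Variables (M : zmodType) (P : int -> M -> Prop).
Hypotheses (P0 : forall e, P e 0) (PD : forall e u v, P e u -> P e v -> P e (u + v)).

Definition decomposable u := exists s (f : int -> M),
  [/\ uniq s, forall e, P e (f e) & u = \sum_(e <- s) f e].

Lemma decomposable_hom e u : P e u -> decomposable u.
Proof.
move=> h; exists [:: e], (fun d => if d == e then u else 0); split=> //.
  by move=> d; case: eqP => [->|].
by rewrite big_seq1 eqxx.
Qed.

Lemma decomposable_add u v : decomposable u -> decomposable v ->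
  decomposable (u + v).
Proof.
move=> [s1 [f1 [u1 h1 ->]]] [s2 [f2 [u2 h2 ->]]].
exists (undup (s1 ++ s2)), (fun d => (if d \in s1 then f1 d else 0)
  + (if d \in s2 then f2 d else 0)); split; first exact: undup_uniq.
  by move=> e; apply: PD; case: ifP.
rewrite big_split /= -!big_mkcond /=.
have H s f : uniq s -> {subset s <= s1 ++ s2} ->
    \sum_(e <- s) f e = \sum_(e <- undup (s1 ++ s2) | e \in s) f e :> M.
  move=> us sub; rewrite -[RHS]big_filter; apply: perm_big.
  apply: uniq_perm => //; first by rewrite filter_uniq ?undup_uniq.
  move=> e; rewrite mem_filter mem_undup.
  by case: (boolP (e \in s)) => // /sub ->.
by congr (_ + _); apply: H => // e he; rewrite mem_cat he ?orbT.
Qed.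

Lemma decomposable0 : decomposable 0.
Proof. exact: (@decomposable_hom 0). Qed.

End Decompositions.

Section SimpleModule.
Variables (K : fieldType) (n : nat) (eps : 'I_n -> 'I_n -> K).
Variables (m : nat) (M : klr_mod eps m) (x y : nat).
Hypotheses (xy : (x <= y)%N) (Mgr : klr_graded M) (Mwt : klr_weight M (rootn n x y)).
Hypothesis Msimple : klr_simple M.
Implicit Types (nu mu : seq 'I_n) (u v w : M).
Local Notation gE := (@gE K n).
Local Notation ksc := (@ksc K n).

Lemma klr_E_wt nu u : gE nu *: u != 0 -> word_wt nu = rootn n x y.
Proof. by move=> h; apply/eqP; apply: contraNT h => /Mwt ->. Qed.

Lemma klr_deg_add e u v : klr_deg e u -> klr_deg e v -> klr_deg e (u + v).
Proof. by move=> hu hv; rewrite -[u]scale1r -ksc1; apply: klr_deg_lin. Qed.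

Lemma klr_deg_scale e (a : K) u : klr_deg e u -> klr_deg e (ksc a *: u).
Proof. by move=> hu; rewrite -[_ *: u]addr0; apply: klr_deg_lin => //; apply: klr_deg0. Qed.

(** Sums of such vectors over all [e] form the part of the module in degrees above [d]. *)
Definition above (d e : int) (w : M) := klr_deg e w /\ (e <= d -> w = 0).

Lemma above0 d e : above d e 0.
Proof. by split=> //; apply: klr_deg0. Qed.

Lemma aboveD d e u v : above d e u -> above d e v -> above d e (u + v).
Proof.
move=> [h1 h2] [h3 h4]; split; first exact: klr_deg_add.
by move=> h; rewrite h2 // h4 // addr0.
Qed.

(* As the letters of a weight of [M] are distinct, all the generators have
   non-negative degree. *)
Lemma above_submod d : klr_graded_submod (decomposable (above d)).
Proof.
have DD := decomposable_add (@above0 d) (@aboveD d).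
have Dh := decomposable_hom (@above0 d).
have D0 := decomposable0 (@above0 d).
have Dgen g u : decomposable (above d) u -> decomposable (above d) (free_gen K g *: u).
  move=> [s [f [_ hf ->]]]; rewrite scaler_sumr; elim/big_ind: _ => // e _.
  case: g => [nu|[k|l]].
  - apply: (Dh e); have [h1 h2] := hf e; split; first exact: klr_degE.
    by move=> /h2 ->; rewrite scaler0.
  - apply: (Dh (e + 2)); have [h1 h2] := hf e; split; first exact: klr_degX.
    by move=> h; rewrite h2 ?scaler0 //; lia.
  rewrite [f e]klr_E1 scaler_sumr; elim/big_ind: _ => // nu _.
  have [lm|lm] := leqP m l.+1; first by rewrite klr_P_out.
  have [mu [i [j [mu' [enu <-]]]]] : exists mu i j mu',
      tval nu = mu ++ [:: i, j & mu'] /\ size mu = l.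
    by apply: split_two; rewrite size_tuple.
  have [->|/klr_E_wt] := eqVneq (gE nu *: f e) 0; first by rewrite scaler0.
  move/(word_wt_root xy) => [un _].
  have ij : i != j.
    move: un; rewrite enu cat_uniq /= => /and5P[_ _ + _ _].
    by rewrite inE => /norP[].
  have c0 : cartan i j <= 0.
    by rewrite /cartan (negbTE ij); case: ifP.
  have [h1 h2] := hf e.
  apply: (Dh (e - cartan i j)); split.
    by rewrite enu scalerA; apply: klr_degP.
  by move=> h; rewrite h2 ?scaler0 //; lia.
split=> //.
- move=> a u v hu hv; apply: (DD) => //; apply: (free_gen_ind D0 DD) => //.
  move=> b w [s [f [us hf ->]]]; rewrite scaler_sumr.
  elim/big_ind: _ => // e _; apply: (Dh e); have [h1 h2] := hf e.
  split; first exact: klr_deg_scale.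
  by move=> /h2 ->; rewrite scaler0.
- move=> u [s [f [us hf ->]]]; exists s, f; split=> // e; split.
    by have [] := hf e.
  exact: Dh (hf e).
Qed.

(** By simplicity the part in degrees above [e] is zero or everything. A nonzero vector of degree
    [e] does not lie in it, so it is then zero, and two different degrees cannot both occur. *)
Lemma klr_one_degree : exists d0,
  (forall u, klr_deg d0 u) /\ (forall e u, klr_deg e u -> e != d0 -> u = 0).
Proof.
have [u u0] : exists u : M, u != 0 by case: Msimple.
have [s [f [hf eu]]] := klr_deg_gen Mgr u.
have [d fd] : exists d, f d != 0.
  apply/not_existsP => h; case/eqP: u0; rewrite eu big1 // => e _.
  by apply/eqP/negPn/negP => /h.
have A e v : klr_deg e v -> v != 0 -> forall w, decomposable (above (e - 1)) w.
  move=> hv v0; have [_ /(_ _ (above_submod (e - 1)))] := Msimple.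
  case=> // h; case/eqP: v0; apply: h; apply: (decomposable_hom (@above0 _) (e := e)).
  by split=> // h; lia.
have B e v : klr_deg e v -> v != 0 -> forall w, decomposable (above e) w -> w = 0.
  move=> hv v0; have [_ /(_ _ (above_submod e))] := Msimple.
  case=> // h; have [s' [f' [us hf' ev]]] := h v.
  (* If the part above [e] were everything, [v] would be a sum of vectors of degrees other than [e],
     against the directness of the grading. *)
  pose g d := if d == e then - v else f' d.
  have hg d' : klr_deg d' (g d').
    rewrite /g; case: eqP => [->|_]; last by have [] := hf' d'.
    by rewrite -[- v]scaleN1r -kscN1; apply: klr_deg_scale.
  have fe0 : f' e = 0 by have [_] := hf' e; apply.
  have ug : uniq (e :: filter (predC1 e) s').
    by rewrite /= mem_filter /= eqxx filter_uniq.
  have sg : \sum_(d <- e :: filter (predC1 e) s') g d = 0.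
    rewrite big_cons {1}/g eqxx big_filter.
    rewrite [X in _ + X](_ : _ = v) ?addNr // [in RHS]ev.
    rewrite [RHS](bigID (predC1 e)) /= [X in _ = _ + X]big1 ?addr0 => [|i].
      by apply: eq_bigr => i /negbTE; rewrite /g => ->.
    by rewrite negbK => /eqP ->.
  have := klr_deg_direct Mgr ug hg sg (mem_head _ _).
  by rewrite /g eqxx => /eqP; rewrite oppr_eq0 (negbTE v0).
have C e v : klr_deg e v -> e != d -> v = 0.
  move=> hv ed; apply/eqP/negPn/negP => v0.
  have [lt|lt|eq] := ltgtP e d; last by rewrite eq eqxx in ed.
    case/eqP: fd; apply: (B _ _ hv v0); apply: (decomposable_hom (@above0 _) (e := d)).
    by split=> // h; lia.
  case/eqP: v0; apply: (B _ _ (hf d) fd); apply: (decomposable_hom (@above0 _) (e := e)).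
  by split=> // h; lia.
exists d; split=> // v; have [s' [f' [hf' ->]]] := klr_deg_gen Mgr v.
elim/big_ind: _ => [|*|e _]; [exact: klr_deg0 | exact: klr_deg_add |].
have [->|ed] := eqVneq e d; first exact: hf'.
by rewrite (C _ _ (hf' e) ed); apply: klr_deg0.
Qed.

End SimpleModule.

(** * The words of a quiver, and bases of simple modules indexed by them *)

Section QuiverWords.
Variables (n : nat) (Q : rel 'I_n).
Hypothesis qQ : dynkin_quiver Q.
Implicit Types (nu mu : seq 'I_n) (i j c d : 'I_n).

Definition follows nu : bool :=
  [forall c, [forall d, [&& Q c d, c \in nu & d \in nu] ==>
     (filter (pred2 c d) nu == [:: d; c])]].

(* The weights of [S_Q] of the root [rootn n x y]: for each arrow c -> d between
   letters of the word, d comes before c. *)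
Definition qword x y nu : bool := (word_wt nu == rootn n x y) && follows nu.

Lemma followsP nu : reflect (forall c d, Q c d -> c \in nu -> d \in nu ->
  filter (pred2 c d) nu = [:: d; c]) (follows nu).
Proof.
apply: (iffP forallP) => [h c d cd cn dn|h c].
  by move/forallP: (h c) => /(_ d); rewrite cd cn dn => /eqP.
by apply/forallP => d; apply/implyP => /and3P[cd cn dn]; rewrite h.
Qed.

Lemma quiver_adjacent c d : Q c d -> adjacent c d.
Proof. by move=> cd; have [<- _] := qQ c d; rewrite cd. Qed.

Lemma qword_uniq x y nu : (x <= y)%N -> qword x y nu ->
  uniq nu /\ forall i, (i \in nu) = (x <= i < y)%N.
Proof. by move=> xy /andP[/eqP w _]; apply: word_wt_root. Qed.

(** The weight fixes the letters and each arrow between them fixes the order of two adjacent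
    letters, so admissible words agree on every adjacent pair: they form one commutation class. *)
Lemma qword_eqv x y nu0 nu : (x <= y)%N -> qword x y nu0 ->
  word_eqv nu nu0 = qword x y nu.
Proof.
move=> xy q0; have [u0 m0] := qword_uniq xy q0; have /andP[/eqP w0 /followsP f0] := q0.
apply/idP/idP => [/word_eqvP[p h]|q].
  apply/andP; split; first by rewrite /word_wt (perm_big _ p) -w0.
  apply/followsP => c d cd; rewrite !(perm_mem p) => cn dn.
  by rewrite h ?f0 // quiver_adjacent.
have [u m] := qword_uniq xy q; have /andP[_ /followsP f] := q.
apply/word_eqvP; split; first by apply: uniq_perm => // i; rewrite m m0.
move=> c d; have [<- _] := qQ c d => cd.
have M i : (i \in nu) = (i \in nu0) by rewrite m m0.
have [cn|cn] := boolP (c \in nu); have [dn|dn] := boolP (d \in nu).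
- case/orP: cd => cd; first by rewrite f ?f0 -?M.
  have E s : filter (pred2 c d) s = filter (pred2 d c) s.
    by apply: eq_filter => k /=; rewrite orbC.
  by rewrite !E f ?f0 -?M.
- have E s : d \notin s -> filter (pred2 c d) s = filter (pred1 c) s.
    move=> ds; apply: eq_in_filter => k ks /=; case: eqP => //= _.
    by apply/negbTE; apply: contraNneq ds => <-.
  by rewrite !E -?M // !filter_pred1_uniq -?M.
- have E s : c \notin s -> filter (pred2 c d) s = filter (pred1 d) s.
    move=> ds; apply: eq_in_filter => k ks /=; case: (k =P c) => //= kc.
    by rewrite -kc ks in ds.
  by rewrite !E -?M // !filter_pred1_uniq -?M.
have E s : c \notin s -> d \notin s -> filter (pred2 c d) s = [::].
  move=> cs ds; apply/eqP; rewrite -size_eq0 size_filter -leqn0 leqNgt -has_count.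
  by apply/hasPn => k ks /=; apply/norP; split; apply: contraTneq ks => ->.
by rewrite !E -?M.
Qed.

Lemma qword_swap x y mu i j mu' : (x <= y)%N -> ~~ adjacent i j ->
  qword x y (mu ++ [:: i, j & mu']) -> qword x y (mu ++ [:: j, i & mu']).
Proof.
move=> xy nij q; have [u _] := qword_uniq xy q.
have ij : i != j.
  move: u; rewrite cat_uniq /= => /and5P[_ _ + _ _].
  by rewrite inE => /norP[].
by rewrite -(qword_eqv _ xy q) -word_eqv_swap // word_eqv_refl.
Qed.

(** The only edge between the two supports is the one at [y], and its orientation decides which
    block comes first. *)
Lemma qword_cat x y z nu nu' : (x < y)%N -> (y < z <= n)%N ->
  (if arrow_right Q y then qword y z nu && qword x y nu'
   else qword x y nu && qword y z nu') -> qword x z (nu ++ nu').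
Proof.
move=> xy yz.
have yz' : (y <= z)%N by lia.
have H p q r s : (p <= q)%N -> (r <= s)%N -> qword p q nu -> qword r s nu' ->
   rootn n p q + rootn n r s = rootn n x z ->
   (forall c : 'I_n, (p <= c < q)%N -> ~~ (r <= c < s)%N) ->
   (forall c d : 'I_n, (p <= c < q)%N -> (r <= d < s)%N -> ~~ Q c d) ->
   qword x z (nu ++ nu').
  move=> pq rs q1 q2 e dis nQ.
  have [u1 m1] := qword_uniq pq q1; have [u2 m2] := qword_uniq rs q2.
  case/andP: q1 => /eqP w1 /followsP f1; case/andP: q2 => /eqP w2 /followsP f2.
  apply/andP; split; first by rewrite /word_wt big_cat /= -!/(word_wt _) w1 w2 e.
  have E c t : c \notin t -> forall d, filter (pred2 c d) t = filter (pred1 d) t.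
    move=> ds d; apply: eq_in_filter => k ks /=; case: (k =P c) => //= kc.
    by rewrite -kc ks in ds.
  have E' c t : c \notin t -> forall d, filter (pred2 d c) t = filter (pred1 d) t.
    move=> ds d; rewrite -(E c t ds); apply: eq_filter => k /=; exact: orbC.
  have N c t : c \notin t -> filter (pred1 c) t = [::].
    move=> cs; apply/eqP; rewrite -size_eq0 size_filter -leqn0 leqNgt -has_count.
    by rewrite has_pred1.
  apply/followsP => c d cd; rewrite !mem_cat filter_cat.
  have D k : k \in nu -> k \notin nu' by rewrite m1 m2; apply: dis.
  have [c1|c1] := boolP (c \in nu); have [d1|d1] := boolP (d \in nu) => //= c2 d2.
  - by rewrite f1 // E ?D // N ?D.
  - by have := nQ c d; rewrite -m1 -m2 c1 d2 cd => /(_ isT isT).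
  - by rewrite E // filter_pred1_uniq // E' ?D // filter_pred1_uniq.
  - by rewrite f2 // E // N.
have L c d : Q c d ->
    ((d : nat) = c.+1 /\ arrow_right Q d) \/ ((c : nat) = d.+1 /\ ~~ arrow_right Q c).
  move=> cd; have /orP[/eqP e|/eqP e] := quiver_adjacent cd.
    by right; split=> //; rewrite (@arrow_rightN _ Q c d c) // cd.
  by left; split=> //; rewrite (@arrow_rightP _ Q d c d).
case: ifP => hR /andP[q1 q2].
  apply: (H y z x y) => //; try lia; first by rewrite addrC root_add.
  move=> c d hc hd; apply/negP => /L[[e _]|[e h]]; first by lia.
  by have ec : (c : nat) = y by [lia]; rewrite ec hR in h.
apply: (H x y y z) => //; try lia; first by rewrite root_add.
move=> c d hc hd; apply/negP => /L[[e h]|[e _]]; last by lia.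
by have ed : (d : nat) = y by [lia]; rewrite ed hR in h.
Qed.

End QuiverWords.

Section Basis.
Variables (K : fieldType) (n : nat) (eps : 'I_n -> 'I_n -> K) (Q : rel 'I_n).
Implicit Types (nu mu : seq 'I_n) (i j : 'I_n).
Local Notation gE := (@gE K n).
Local Notation ksc := (@ksc K n).
Local Notation gX := (@gX K n).
Local Notation gP := (@gP K n).

Record klr_basis m (M : klr_mod eps m) x y (v : seq 'I_n -> M)
    (co : seq 'I_n -> M -> K) : Prop := KlrBasis {
  basis_neq0 : forall nu, qword Q x y nu -> v nu != 0;
  basis_E : forall nu, qword Q x y nu -> gE nu *: v nu = v nu;
  basis_X : forall k (u : M), gX k *: u = 0;
  basis_P : forall mu i j mu', qword Q x y (mu ++ [:: i, j & mu']) ->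
    gP (size mu) *: v (mu ++ [:: i, j & mu'])
    = if adjacent i j then 0 else v (mu ++ [:: j, i & mu']);
  basis_sum : forall u,
    u = \sum_(nu : m.-tuple 'I_n | qword Q x y nu) ksc (co nu u) *: v nu;
  basis_co : forall nu u, qword Q x y nu -> gE nu *: u = ksc (co nu u) *: v nu;
  basis_wt : forall nu (u : M), gE nu *: u != 0 -> qword Q x y nu;
  basis_deg : exists d0, (forall u : M, klr_deg d0 u) /\
    (forall e (u : M), klr_deg e u -> e != d0 -> u = 0) }.

Hypothesis qQ : dynkin_quiver Q.

Theorem klr_basis_exists m (M : klr_mod eps m) x y nu0 u0 : (x <= y)%N ->
  klr_graded M -> klr_weight M (rootn n x y) -> klr_simple M ->
  qword Q x y nu0 -> gE nu0 *: (u0 : M) != 0 ->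
  exists v co, @klr_basis m M x y v co.
Proof.
move=> xy gr wt simple q0 u00.
have [d0 [hd0 d0u]] := klr_one_degree xy gr wt simple.
have X0 k (u : M) : gX k *: u = 0.
  by apply: (d0u (d0 + 2)); [apply: klr_degX | lia].
have [un0 _] := qword_uniq xy q0.
pose In nu (u : M) := gE nu *: u = u.
have In0 : In ([::] ++ nu0) (gE nu0 *: u0) by rewrite /In klr_EE eqxx.
have [|||||v [v0 hv]] := @word_coherence n M (fun l u => gP l *: u) In _ _ _ _ _ nu0 [::]
  (gE nu0 *: u0) un0 In0 u00.
- by move=> l; rewrite scaler0.
- by move=> k l u h; apply: klr_PC.
- by move=> mu i j mu' u ij nij; rewrite /In => h; rewrite -klr_PE h.
- by move=> mu i j mu' u ij nij h; apply: klr_PK ij nij h.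
- by move=> mu h i j mu' u hj hu; apply: klr_braid hj hu.
have eqv nu : qword Q x y nu -> word_eqv nu nu0 by rewrite (qword_eqv qQ _ xy q0).
have vE nu : qword Q x y nu -> gE nu *: v nu = v nu.
  by move=> /eqv/hv[].
have vn0 nu : qword Q x y nu -> v nu != 0 by move=> /eqv/hv[].
have vP mu i j mu' : qword Q x y (mu ++ [:: i, j & mu']) ->
    gP (size mu) *: v (mu ++ [:: i, j & mu'])
    = if adjacent i j then 0 else v (mu ++ [:: j, i & mu']).
  move=> q; have [u _] := qword_uniq xy q.
  have ij : i != j.
    move: u; rewrite cat_uniq /= => /and5P[_ _ + _ _].
    by rewrite inE => /norP[].
  case: ifP => [adj|/negbT nadj].
    rewrite -(vE _ q) scalerA; apply: (d0u (d0 - cartan i j)).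
      by apply: klr_degP.
    by rewrite /cartan (negbTE ij) adj; lia.
  by have [_ _ /(_ _ _ _ _ erefl ij nadj)] := hv _ (eqv _ q).
have sz nu : qword Q x y nu -> size nu = m.
  by move=> q; apply: (@klr_E_size _ _ _ m M nu (v nu)); rewrite vE // vn0.
(* The span of the [v nu] is stable under the generators, and it is graded because the module has a
   single degree. Being nonzero, it is everything by simplicity. *)
pose U (u : M) := exists a : seq 'I_n -> K,
  u = \sum_(nu : m.-tuple 'I_n | qword Q x y nu) ksc (a nu) *: v nu.
have U0 : U 0 by exists (fun=> 0); rewrite big1 // => nu _; rewrite ksc0 scale0r.
have UD u w : U u -> U w -> U (u + w).
  move=> [a ->] [b ->]; exists (fun nu => a nu + b nu); rewrite -big_split /=.
  by apply: eq_bigr => nu _; apply: esym (kscDl _ _ _).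
have UZ (c : K) u : U u -> U (ksc c *: u).
  move=> [a ->]; exists (fun nu => c * a nu); rewrite [LHS]scaler_sumr.
  by apply: eq_bigr => nu _; exact: ksc_scale.
have Uv nu : qword Q x y nu -> U (v nu).
  move=> q; have s : size nu == m by rewrite sz.
  exists (fun nu' => (nu' == nu)%:R).
  rewrite (bigD1 (Tuple s)) //= eqxx ksc1 scale1r big1 ?addr0 // => nu' /andP[_ ne].
  have -> : (tval nu' == nu) = false by rewrite -(val_eqE nu' (Tuple s)) in ne; apply/negbTE.
  by rewrite ksc0 scale0r.
have Ug g u : U u -> U (free_gen K g *: u).
  move=> [a ->]; rewrite scaler_sumr; elim/big_ind: _ => // nu q.
  rewrite kscA; apply: (UZ); case: g => [xi|[k|l]].
  - rewrite -(vE _ q) -/(gE xi) klr_EE; case: eqP => // ->.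
    by rewrite vE //; apply: Uv.
  - by rewrite -/(gX k) X0.
  rewrite -/(gP l); have [lm|lm] := leqP m l.+1; first by rewrite klr_P_out.
  have [mu [i [j [mu' [enu el]]]]] : exists mu i j mu',
      tval nu = mu ++ [:: i, j & mu'] /\ size mu = l.
    by apply: split_two; rewrite size_tuple.
  rewrite enu in q *; rewrite -el vP //; case: ifP => // /negbT nadj.
  by apply: Uv; apply: (qword_swap qQ xy nadj q).
have Ugr : klr_graded_submod U.
  split=> // [a u w hu hw|u hu].
    by apply: (UD) => //; apply: (free_gen_ind U0 UD UZ Ug).
  exists [:: d0], (fun d => if d == d0 then u else 0).
  split; last by rewrite big_seq1 eqxx.
  move=> d; case: eqP => [->|_]; first by split.
  by split=> //; apply: klr_deg0.
have Uall u : U u.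
  have [_ /(_ _ Ugr)] := simple; case=> // h.
  by have := vn0 _ q0; rewrite (h _ (Uv _ q0)) eqxx.
have gEsum nu (a : seq 'I_n -> K) : gE nu *:
    (\sum_(nu : m.-tuple 'I_n | qword Q x y nu) ksc (a nu) *: v nu)
    = if qword Q x y nu then ksc (a nu) *: v nu else 0.
  rewrite scaler_sumr; case: ifP => q.
    have s : size nu == m by rewrite sz.
    rewrite (bigD1 (Tuple s)) //= kscA vE // big1 ?addr0 // => nu' /andP[q' ne].
    rewrite kscA -(vE _ q') klr_EE.
    have -> : (nu == nu') = false.
      by rewrite -(val_eqE nu' (Tuple s)) /= eq_sym in ne; apply/negbTE.
    by rewrite scaler0.
  rewrite big1 // => nu' q'; rewrite kscA -(vE _ q') klr_EE.
  by case: eqP q => [->|_ _]; rewrite ?q' // scaler0.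
(* The idempotent e(nu) projects onto the line of [v nu], which is how coordinates are read off. *)
pose co nu (u : M) := classical_sets.xget 0 (fun c : K => gE nu *: u = ksc c *: v nu).
have coE nu u : qword Q x y nu -> gE nu *: u = ksc (co nu u) *: v nu.
  move=> q; rewrite /co; case: classical_sets.xgetP => // h; exfalso.
  by have [a eu] := Uall u; apply: (h (a nu)); rewrite {1}eu gEsum q.
have coU nu (u : M) (a : K) : qword Q x y nu -> gE nu *: u = ksc a *: v nu ->
    co nu u = a.
  by move=> q e; apply: ksc_inj (etrans (esym (coE _ _ q)) e) (vn0 _ q).
exists v, co; split=> //.
- move=> u; have [a eu] := Uall u; rewrite {1}eu; apply: eq_bigr => nu q.
  by rewrite (coU _ _ (a nu)) // {1}eu gEsum q.
- move=> nu u; have [a ->] := Uall u; rewrite gEsum; case: ifP => //.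
  by rewrite eqxx.
- by exists d0.
Qed.

Section Coordinates.
Variables (m : nat) (M : klr_mod eps m) (x y : nat).
Variables (v : seq 'I_n -> M) (co : seq 'I_n -> M -> K).
Hypothesis bM : klr_basis x y v co.

Lemma basis_co_unique nu u (a : K) : qword Q x y nu ->
  gE nu *: u = ksc a *: v nu -> co nu u = a.
Proof.
by move=> q e; apply: ksc_inj (etrans (esym (basis_co bM _ q)) e) (basis_neq0 bM q).
Qed.

Lemma basis_co_linear nu (a : K) u w : qword Q x y nu ->
  co nu (ksc a *: u + w) = a * co nu u + co nu w.
Proof.
move=> q; apply: basis_co_unique => //; rewrite scalerDr kscA.
have [eu ew] := (basis_co bM u q, basis_co bM w q).
apply: etrans (congr2 (fun s t => ksc a *: s + t) eu ew) _.
exact: (etrans (congr1 (+%R^~ _) (ksc_scale _ _ _)) (esym (kscDl _ _ _))).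
Qed.

Lemma basis_size nu : qword Q x y nu -> size nu = m.
Proof.
move=> q; apply: (@klr_E_size _ _ _ m M nu (v nu)).
by rewrite (basis_E bM) // (basis_neq0 bM).
Qed.

Lemma basis_co_basis nu nu' : qword Q x y nu -> qword Q x y nu' ->
  co nu (v nu') = (nu == nu')%:R.
Proof.
move=> q q'; apply: basis_co_unique => //; rewrite -{1}(basis_E bM q') klr_EE.
by case: eqP => [->|_]; rewrite ?(basis_E bM) ?ksc1 ?scale1r // ksc0 scale0r.
Qed.

End Coordinates.
End Basis.

(** * Homomorphisms from convolution products *)

Section ConvolutionMap.
Variables (K : fieldType) (n : nat) (eps : 'I_n -> 'I_n -> K) (Q : rel 'I_n).
Implicit Types (nu mu : seq 'I_n) (i j : 'I_n).
Local Notation gE := (@gE K n).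
Local Notation ksc := (@ksc K n).
Local Notation gP := (@gP K n).
Local Notation F := (klr_free K n).
Hypothesis qQ : dynkin_quiver Q.

Variables (mb ma mg : nat) (Mb : klr_mod eps mb) (Ma : klr_mod eps ma).
Variables (Mg : klr_mod eps mg) (xb yb xa ya xg yg : nat).
Variables (vb : seq 'I_n -> Mb) (cb : seq 'I_n -> Mb -> K).
Variables (va : seq 'I_n -> Ma) (ca : seq 'I_n -> Ma -> K).
Variables (vg : seq 'I_n -> Mg) (cg : seq 'I_n -> Mg -> K).
Hypothesis bb : klr_basis Q xb yb vb cb.
Hypothesis ba : klr_basis Q xa ya va ca.
Hypothesis bg : klr_basis Q xg yg vg cg.
Hypothesis xyb : (xb <= yb)%N.
Hypothesis xya : (xa <= ya)%N.
(** An equation and not a shared index: the height of a root and the sum of the heights of its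
    summands are equal but not convertible. *)
Hypothesis emg : mg = (mb + ma)%N.
Hypothesis qcat : forall nu nu', qword Q xb yb nu -> qword Q xa ya nu' ->
  qword Q xg yg (nu ++ nu').

Definition glue (u : Mb) (w : Ma) : Mg :=
  \sum_(nu : mb.-tuple 'I_n | qword Q xb yb nu)
  \sum_(nu' : ma.-tuple 'I_n | qword Q xa ya nu')
    ksc (cb nu u * ca nu' w) *: vg (nu ++ nu').

Lemma glue_linl (a : K) u u' w :
  glue (ksc a *: u + u') w = ksc a *: glue u w + glue u' w.
Proof.
rewrite /glue [X in _ = X + _]scaler_sumr -big_split; apply: eq_bigr => nu q /=.
rewrite [X in _ = X + _]scaler_sumr -big_split; apply: eq_bigr => nu' q' /=.
by rewrite (basis_co_linear bb) //; exact: ksc_combl.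
Qed.

Lemma glue_linr (a : K) u w w' :
  glue u (ksc a *: w + w') = ksc a *: glue u w + glue u w'.
Proof.
rewrite /glue [X in _ = X + _]scaler_sumr -big_split; apply: eq_bigr => nu q /=.
rewrite [X in _ = X + _]scaler_sumr -big_split; apply: eq_bigr => nu' q' /=.
by rewrite (basis_co_linear ba) //; exact: ksc_combr.
Qed.

Lemma bilinear_ext (f g : Mb -> Ma -> Mg) :
  (forall (a : K) u u' w, f (ksc a *: u + u') w = ksc a *: f u w + f u' w) ->
  (forall (a : K) u w w', f u (ksc a *: w + w') = ksc a *: f u w + f u w') ->
  (forall (a : K) u u' w, g (ksc a *: u + u') w = ksc a *: g u w + g u' w) ->
  (forall (a : K) u w w', g u (ksc a *: w + w') = ksc a *: g u w + g u w') ->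
  (forall nu nu', qword Q xb yb nu -> qword Q xa ya nu' ->
     f (vb nu) (va nu') = g (vb nu) (va nu')) ->
  forall u w, f u w = g u w.
Proof.
move=> fl fr gl gr h u w.
have Z (V W : lmodType F) (k : V -> W) :
    (forall (a : K) u u', k (ksc a *: u + u') = ksc a *: k u + k u') ->
    k 0 = 0.
  move=> kl; have := kl (-1) 0 0; rewrite scaler0 addr0 kscN1 scaleN1r.
  by rewrite addNr.
rewrite [u](basis_sum bb); elim/big_rec: _ => [|nu u' q IH].
  by rewrite (Z _ _ (f^~ w)) ?(Z _ _ (g^~ w)).
rewrite fl gl IH; congr (_ *: _ + _).
rewrite [w](basis_sum ba); elim/big_rec: _ => [|nu' w' q' IH'].
  by rewrite (Z _ _ (f (vb nu))) ?(Z _ _ (g (vb nu))).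
by rewrite fr gr IH' h.
Qed.

Lemma glue_basis nu nu' : qword Q xb yb nu -> qword Q xa ya nu' ->
  glue (vb nu) (va nu') = vg (nu ++ nu').
Proof.
move=> q q'; have s : size nu == mb by rewrite (basis_size bb).
have s' : size nu' == ma by rewrite (basis_size ba).
rewrite /glue (bigD1 (Tuple s)) //= [X in _ + X]big1 ?addr0 => [|mu /andP[qm ne]].
  rewrite (bigD1 (Tuple s')) //= big1 ?addr0 => [|mu /andP[qm ne]].
    by rewrite (basis_co_basis bb) // (basis_co_basis ba) // !eqxx mulr1 ksc1 scale1r.
  rewrite (basis_co_basis ba) //.
  have -> : (tval mu == nu') = false by rewrite -(val_eqE mu (Tuple s')) in ne; apply/negbTE.
  by rewrite mulr0 ksc0 scale0r.
rewrite big1 // => mu' qm'; rewrite (basis_co_basis bb) //.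
have -> : (tval mu == nu) = false by rewrite -(val_eqE mu (Tuple s)) in ne; apply/negbTE.
by rewrite mul0r ksc0 scale0r.
Qed.

Lemma glue0l w : glue 0 w = 0.
Proof.
by have := glue_linl (-1) 0 0 w; rewrite scaler0 addr0 kscN1 scaleN1r addNr.
Qed.

Lemma glue0r u : glue u 0 = 0.
Proof.
by have := glue_linr (-1) u 0 0; rewrite scaler0 addr0 kscN1 scaleN1r addNr.
Qed.

Lemma glue_E nu nu' u w : size nu = mb -> size nu' = ma ->
  gE (nu ++ nu') *: glue u w = glue (gE nu *: u) (gE nu' *: w).
Proof.
move=> s s'; apply: (bilinear_ext (f := fun u w => gE (nu ++ nu') *: glue u w)
  (g := fun u w => glue (gE nu *: u) (gE nu' *: w)))
  => {u w} [a u u' w|a u w w'|a u u' w|a u w w'|mu mu' q q'].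
- by rewrite glue_linl scalerDr kscA.
- by rewrite glue_linr scalerDr kscA.
- by rewrite scalerDr kscA glue_linl.
- by rewrite scalerDr kscA glue_linr.
rewrite glue_basis // -(basis_E bb q) -(basis_E ba q') -(basis_E bg (qcat q q')).
rewrite !klr_EE eqseq_cat; last by rewrite s (basis_size bb q).
case: eqP => [->|_]; last by rewrite glue0l.
case: eqP => [->|_]; last by rewrite glue0r.
by rewrite (basis_E bb) // (basis_E ba) // (basis_E bg) ?glue_basis //; apply: qcat.
Qed.

Lemma glue_Pl l u w : (l.+1 < mb)%N -> gP l *: glue u w = glue (gP l *: u) w.
Proof.
move=> lm; apply: (bilinear_ext (f := fun u w => gP l *: glue u w)
  (g := fun u w => glue (gP l *: u) w))
  => {u w} [a u u' w|a u w w'|a u u' w|a u w w'|nu nu' q q'].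
- by rewrite glue_linl scalerDr kscA.
- by rewrite glue_linr scalerDr kscA.
- by rewrite scalerDr kscA glue_linl.
- by rewrite glue_linr.
rewrite glue_basis //.
have [mu [i [j [mu' [enu el]]]]] : exists mu i j mu',
    nu = mu ++ [:: i, j & mu'] /\ size mu = l.
  by apply: split_two; rewrite (basis_size bb q).
rewrite -el; rewrite enu in q *; have qc := qcat q q'.
rewrite -catA /= in qc *; rewrite (basis_P bb) // (basis_P bg) //.
case: ifP => [_|/negbT nadj]; first by rewrite glue0l.
by rewrite glue_basis -?catA //; apply: (qword_swap qQ xyb nadj q).
Qed.

Lemma glue_Pr l u w : (l.+1 < ma)%N ->
  gP (mb + l) *: glue u w = glue u (gP l *: w).
Proof.
move=> lm; apply: (bilinear_ext (f := fun u w => gP (mb + l) *: glue u w)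
  (g := fun u w => glue u (gP l *: w)))
  => {u w} [a u u' w|a u w w'|a u u' w|a u w w'|nu nu' q q'].
- by rewrite glue_linl scalerDr kscA.
- by rewrite glue_linr scalerDr kscA.
- by rewrite glue_linl.
- by rewrite scalerDr kscA glue_linr.
rewrite glue_basis //.
have [mu [i [j [mu' [enu el]]]]] : exists mu i j mu',
    nu' = mu ++ [:: i, j & mu'] /\ size mu = l.
  by apply: split_two; rewrite (basis_size ba q').
have <- : size (nu ++ mu) = (mb + l)%N by rewrite size_cat el (basis_size bb q).
rewrite -el; rewrite enu in q' *; have qc := qcat q q'.
rewrite catA in qc *; rewrite (basis_P ba) // (basis_P bg) //.
case: ifP => [_|/negbT nadj]; first by rewrite glue0r.
by rewrite glue_basis -?catA //; apply: (qword_swap qQ xya nadj q').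
Qed.

Definition conv_lift (z : conv_free Mb Ma) : Mg := lin_ext (fun k => glue k.1 k.2) z.

Lemma conv_lift_sym u w : conv_lift (conv_sym u w) = glue u w.
Proof. exact: lin_extU. Qed.

Lemma conv_lift_linear a z z' :
  conv_lift (a *: z + z') = a *: conv_lift z + conv_lift z'.
Proof. exact: lin_ext_linear. Qed.

(** The relations of the algebra hold in [Mg]. The others involve only generators acting inside one
    of the two blocks, where [glue] commutes with them by the form of the bases; the psi that
    crosses from one block to the other is not constrained. *)
Lemma conv_lift_rel z : conv_rel z -> conv_lift z = 0.
Proof.
have L0 : conv_lift 0 = 0.
  by have := conv_lift_linear (-1) 0 0; rewrite scaler0 addr0 scaleN1r addNr.
have LZ a t : conv_lift (a *: t) = a *: conv_lift t.
  by have := conv_lift_linear a t 0; rewrite L0 !addr0.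
have LD t t' : conv_lift (t + t') = conv_lift t + conv_lift t'.
  by have := conv_lift_linear 1 t t'; rewrite !scale1r.
have LB t t' : conv_lift (t - t') = conv_lift t - conv_lift t'.
  have := conv_lift_linear (-1) t' t; rewrite !scaleN1r [- t' + t]addrC => ->.
  by rewrite addrC.
case=> [r a u w hr|a u u' w|a u w w'|nu nu' u w s s'|k u w _|k u w _|l u w h|l u w h];
  rewrite ?LB ?LD ?LZ !conv_lift_sym.
- by rewrite -scalerA; apply: klr_relP; rewrite emg.
- by rewrite glue_linl subrr.
- by rewrite glue_linr subrr.
- by rewrite glue_E // subrr.
- by rewrite (basis_X bg) (basis_X bb) glue0l subrr.
- by rewrite (basis_X bg) (basis_X ba) glue0r subrr.
- by rewrite glue_Pl // subrr.
- by rewrite glue_Pr // subrr.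
Qed.

Theorem conv_epi_exists nub nua : klr_graded Mg -> klr_simple Mg ->
  qword Q xb yb nub -> qword Q xa ya nua ->
  exists f : {linear conv Mb Ma -> Mg}, klr_epi f.
Proof.
move=> gr simple qb qa.
have [f ef] := linear_pack (quot_map_linear conv_lift_linear conv_lift_rel).
have fpi z : f (conv_pi z) = conv_lift z.
  by rewrite ef (quot_map_pi conv_lift_linear conv_lift_rel).
have [db [hb1 hb2]] := basis_deg bb.
have [da [ha1 ha2]] := basis_deg ba.
have [dg [hg1 hg2]] := basis_deg bg.
exists f; split.
  exists (dg - (db + da)) => d z; elim=> {d z}.
  - move=> d d' u w hu hw; rewrite fpi conv_lift_sym.
    have [ed|/(hb2 _ _ hu) ->] := eqVneq d db; last first.
      by rewrite glue0l; apply: klr_deg0.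
    have [ed'|/(ha2 _ _ hw) ->] := eqVneq d' da; last first.
      by rewrite glue0r; apply: klr_deg0.
    by have -> : d + d' + (dg - (db + da)) = dg by [rewrite ed ed'; ring].
  - by move=> d; rewrite raddf0; apply: klr_deg0.
  - by move=> d a z z' _ hz _ hz'; rewrite linearP; apply: klr_deg_lin.
  - by move=> d nu z _ hz; rewrite linearZ /=; apply: klr_degE.
  - by move=> d k z _ hz; rewrite linearZ /= addrAC; apply: klr_degX.
  - by move=> d mu i j mu' z _ hz; rewrite linearZ /= addrAC; apply: klr_degP.
(* The target has a single degree, so the image is a graded submodule; it contains the nonzero
   vector of a concatenated word. *)
pose U (t : Mg) := exists z, f z = t.
have Ugr : klr_graded_submod U.
  split=> [|a t t' [z <-] [z' <-]|t ht].
  - by exists 0; rewrite raddf0.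
  - by exists (a *: z + z'); rewrite linearP.
  exists [:: dg], (fun d => if d == dg then t else 0).
  split; last by rewrite big_seq1 eqxx.
  move=> d; case: eqP => [->|_]; first by split.
  by split; [apply: klr_deg0 | exists 0; rewrite raddf0].
have [_ /(_ _ Ugr)[h|h]] := simple; last by move=> t; apply: h.
exfalso; have := basis_neq0 bg (qcat qb qa).
rewrite -glue_basis // -conv_lift_sym -fpi => /eqP; apply; apply: h.
by eexists.
Qed.

End ConvolutionMap.

Section WeightOfQuotient.
Variables (K : fieldType) (n : nat) (eps : 'I_n -> 'I_n -> K).
Local Notation gE := (@gE K n).

(** The symbols [conv_sym u w] generate the product, so one of them has nonzero image, and some
    idempotent e(xi) does not kill this image. On a symbol, e(xi) acts by cutting xi into its first
    [mb] and its last [ma] letters. *)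
Lemma conv_weight mb ma mg (Mb : klr_mod eps mb) (Ma : klr_mod eps ma)
    (Mg : klr_mod eps mg) (f : {linear conv Mb Ma -> Mg}) (t0 : Mg) :
  mg = (mb + ma)%N -> (forall t, exists z, f z = t) -> t0 != 0 ->
  exists nu nu' u w, [/\ gE nu *: u != 0 :> Mb, gE nu' *: w != 0 :> Ma
    & exists t, gE (nu ++ nu') *: t != 0 :> Mg].
Proof.
move=> emg fsurj t00.
have fZ a t : f (a *: t) = a *: f t by rewrite linearZ.
have pi0 : quot_pi (conv_rel (M:=Mb) (N:=Ma)) 0 = 0.
  by rewrite -[0 in LHS](scale0r (0 : conv_free Mb Ma)) -quot_piZ; apply: scale0r.
have [u [w fuw]] : exists u w, f (conv_pi (conv_sym u w)) != 0.
  apply/not_existsP => h.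
  have h' u w : f (conv_pi (conv_sym u w)) = 0.
    apply/eqP/negPn/negP => ne; apply: (h u); by exists w.
  case/eqP: t00; have [z <-] := fsurj t0.
  rewrite -[z]quot_piK; set y := repr _.
  have pZ (a : klr_free K n) (t : conv_free Mb Ma) :
      conv_pi (a *: t) = a *: conv_pi t by rewrite /conv_pi -quot_piZ.
  have -> : y = \sum_(k <- msupp y) y@_k *: conv_sym k.1 k.2.
    rewrite {1}[y]monalgE; apply: eq_bigr => -[u w] _.
    by apply/malgP => k; rewrite mcoeffZ !mcoeffU mulrnAr mulr1.
  elim/big_rec: _ => [|k t _ IH].
    by rewrite pi0 raddf0.
  rewrite quot_piD; apply: etrans (raddfD f _ _) _.
  apply: etrans (congr2 +%R _ IH) (addr0 _).
  apply: etrans (congr1 f (pZ _ _)) _; apply: etrans (fZ _ _) _.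
  by apply: etrans (congr1 (fun z => _ *: z) (h' _ _)) _; apply: scaler0.
have : f (conv_pi (conv_sym u w))
    = \sum_(xi : mg.-tuple 'I_n) gE xi *: f (conv_pi (conv_sym u w)).
  exact: klr_E1.
move=> e; have [xi hxi] : exists xi : mg.-tuple 'I_n,
    gE xi *: f (conv_pi (conv_sym u w)) != 0.
  apply/not_existsP => h; case/eqP: fuw; rewrite e big1 // => xi _.
  by apply/eqP/negPn/negP => /h.
exists (take mb xi), (drop mb xi), u, w.
have s1 : size (take mb xi) = mb by rewrite size_takel // size_tuple emg leq_addr.
have s2 : size (drop mb xi) = ma by rewrite size_drop size_tuple emg addKn.
have hE : gE xi *: f (conv_pi (conv_sym u w)) =
    f (conv_pi (conv_sym (gE (take mb xi) *: u) (gE (drop mb xi) *: w))).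
  apply: etrans (esym (fZ _ _)) _; congr (f _).
  rewrite [_ *: conv_pi _]quot_piZ; apply: quot_pi_eq; apply: Span_gen.
  by have := Conv_E u w s1 s2; rewrite cat_take_drop.
have L0 w' : conv_pi (conv_sym (0 : Mb) w') = 0 :> conv_sort Mb Ma.
  have : submod_span (@conv_rel _ _ eps _ _ Mb Ma) (conv_sym 0 w' - 0).
    have := Span_gen (@Conv_linl _ _ eps _ _ Mb Ma (-1) 0 0 w').
    by rewrite scaler0 addr0 (scaleN1r (1 : klr_free K n)) scaleN1r addNr.
  by move/quot_pi_eq => e0; apply: etrans e0 pi0.
have R0 u' : conv_pi (conv_sym u' (0 : Ma)) = 0 :> conv_sort Mb Ma.
  have : submod_span (@conv_rel _ _ eps _ _ Mb Ma) (conv_sym u' 0 - 0).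
    have := Span_gen (@Conv_linr _ _ eps _ _ Mb Ma (-1) u' 0 0).
    by rewrite scaler0 addr0 (scaleN1r (1 : klr_free K n)) scaleN1r addNr.
  by move/quot_pi_eq => e0; apply: etrans e0 pi0.
rewrite cat_take_drop; split.
- by apply: contraNneq hxi => e0; rewrite hE e0 L0 raddf0.
- by apply: contraNneq hxi => e0; rewrite hE e0 R0 raddf0.
by eexists; exact: hxi.
Qed.

End WeightOfQuotient.

(** * The modules S_Q: admissible weights and surjections *)

Section RootModules.
Variables (K : fieldType) (n : nat) (eps : 'I_n -> 'I_n -> K) (Q : rel 'I_n).
Hypothesis qQ : dynkin_quiver Q.
Variable w : seq 'I_n.
Hypotheses (wlong : reduced_longest w) (wQ : adapted Q w).
Local Notation gE := (@gE K n).

Let rw : reduced w. Proof. by case: wlong. Qed.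

(** The summands of [rootn n x z] cut at [y], named so that the first is the smaller one for every
    adapted reduced word of the longest element. *)
Definition fst_root x y z := if arrow_right Q y then rootn n x y else rootn n y z.
Definition snd_root x y z := if arrow_right Q y then rootn n y z else rootn n x y.

Lemma fst_snd_root x y z : fst_root x y z + snd_root x y z = rootn n x z.
Proof.
by rewrite /fst_root /snd_root; case: ifP => _;
   rewrite ?root_add // addrC root_add.
Qed.

Lemma fst_snd_lt x y z : (x < y)%N -> (y < z <= n)%N ->
  root_lt w (fst_root x y z) (snd_root x y z).
Proof.
move=> xy yz.
have m1 : (x, y) \in rseq w by apply: rseq_mem => //; lia.
have m2 : (y, z) \in rseq w by apply: rseq_mem => //; lia.
have := adapted_order qQ rw wQ xy yz m1 m2.
rewrite /fst_root /snd_root; case: ifP => _ h; apply/root_lt_rindex => //; lia.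
Qed.

(* Choose the pair with the largest first component. *)
Lemma minimal_pair_exists x z : (x.+1 < z <= n)%N -> exists y,
  (x < y < z)%N /\ minimal_pair w (fst_root x y z) (snd_root x y z) (rootn n x z).
Proof.
move=> xz; have x1n : (x.+1 < n)%N by lia.
pose ix (y : 'I_n) := index (fst_root x y z) (root_seq w).
pose P := [pred y : 'I_n | (x < y < z)%N].
have P0 : P (Ordinal x1n) by rewrite /=; lia.
case: (@arg_maxnP _ (Ordinal x1n) P ix P0) => y hy ymax.
exists y; split=> //; have [xy yz] := andP hy.
have yz' : (y < z <= n)%N by lia.
split; [by rewrite fst_snd_root | exact: fst_snd_lt |].
move=> [a [b [e aa ag gb _]]].
have pos c : c \in root_seq w -> posroot c.
  rewrite root_seqE => /mapP[p hp ->]; apply/posrootP; exists p.1, p.2.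
  by split=> //; [apply: rseq_pos rw hp | case: (rseq_le hp)].
have [pa pb] : posroot a /\ posroot b.
  by case: ag => ha _ _; case: gb => _ hb _; split; apply: pos.
have pg : posroot (a + b) by rewrite -e; apply/posrootP; exists x, z; split=> //; lia.
have [x' [y' [z' [xy' yz'' h]]]] := posroot_add pa pb pg.
have e2 : rootn n x z = rootn n x' z'.
  by rewrite e; case: h => -[-> ->]; rewrite ?root_add // addrC root_add.
have [ex ez] : x = x' /\ z = z' by apply: root_inj e2; lia.
subst x' z'.
have y'n : (y' < n)%N by lia.
have lt_ab : (index a (root_seq w) < index b (root_seq w))%N.
  by case: ag => _ _ h1; case: gb => _ _ h2; apply: ltn_trans h2.
(* As [a] precedes [b], it is the first summand at the cut [y']. It also comes after the first
   summand at [y], against the maximal choice of [y]. *)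
have fa : a = fst_root x y' z.
  case: (fst_snd_lt xy' yz'') => _ _; rewrite /fst_root /snd_root.
  by case: ifP h => _ [[ea eb]|[ea eb]] //; rewrite -ea -eb => hlt;
     have := ltn_trans hlt lt_ab; rewrite ltnn.
have hy' : P (Ordinal y'n) by rewrite /=; lia.
by have := ymax _ hy'; rewrite /ix /= -fa /geq /= leqNgt; case: aa => _ _ ->.
Qed.

Variable S : root_modules eps.
Hypothesis SQ : is_S_word w S.

Lemma S_basis x z nu u : (x < z <= n)%N -> qword Q x z nu ->
  gE nu *: (u : S (rootn n x z)) != 0 ->
  exists v co, @klr_basis K n eps Q _ (S (rootn n x z)) x z v co.
Proof.
move=> xz q h.
have [|gr _ wt simple] := S_word_simple SQ (b := rootn n x z).
  by apply/posrootP; exists x, z; split=> //; lia.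
by apply: (klr_basis_exists qQ _ gr wt simple q h); lia.
Qed.

(** Induction over a minimal pair: one admissible weight gives a basis of each smaller module, hence
    all their weights are admissible, and the quotient of the convolution product has a
    concatenation of two of them. *)
Lemma S_has_qword x z : (x < z <= n)%N ->
  exists nu u, qword Q x z nu /\ gE nu *: (u : S (rootn n x z)) != 0.
Proof.
move: {2}(z - x)%N (leqnn (z - x)) => d.
elim: d x z => [|d IH] x z hd xz; first by lia.
have pxz : posroot (rootn n x z) by apply/posrootP; exists x, z; split=> //; lia.
have [gr _ wt simple] := S_word_simple SQ pxz.
have [t0 t00] : exists u : S (rootn n x z), u != 0 by case: simple.
have [z1|z1] := eqVneq z x.+1.
  have [nu hnu] : exists nu, gE nu *: t0 != 0.
    apply/not_existsP => h; case/eqP: t00; rewrite (klr_E1 t0) big1 // => nu _.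
    by apply/eqP/negPn/negP => /h.
  exists nu, t0; split=> //.
  have ew := klr_E_wt wt hnu.
  have [|_ mem] := word_wt_root _ ew; first by lia.
  apply/andP; split; first by rewrite ew.
  apply/followsP => c d'; rewrite !mem => cd hc hd'.
  have ecd : c = d' by apply: ord_inj; lia.
  by rewrite -ecd in cd; have [_] := qQ c c; rewrite cd.
have [|y [xyz mp]] := @minimal_pair_exists x z; first by lia.
have [_ [f [_ fsurj] _]] := S_word_pair SQ pxz mp.
have emg : height (rootn n x z)
    = (height (snd_root x y z) + height (fst_root x y z))%N.
  by rewrite /snd_root /fst_root; case: ifP => _; rewrite !height_root //; lia.
have [nu [nu' [u [u' [hu hu' [t ht]]]]]] := conv_weight emg fsurj t00.
exists (nu ++ nu'), t; split=> //; apply: (@qword_cat _ _ qQ x y z); try lia.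
have IH' p q xi (v : S (rootn n p q)) : (p < q <= n)%N -> (q - p <= d)%N ->
    gE xi *: v != 0 -> qword Q p q xi.
  move=> pq hpq hv; have [xi' [v' [q' hv']]] := IH _ _ hpq pq.
  by have [b [co bas]] := S_basis pq q' hv'; apply: basis_wt bas _ _ hv.
move: u u' hu hu'; rewrite /snd_root /fst_root; case: ifP => _ u u' hu hu';
  by apply/andP; split; [apply: IH' hu; lia | apply: IH' hu'; lia].
Qed.

Theorem S_quiver_epi x y z : (x < y)%N -> (y < z <= n)%N ->
  exists f : {linear conv (S (snd_root x y z)) (S (fst_root x y z))
                     -> S (rootn n x z)}, klr_epi f.
Proof.
move=> xy yz.
have B p q : (p < q <= n)%N -> exists nu v co, qword Q p q nu /\
    @klr_basis K n eps Q _ (S (rootn n p q)) p q v co.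
  move=> pq; have [nu [u [hq hu]]] := S_has_qword pq.
  by have [v [co bas]] := S_basis pq hq hu; exists nu, v, co.
have xz : (x < z <= n)%N by lia.
have pxz : posroot (rootn n x z) by apply/posrootP; exists x, z; split=> //; lia.
have [gr _ _ simple] := S_word_simple SQ pxz.
have [_ [vg [cg [_ bg]]]] := B _ _ xz.
have xy' : (x < y <= n)%N by lia.
have [nu1 [v1 [c1 [q1 b1]]]] := B _ _ xy'.
have [nu2 [v2 [c2 [q2 b2]]]] := B _ _ yz.
have qc := @qword_cat _ _ qQ x y z _ _ xy yz.
have h1 := height_root (n := n) (x := x) (y := y).
have h2 := height_root (n := n) (x := y) (y := z).
have h3 := height_root (n := n) (x := x) (y := z).
rewrite /snd_root /fst_root; case: ifP qc => _ qc.
  apply: (conv_epi_exists qQ b2 b1 bg _ _ _ _ gr simple q2 q1); try lia.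
  by move=> nu nu' q q'; apply: qc; rewrite q q'.
apply: (conv_epi_exists qQ b1 b2 bg _ _ _ _ gr simple q1 q2); try lia.
by move=> nu nu' q q'; apply: qc; rewrite q q'.
Qed.

End RootModules.

Theorem corollary3p5 (R : realType) (K : closedFieldType)
    (iota : {rmorphism {fraction {poly R[i]}} -> K})
    (Kclosure : is_alg_closure iota)
    (n : nat) (n_gt0 : (0 < n)%N)
    (Q : rel 'I_n) (Qquiver : dynkin_quiver Q)
    (c : seq 'I_n) (cQ : adapted_coxeter Q c)
    (xi : 'I_n -> int) (xiQ : height_function Q xi)
    (eps : 'I_n -> 'I_n -> K) (eps_signs : klr_signs eps)
    (S : root_modules eps) (SQ : is_S_quiver Q S) :
  let q := q_of iota in
  let V := V_quiver q Q c xi in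
  (forall a b : 'rV[int]_n,
     posroot a -> posroot b -> posroot (a + b) -> ar_lt Q c xi a b ->
     (exists f : {linear conv (S b) (S a) -> S (a + b)}, klr_epi f) /\
     [/\ in_CQ q Q c xi (uq_tensor (V b) (V a)), in_CQ q Q c xi (V (a + b))
       & uq_epi (uq_tensor (V b) (V a)) (V (a + b))]) /\
  (forall b : 'rV[int]_n, posroot b ->
     exists s : seq 'I_n,
       size s = height b /\
       uq_epi (uq_tensor_seq [seq V (alpha i) | i <- s]) (V b)).
Proof.
move=> q V.
have q0 : q != 0 by rewrite fmorph_eq0 tofrac_eq0 polyX_eq0.
have [w [wlong wQ Sw]] := SQ.
split=> [a b pa pb pab ab|b /posrootP[x [y [xy yn ->]]]]; last first.
  have [s [ss es]] :=
    V_quiver_simple_epi q0 n_gt0 Qquiver cQ xiQ (x := x) (y := y) ltac:(lia).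
  by exists s; rewrite height_root //; lia.
have C t : posroot t -> in_CQ q Q c xi (V t) := @CQ_V _ q _ Q c xi t.
suff [H1 H2] : (exists f : {linear conv (S b) (S a) -> S (a + b)}, klr_epi f)
    /\ uq_epi (uq_tensor (V b) (V a)) (V (a + b)).
  by split=> //; split=> //; [apply: CQ_tensor; apply: C | apply: C].
have [x [y [z [xy yz h]]]] := posroot_add pa pb pab.
have [l1 l2] := ar_lt_arrow_right Qquiver cQ xiQ xy yz.
have := S_quiver_epi Qquiver wlong wQ Sw xy yz.
have := V_quiver_epi q0 n_gt0 Qquiver cQ xiQ xy yz.
rewrite /snd_root /fst_root.
(* The comparison [ab] fixes the orientation at [y], which selects the same branch in both
   surjections. *)
case: h => -[ea eb]; subst a b.
  by rewrite (l1 ab) root_add.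
by rewrite (negbTE (l2 ab)) addrC root_add.
Qed.
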